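(* Let $S$ and $T$ be dualizable operator systems. (a) Suppose that $\phi\in \mathrm{CB}^+(S,T)$. There is a unique $\phi^{\mathrm d}\in\mathrm{CB}^+_w(T^{\mathrm d},S^{\mathrm d})$ satisfying $\phi^{\mathrm d}\circ\mu_{T^*}=\mu_{S^*}\circ\phi^*$. If, in addition, $\phi\in\mathrm{CC}^+(S,T)$, then $\phi^{\mathrm d}\in\mathrm{CC}^+_w(T^{\mathrm d},S^{\mathrm d})$. (b) The assignment $\phi\mapsto\phi^{\mathrm d}$ is a bijection from $\mathrm{CB}^+(S,T)$ onto $\mathrm{CB}^+_w(T^{\mathrm d},S^{\mathrm d})$. (c) If $\phi:S\to T$ is a MOS isomorphism, then $\phi^{\mathrm d}$ is a weak-$*$-homeomorphic MOS isomorphism. Conversely, any weak-$*$-continuous MOS isomorphism $\chi:T^{\mathrm d}\to S^{\mathrm d}$ is of the form $\phi^{\mathrm d}$ for a MOS isomorphism $\phi: S\to T$. (d) For any dualizable dual operator system $D$, there is a dualizable operator system $S_0$ and a weak-$*$-homeomorphic MOS isomorphism from $S_0^{\mathrm d}$ onto $D$. (e) Suppose that both $\tau_S\circ\kappa_S$ and $\tau_T\circ\kappa_T$ are completely isometric, and $\chi\in\mathrm{CC}^+_w(T^{\mathrm d},S^{\mathrm d})$. Then there exists $\phi\in\mathrm{CC}^+(S,T)$ satisfying $\chi=\phi^{\mathrm d}$. If, in addition, $\chi$ is a completely isometric MOS isomorphism, then $\phi$ is a completely isometric MOS isomorphism.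
   Context: Matrices. For a complex vector space $X$ identify $M_n(X)\subseteq M_{n+1}(X)$ (upper left corner) and put $M_\infty(X)=\bigcup_n M_n(X)$. For linear $\varphi:X\to Y$, $\varphi^{(\infty)}([x_{i,j}])=[\varphi(x_{i,j})]$ on $M_\infty(X)$ and $\varphi^{(n)}=\varphi^{(\infty)}|_{M_n(X)}$. An operator space is a complex vector space $X$ with a norm on $M_\infty(X)$ (a matrix norm) such that $\|\sum_k a_k^*x_kb_k\|\le\|\sum_k a_k^*a_k\|^{1/2}\|\sum_k b_k^*b_k\|^{1/2}\max_k\|x_k\|$ for all finite families $a_k,b_k\in M_\infty(\mathbb{C})$, $x_k\in M_\infty(X)$. A linear map $\varphi$ between operator spaces is completely bounded / a complete contraction / a complete isometry / a complete embedding if $\varphi^{(\infty)}$ is bounded / contractive / isometric / bounded and bounded below ($\inf_{\|x\|=1}\|\varphi^{(\infty)}(x)\|>0$). SMOS and MOS. A semi-matrix ordered operator space (SMOS) is an operator space $X$ with an involution $*$ such that $[x_{i,j}]\mapsto[x_{j,i}^*]$ is isometric on $M_\infty(X)$, and a norm-closed subset (matrix cone) $M_\infty(X)^+\subseteq M_\infty(X)^{\mathrm{sa}}:=\{x:x^*=x\}$ with $\sum_k a_k^*x_ka_k\in M_\infty(X)^+$ for all finite families $a_k\in M_\infty(\mathbb{C})$, $x_k\in M_\infty(X)^+$. It is a MOS if $M_\infty(X)^+\cap -M_\infty(X)^+=\{0\}$. For SMOSs, a $*$-preserving linear map $\varphi:X\to Y$ is completely positive if $\varphi^{(\infty)}(M_\infty(X)^+)\subseteq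 M_\infty(Y)^+$; completely order monomorphic if it is injective and, for $x\in M_\infty(X)^{\mathrm{sa}}$, $x\in M_\infty(X)^+\Leftrightarrow\varphi^{(\infty)}(x)\in M_\infty(Y)^+$; a MOS isomorphism if it is a bijective completely order monomorphic complete embedding. $\mathrm{CB}^+(X,Y)$ (resp. $\mathrm{CC}^+(X,Y)$) denotes the set of completely positive completely bounded maps (resp. completely positive complete contractions). An operator system is a self-adjoint subspace (not necessarily containing the identity) of some $\mathcal{L}(\mathfrak{H})$ (bounded operators on a Hilbert space) with the induced matrix norm, involution and matrix cone. A quasi-operator system is a MOS admitting a MOS isomorphism onto an operator system. Duals. For $f=[f_{i,j}]\in M_\infty(X^* )$ let $\theta_f(x)=[f_{i,j}(x)]$ ($x\in X$). The dual space $X^*$ of a SMOS $X$ is always the SMOS with involution $f^*(x)=\overline{f(x^* )}$, i.e. $[f_{i,j}]^*=[(f_{j,i})^*]$, dual matrix norm $\|f\|=\sup\{\|\theta_f^{(\infty)}(x)\|:x\in M_\infty(X),\|x\|\le1\}$ and dual matrix cone $M_\infty(X^* )^+=\{f\in M_\infty(X^* )^{\mathrm{sa}}:\theta_f\text{ is completely positive}\}$. $\kappa_X:X\to X^{**}$ is the canonical embedding; $\phi^*$ is the dual map of $\phi$. Dual objects. A SMOS (resp. MOS) $D$ is a dual SMOS (resp. dual MOS) if there is a $*$-invariant norm-closed subspace $D_\#\subseteq D^*$ (a predual) such that the canonical map $D\to(D_\#)^*$ is a surjective complete isometry, and $M_\infty(D)^+$ is closed under the weak-$*$ topology $\sigma(M_\infty(D),M_\infty(D_\#))$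 (entrywise $\sigma(D,D_\#)$-convergence). For complete $X$, $X^*$ is a dual SMOS with predual $X$. A dual MOS $D$ is a dual quasi-operator system (resp. dual operator system) if there is a weak-$*$-homeomorphic (resp. weak-$*$-homeomorphic completely isometric) MOS isomorphism from $D$ onto a weak-$*$-closed (self-adjoint) subspace of some $\mathcal{L}(\mathfrak{H})$. For dual operator systems $D,E$, $\mathrm{CB}^+_w(D,E)$ (resp. $\mathrm{CC}^+_w(D,E)$) is the set of weak-$*$-continuous completely positive completely bounded maps (resp. complete contractions). The map $\mu_D$. For a dual MOS $D$ with predual $D_\#$, let $\mathcal{WQ}^D_n$ be the set of $\sigma(D,D_\#)$-continuous maps in $\mathrm{CC}^+(D,M_n(\mathbb{C}))$, let $N(D)=\bigoplus^{\ell_\infty}_{n\in\mathbb{N}}\ell_\infty(\mathcal{WQ}^D_n;M_n(\mathbb{C}))$ (a von Neumann algebra), and let $\mu_D:D\to N(D)$ be $\mu_D(x)=(\mu_D(x)_n)_n$ with $\mu_D(x)_n(\varphi)=\varphi(x)$. Dualizability. A quasi-operator system $T$ is dualizable if the dual SMOS $T^*$ (with predual $T$; so $T$ is complete) is a dual quasi-operator system. In that case $T^{\mathrm d}:=\mu_{T^*}(T^* )\subseteq N(T^* )$, which is weak-$*$-closed and is equipped with the dual operator system structure induced from $N(T^* )$; $\mu_{T^*}:T^*\to T^{\mathrm d}$ is a weak-$*$-homeomorphic MOS isomorphism, and $T^{\mathrm d}$ is again dualizable. The canonical bijection is $\tau_T:=\mu_{(T^{\mathrm d})^*}\circ(\mu_{T^*}^*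 )^{-1}:T^{**}\to(T^{\mathrm d})^{\mathrm d}$, where $\mu_{T^*}^*:(T^{\mathrm d})^*\to T^{**}$ is the dual map of $\mu_{T^*}:T^*\to T^{\mathrm d}$. *)

(* Defs.v *)
From HB Require Import structures.
From mathcomp Require Import all_boot all_order all_algebra.
From mathcomp Require Import complex lra.
From mathcomp Require Import all_classical all_reals all_analysis.

Set Implicit Arguments.
Unset Strict Implicit.
Unset Printing Implicit Defensive.

Import Order.TTheory GRing.Theory Num.Theory numFieldNormedType.Exports.

Local Open Scope classical_set_scope.
Local Open Scope ring_scope.
Local Open Scope complex_scope.
Local Open Scope sesquilinear_scope.

(* Norms of complex normed spaces take their values in R[i]; Rnorm is the
   same number seen in R. *)
Definition Rnorm (R : realType) (V : normedZmodType R[i]) (v : V) : R :=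
  complex.Re `|v|.

Section Matrices.
Variable R : realType.
Local Notation C := R[i].

Definition vnorm m (v : 'cV[C]_m) : R :=
  Num.sqrt (\sum_i Rnorm (v i 0) ^+ 2).

Definition mxnorm m n (A : 'M[C]_(m, n)) : R :=
  sup [set vnorm (A *m v) | v in [set v : 'cV[C]_n | vnorm v <= 1]].

(* Over R[i], 0 <= z says that z is real and nonnegative. *)
Definition psdmx n (A : 'M[C]_n) : Prop :=
  forall v : 'cV[C]_n, 0 <= (v ^t* *m A *m v) 0 0.

Lemma Rnorm_ge0 (V : normedZmodType C) (v : V) : 0 <= Rnorm v.
Proof. by have := normr_ge0 v; rewrite /Rnorm lecE /= => /andP[]. Qed.

Lemma RnormE (V : normedZmodType C) (v : V) : (Rnorm v)%:C = `|v|.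
Proof.
rewrite /Rnorm; have := normr_ge0 v; rewrite lecE => /andP[/eqP /= + _].
by case: `|v| => a b /= ->.
Qed.

Lemma RnormD (V : normedZmodType C) (u v : V) :
  Rnorm (u + v) <= Rnorm u + Rnorm v.
Proof. by rewrite -lecR rmorphD /= !RnormE; exact: ler_normD. Qed.

Lemma RnormM (a b : C) : Rnorm (a * b) = Rnorm a * Rnorm b.
Proof.
by apply: (@complexI R); rewrite rmorphM /= !RnormE normrM.
Qed.

Lemma RnormZ (V : normedModType C) (a : C) (v : V) :
  Rnorm (a *: v) = Rnorm a * Rnorm v.
Proof. by apply: (@complexI R); rewrite rmorphM /= !RnormE normrZ. Qed.

Lemma vnorm_ge0 m (v : 'cV[C]_m) : 0 <= vnorm v.
Proof. exact: sqrtr_ge0. Qed.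

Lemma vnormE m (v : 'cV[C]_m) : vnorm v ^+ 2 = \sum_i Rnorm (v i 0) ^+ 2.
Proof. by rewrite sqr_sqrtr// sumr_ge0// => i _; exact: sqr_ge0. Qed.

Lemma vnormD m (u v : 'cV[C]_m) : vnorm (u + v) <= 2 * (vnorm u + vnorm v).
Proof.
have h : 0 <= 2 * (vnorm u + vnorm v) by rewrite mulr_ge0// addr_ge0// vnorm_ge0.
rewrite -(ler_pXn2r (n := 2))// ?nnegrE ?vnorm_ge0// vnormE.
apply: (@le_trans _ _ (2 * vnorm u ^+ 2 + 2 * vnorm v ^+ 2)); last first.
  have := vnorm_ge0 u; have := vnorm_ge0 v; nra.
rewrite !vnormE !mulr_sumr -big_split /=; apply: ler_sum => i _; rewrite mxE.
apply: (@le_trans _ _ ((Rnorm (u i 0) + Rnorm (v i 0)) ^+ 2)).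
  by rewrite ler_pXn2r ?nnegrE ?addr_ge0 ?Rnorm_ge0 ?RnormD.
by have := sqr_ge0 (Rnorm (u i 0) - Rnorm (v i 0)); nra.
Qed.

Lemma vnormZ m (a : C) (v : 'cV[C]_m) : vnorm (a *: v) = Rnorm a * vnorm v.
Proof.
rewrite /vnorm -[Rnorm a in RHS]ger0_norm ?Rnorm_ge0// -sqrtr_sqr.
rewrite -sqrtrM ?sqr_ge0// mulr_sumr; congr Num.sqrt.
by apply: eq_bigr => i _; rewrite mxE RnormM exprMn.
Qed.

Lemma vnorm_coord m (v : 'cV[C]_m) i : Rnorm (v i 0) <= vnorm v.
Proof.
rewrite -(ler_pXn2r (n := 2))// ?nnegrE ?vnorm_ge0 ?Rnorm_ge0// vnormE.
by rewrite (bigD1 i)//= lerDl sumr_ge0// => j _; exact: sqr_ge0.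
Qed.

Lemma mxnorm_has_sup m n (A : 'M[C]_(m, n)) :
  has_sup [set vnorm (A *m v) | v in [set v : 'cV[C]_n | vnorm v <= 1]].
Proof.
have vn0 k : vnorm (0 : 'cV[C]_k) = 0.
  by rewrite -[0](scale0r 0) vnormZ /Rnorm normr0 mul0r.
split; first by exists (vnorm (A *m 0)), 0 => //=; rewrite vn0.
exists (Num.sqrt (\sum_i (\sum_j Rnorm (A i j)) ^+ 2)) => _ [v /= v1 <-].
rewrite ler_sqrt; last by apply: sumr_ge0 => i _; exact: sqr_ge0.
apply: ler_sum => i _; rewrite ler_pXn2r// ?nnegrE ?Rnorm_ge0//; last first.
  by apply: sumr_ge0 => j _; exact: Rnorm_ge0.
rewrite mxE; elim/big_rec2: _ => [|j y x _ le_xy]; first by rewrite /Rnorm normr0.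
apply: le_trans (RnormD _ _) _; apply: lerD => //; rewrite RnormM.
by apply: ler_piMr; [exact: Rnorm_ge0|exact: le_trans (vnorm_coord _ _) v1].
Qed.

Lemma mxnorm_ub m n (A : 'M[C]_(m, n)) v :
  vnorm v <= 1 -> vnorm (A *m v) <= mxnorm A.
Proof.
move=> v1; apply: ub_le_sup; last by exists v.
by case: (mxnorm_has_sup A).
Qed.

Lemma mxnormZD m n (a : C) (A B : 'M[C]_(m, n)) :
  mxnorm (a *: A + B) <= 2 * (Rnorm a * mxnorm A + mxnorm B).
Proof.
apply: sup_le_ub; first by case: (mxnorm_has_sup (a *: A + B)).
move=> _ [v /= v1 <-]; rewrite mulmxDl -scalemxAl.
apply: le_trans (vnormD _ _) _; rewrite ler_pM2l// vnormZ.
by apply: lerD; [apply: ler_wpM2l; rewrite ?Rnorm_ge0|]; rewrite ?mxnorm_ub.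
Qed.

Lemma mxnorm0 m n : mxnorm (0 : 'M[C]_(m, n)) <= 0.
Proof.
apply: sup_le_ub; first by case: (mxnorm_has_sup (0 : 'M[C]_(m, n))).
move=> _ [v /= _ <-]; rewrite mul0mx /vnorm big1 ?sqrtr0// => k _.
by rewrite mxE /Rnorm normr0 expr0n.
Qed.

End Matrices.

(* A complex space with an involution, a norm and a cone on each M_n, not yet
   subject to any axiom: see is_smos. *)
Record modata (R : realType) := MOData {
  mo_car :> lmodType R[i];
  star : mo_car -> mo_car;
  mnorm : forall n, 'M[mo_car]_n -> R;
  mcone : forall n, set 'M[mo_car]_n }.

Section Smos.
Variables (R : realType).
Local Notation C := R[i].

Definition nrm (X : modata R) (x : X) : R := mnorm (const_mx x : 'M[X]_1).

Definition mstar (X : modata R) n (x : 'M[X]_n) : 'M[X]_n := map_mx (@star R X) x^T.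

Definition mxact (X : modata R) n (a : 'M[C]_n) (x : 'M[X]_n) (b : 'M[C]_n) :
    'M[X]_n :=
  \matrix_(i, j) \sum_k \sum_l (a i k * b l j) *: x k l.

(* the inclusion of M_n(X) in M_{n+1}(X) *)
Definition corner (X : modata R) n (x : 'M[X]_n) : 'M[X]_(n + 1) :=
  block_mx x 0 0 0.

(* A norm (a cone) on M_oo(X) is a family of norms (cones) on the M_n(X)
   compatible with corner; a finite family in M_oo(X) lies in some M_n(X). *)
Definition is_operator_space (X : modata R) : Prop :=
  [/\ forall n (x y : 'M[X]_n), mnorm (x + y) <= mnorm x + mnorm y,
      forall n (a : C) (x : 'M[X]_n),
        mnorm (map_mx ( *:%R a) x) = Rnorm a * mnorm x,
      forall n (x : 'M[X]_n), mnorm x = 0 -> x = 0,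
      forall n (x : 'M[X]_n), mnorm (corner x) = mnorm x &
      forall n k (a b : 'I_k -> 'M[C]_n) (x : 'I_k -> 'M[X]_n),
        mnorm (\sum_i mxact ((a i)^t*) (x i) (b i)) <=
          Num.sqrt (mxnorm (\sum_i ((a i)^t*) *m a i)) *
          Num.sqrt (mxnorm (\sum_i ((b i)^t*) *m b i)) *
          \big[Num.max/0]_i mnorm (x i)].

Definition is_involution (X : modata R) : Prop :=
  [/\ forall x y : X, star (x + y) = star x + star y,
      forall (a : C) (x : X), star (a *: x) = a^* *: star x &
      forall x : X, star (star x) = x].

(* With p the projection onto the first n coordinates and y in M_oo(X)^+, p y p
   is positive and at least as close to x in M_n(X) as y is; so closedness in M_oo(X) is closedness in each M_n(X). *)
Definition is_matrix_cone (X : modata R) : Prop :=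
  [/\ forall n (x : 'M[X]_n), mcone x -> mstar x = x,
      forall n (x : 'M[X]_n), mcone (corner x) <-> mcone x,
      forall n (x : 'M[X]_n),
        (forall e : R, 0 < e -> exists2 y, mcone y & mnorm (x - y) < e) ->
        mcone x &
      forall n k (a : 'I_k -> 'M[C]_n) (x : 'I_k -> 'M[X]_n),
        (forall i, mcone (x i)) -> mcone (\sum_i mxact ((a i)^t*) (x i) (a i))].

Definition is_smos (X : modata R) : Prop :=
  [/\ is_operator_space X, is_involution X,
      forall n (x : 'M[X]_n), mnorm (mstar x) = mnorm x & is_matrix_cone X].

Definition is_mos (X : modata R) : Prop :=
  is_smos X /\ forall n (x : 'M[X]_n), mcone x -> mcone (- x) -> x = 0.

End Smos.

Section Maps.
Variables (R : realType) (X Y : modata R).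
Implicit Types phi : X -> Y.

Definition completely_bounded phi : Prop :=
  exists M : R, forall n (x : 'M[X]_n), mnorm (map_mx phi x) <= M * mnorm x.

Definition complete_contraction phi : Prop :=
  forall n (x : 'M[X]_n), mnorm (map_mx phi x) <= mnorm x.

Definition complete_isometry phi : Prop :=
  forall n (x : 'M[X]_n), mnorm (map_mx phi x) = mnorm x.

Definition complete_embedding phi : Prop :=
  completely_bounded phi /\
  exists2 c : R, 0 < c & forall n (x : 'M[X]_n), c * mnorm x <= mnorm (map_mx phi x).

Definition star_linear phi : Prop :=
  linear phi /\ forall x, phi (star x) = star (phi x).

Definition completely_positive phi : Prop :=
  star_linear phi /\ forall n (x : 'M[X]_n), mcone x -> mcone (map_mx phi x).

Definition completely_order_monomorphic phi : Prop :=
  [/\ star_linear phi, injective phi &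
      forall n (x : 'M[X]_n), mstar x = x ->
        (mcone x <-> mcone (map_mx phi x))].

Definition mos_iso phi : Prop :=
  [/\ bijective phi, completely_order_monomorphic phi & complete_embedding phi].

Definition CBp : set (X -> Y) :=
  [set phi | completely_positive phi /\ completely_bounded phi].

Definition CCp : set (X -> Y) :=
  [set phi | completely_positive phi /\ complete_contraction phi].

End Maps.

Section Subspaces.
Variables (R : realType) (W : lmodType R[i]).

Record lspace := LSpace {
  lset :> set W;
  lset0 : lset 0;
  lsetZD : forall (a : R[i]) u v, lset u -> lset v -> lset (a *: u + v) }.

Record subl (V : lspace) := Subl { subl_val : W; subl_valP : subl_val \in lset V }.

Variable V : lspace.
HB.instance Definition _ := [isSub for @subl_val V].
HB.instance Definition _ := [Choice of subl V by <:].

Fact subl_closed : GRing.submod_closed (fun x => x \in lset V).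
Proof.
split; first by apply/mem_set; exact: lset0.
move=> a u v /set_mem Hu /set_mem Hv; apply/mem_set; exact: lsetZD.
Qed.

HB.instance Definition _ :=
  GRing.SubChoice_isSubLmodule.Build R[i] W _ (subl V) subl_closed.
End Subspaces.

Section SelfAdjointSubspaces.
Variables (R : realType) (X : modata R).

Record saspace := SASpace {
  sas_lspace :> lspace X;
  sas_star : forall x, lset sas_lspace x -> lset sas_lspace (star x) }.

Variable V : saspace.

Fact sub_star_subproof (x : subl V) : star (val x) \in lset V.
Proof. by apply/mem_set/sas_star/set_mem; exact: subl_valP. Qed.

Definition submo : modata R := {|
  mo_car := subl V;
  star := fun x => Subl (sub_star_subproof x);
  mnorm := fun n x => mnorm (map_mx val x);
  mcone := fun n => [set x | mcone (map_mx val x)] |}.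

End SelfAdjointSubspaces.

Section Dual.
Variable R : realType.
Local Notation C := R[i].

(* M_n(M_m(C)) is identified with M_nm(C). *)
Definition matmo (m : nat) : modata R := {|
  mo_car := 'M[C]_m;
  star := fun a => a^t*;
  mnorm := fun n x => mxnorm (\mxblock_(i < n, j < n) x i j);
  mcone := fun n => [set x | psdmx (\mxblock_(i < n, j < n) x i j)] |}.

Variable X : modata R.

Definition bounded_functional : set (X -> C^o) :=
  [set f | linear f /\ exists M : R, forall x, Rnorm (f x) <= M * nrm x].

Fact bounded_functional0 : bounded_functional 0.
Proof.
split; last by exists 0 => x; rewrite mul0r /Rnorm normr0.
by move=> a u v /=; rewrite scaler0 addr0.
Qed.

Fact bounded_functionalZD (a : C) f g :
  bounded_functional f -> bounded_functional g ->
  bounded_functional (a *: f + g).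
Proof.
move=> [lf [M fM]] [lg [N gN]]; split.
  move=> b u v; rewrite !fctE lf lg /= !scalerDr !scalerA [b * a]mulrC.
  by rewrite -!addrA; congr (_ + _); rewrite addrCA.
exists (Rnorm a * M + N) => x; rewrite mulrDl -mulrA.
apply: le_trans (RnormD _ _) _; apply: lerD => //=.
by rewrite [Rnorm _]RnormM ler_wpM2l// Rnorm_ge0.
Qed.

Definition dual_car : lmodType C :=
  subl (LSpace bounded_functional0 bounded_functionalZD).

Definition theta m (f : 'M[dual_car]_m) (x : X) : matmo m :=
  \matrix_(i, j) (val (f i j) x : C).

(* insubd 0 g is the element of the dual with underlying function g, or 0 if g
   is not a bounded functional, which does not occur when X is an SMOS. *)
Definition dual_star (f : dual_car) : dual_car :=
  insubd 0 (fun x : X => (val f (star x) : C)^* : C^o).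

Definition dual : modata R := {|
  mo_car := dual_car;
  star := dual_star;
  mnorm := fun m f =>
    sup [set r : R | exists n (x : 'M[X]_n),
           mnorm x <= 1 /\ r = mnorm (map_mx (theta f) x)];
  mcone := fun m =>
    [set f | map_mx dual_star f^T = f /\ completely_positive (theta f)] |}.

End Dual.

Section DualMaps.
Variable R : realType.
Local Notation C := R[i].

(* insubd as in dual_star; the value 0 does not occur for bounded phi *)
Definition dual_map (X Y : modata R) (phi : X -> Y) (g : dual Y) : dual X :=
  insubd (0 : dual X) (fun x => val g (phi x)).

Definition kappa (X : modata R) (x : X) : dual (dual X) :=
  insubd (0 : dual (dual X)) (fun f : dual X => val f x).

Definition norm_closed (X : modata R) (A : set X) : Prop :=
  forall x, (forall e : R, 0 < e -> exists2 y, A y & nrm (x - y) < e) -> A x.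

End DualMaps.

Section WeakStar.
Variable R : realType.
Local Notation C := R[i].

(* D with the topology sigma(D, F) *)
Definition wstar (D : modata R) (F : set (dual D)) : Type :=
  initial_topology (fun x : D =>
    (fun f : F => val (val f) x) : prod_topology (fun _ : F => C^o)).

HB.instance Definition _ (D : modata R) (F : set (dual D)) :=
  Uniform.on (wstar F).

Definition wcontinuous (D E : modata R) (F : set (dual D)) (G : set (dual E))
    (phi : D -> E) : Prop :=
  continuous (phi : wstar F -> wstar G).

Definition whomeo (D E : modata R) (F : set (dual D)) (G : set (dual E))
    (phi : D -> E) : Prop :=
  exists psi : E -> D,
    [/\ cancel phi psi, cancel psi phi, wcontinuous F G phi &
        wcontinuous G F psi].

Definition CBpw (D E : modata R) (F : set (dual D)) (G : set (dual E)) :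
    set (D -> E) := [set phi | CBp phi /\ wcontinuous F G phi].

Definition CCpw (D E : modata R) (F : set (dual D)) (G : set (dual E)) :
    set (D -> E) := [set phi | CCp phi /\ wcontinuous F G phi].

(* restrictions to V of the functionals in F *)
Definition restrict (D : modata R) (F : set (dual D)) (V : saspace D) :
    set (dual (submo V)) :=
  [set f | exists2 g, F g & forall x, val f x = val g (val x)].

(* the canonical map from D to the dual of F *)
Definition predual_map (D : modata R) (F : saspace (dual D)) (x : D) :
    dual (submo F) :=
  insubd (0 : dual (submo F)) (fun f : submo F => val (val f) x).

Definition is_dual_smos (D : modata R) (F : saspace (dual D)) : Prop :=
  [/\ is_smos D, norm_closed F,
      (forall g, exists x, predual_map F x = g),
      complete_isometry (predual_map F) &
      forall n, closed ([set x | mcone x] : set 'M[wstar F]_n)].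

Definition is_dual_mos (D : modata R) (F : saspace (dual D)) : Prop :=
  is_dual_smos F /\ is_mos D.

End WeakStar.

Arguments restrict {R D} F V _.

Section BoundedOperators.
Variable R : realType.
Local Notation C := R[i].

Record hilbert := Hilbert {
  hspace :> completeNormedModType C;
  ip : {dot hspace for @Num.conj C};
  ip_norm : forall v, ip v v = `|v| ^+ 2 }.

Variable H : hilbert.

Definition bounded_operator : set (H -> H) :=
  [set T | linear T /\ exists M : R, forall v, Rnorm (T v) <= M * Rnorm v].

Fact bounded_operator0 : bounded_operator 0.
Proof.
split; last by exists 0 => x; rewrite mul0r /Rnorm normr0.
by move=> a u v /=; rewrite scaler0 addr0.
Qed.

Fact bounded_operatorZD (a : C) S T :
  bounded_operator S -> bounded_operator T -> bounded_operator (a *: S + T).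
Proof.
move=> [lS [M SM]] [lT [N TN]]; split.
  move=> b u v; rewrite !fctE lS lT /= !scalerDr !scalerA [b * a]mulrC.
  by rewrite -!addrA; congr (_ + _); rewrite addrCA.
exists (Rnorm a * M + N) => x; rewrite mulrDl -mulrA.
apply: le_trans (RnormD _ _) _; apply: lerD => //=.
by rewrite RnormZ ler_wpM2l// Rnorm_ge0.
Qed.

Definition bop : lmodType C :=
  subl (LSpace bounded_operator0 bounded_operatorZD).

(* the norm of the n-fold Hilbert sum of H *)
Definition hnorm n (v : 'I_n -> H) : R :=
  Num.sqrt (\sum_i Rnorm (v i) ^+ 2).

Definition bop_amp n (x : 'M[bop]_n) (v : 'I_n -> H) : 'I_n -> H :=
  fun i => \sum_j val (x i j) (v j).

Definition BH : modata R := {|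
  mo_car := bop;
  star := fun S => xget 0 [set T : bop | forall u v, ip H (val S u) v = ip H u (val T v)];
  mnorm := fun n x =>
    sup [set hnorm (bop_amp x v) | v in [set v : 'I_n -> H | hnorm v <= 1]];
  mcone := fun n =>
    [set x | forall v : 'I_n -> H, 0 <= \sum_i ip H (bop_amp x v i) (v i)] |}.

(* the predual of BH, i.e. the functionals sum_k <. xi_k, eta_k> with
   square-summable (xi_k) and (eta_k) *)
Definition BH_predual : set (dual BH) :=
  [set f : dual BH | exists xi eta : nat -> H,
    [/\ cvgn (series (fun k => Rnorm (xi k) ^+ 2)),
        cvgn (series (fun k => Rnorm (eta k) ^+ 2)) &
        forall x : BH,
          series (fun k => ip H (val x (xi k)) (eta k) : C^o) @ \oo --> val f x]].

End BoundedOperators.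

Arguments BH_predual {R} H _.

Section MatrixSums.
Variable R : realType.
Local Notation C := R[i].

Section Product.
Variables (I : Type) (V : I -> lmodType C).

Definition dprod : Type := forall i, V i.
HB.instance Definition _ := gen_eqMixin dprod.
HB.instance Definition _ := gen_choiceMixin dprod.

Local Notation ext := functional_extensionality_dep.
Fact dprodA : associative (fun (x y : dprod) => (fun i => x i + y i) : dprod).
Proof. by move=> x y z; apply: ext => i; exact: addrA. Qed.
Fact dprodC : commutative (fun (x y : dprod) => (fun i => x i + y i) : dprod).
Proof. by move=> x y; apply: ext => i; exact: addrC. Qed.
Fact dprod0 :
  left_id ((fun=> 0) : dprod) (fun (x y : dprod) => (fun i => x i + y i) : dprod).
Proof. by move=> x; apply: ext => i; exact: add0r. Qed.
Fact dprodN : left_inverse ((fun=> 0) : dprod) (fun x => (fun i => - x i) : dprod)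
  (fun (x y : dprod) => (fun i => x i + y i) : dprod).
Proof. by move=> x; apply: ext => i; exact: addNr. Qed.
HB.instance Definition _ :=
  GRing.isZmodule.Build dprod dprodA dprodC dprod0 dprodN.

Let scale (a : C) (x : dprod) : dprod := fun i => a *: x i.
Fact dprod_scaleA a b x : scale a (scale b x) = scale (a * b) x.
Proof. by apply: ext => i; exact: scalerA. Qed.
Fact dprod_scale1 : left_id 1 scale.
Proof. by move=> x; apply: ext => i; exact: scale1r. Qed.
Fact dprod_scaleDr : right_distributive scale +%R.
Proof. by move=> a x y; apply: ext => i; exact: scalerDr. Qed.
Fact dprod_scaleDl x : {morph scale^~ x : a b / a + b}.
Proof. by move=> a b; apply: ext => i; exact: scalerDl. Qed.
HB.instance Definition _ := GRing.Zmodule_isLmodule.Build C dprod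
  dprod_scaleA dprod_scale1 dprod_scaleDr dprod_scaleDl.
End Product.

Variables (I : Type) (d : I -> nat).

Definition bounded_family : set (dprod (fun i => matmo R (d i))) :=
  [set x | exists M : R, forall i, nrm (x i) <= M].

Fact nrm_matmoZD n (a : C) (A B : matmo R n) :
  nrm (a *: A + B) <= 2 * (Rnorm a * nrm A + nrm B).
Proof.
rewrite /nrm /=; apply: le_trans (mxnormZD _ _ _); rewrite le_eqVlt; apply/orP; left.
apply/eqP; congr mxnorm; apply/matrixP => i j.
by rewrite !mxE.
Qed.

Fact bounded_family0 : bounded_family 0.
Proof.
exists 0 => i; rewrite /nrm /=.
set A := (X in mxnorm X); have -> : A = 0 by apply/matrixP => k l; rewrite !mxE.
exact: mxnorm0.
Qed.

Fact bounded_familyZD (a : C) x y :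
  bounded_family x -> bounded_family y -> bounded_family (a *: x + y).
Proof.
move=> [M xM] [N yN]; exists (2 * (Rnorm a * M + N)) => i.
apply: le_trans (nrm_matmoZD _ _ _) _; rewrite ler_pM2l//.
by apply: lerD => //; rewrite ler_wpM2l// Rnorm_ge0.
Qed.

Definition msum_car : lmodType C :=
  subl (LSpace bounded_family0 bounded_familyZD).

(* the l_oo direct sum of the algebras M_{d i}(C); insubd as in dual_star *)
Definition msum : modata R := {|
  mo_car := msum_car;
  star := fun x => insubd (0 : msum_car) (fun i => star (val x i));
  mnorm := fun n x => sup [set mnorm (map_mx (fun y : msum_car => val y i) x) | i in [set: I]];
  mcone := fun n => [set x | forall i, mcone (map_mx (fun y : msum_car => val y i) x)] |}.

(* the l_1 direct sum of the duals of the M_{d i}(C), written with vector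
   functionals of the canonical action of msum on the Hilbert sum of the
   C^{d i} *)
Definition msum_predual : set (dual msum) :=
  [set f : dual msum | exists (i : nat -> I) (xi eta : forall k, 'cV[C]_(d (i k))),
    [/\ cvgn (series (fun k => vnorm (xi k) ^+ 2)),
        cvgn (series (fun k => vnorm (eta k) ^+ 2)) &
        forall x : msum,
          series (fun k => (((eta k)^t*) *m val x (i k) *m xi k) 0 0 : C^o) @ \oo
            --> val f x]].

End MatrixSums.

Section Mu.
Variables (R : realType) (D : modata R) (F : set (dual D)).
Local Notation C := R[i].

(* maps into M_{n+1}(C), so that matrix sizes are positive *)
Definition WQ (n : nat) : Type :=
  {phi : D -> matmo R n.+1 |
    CCp phi /\ continuous (phi : wstar F -> 'M[C^o]_n.+1)}.

Definition WQall : Type := {n : nat & WQ n}.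

Definition ND : modata R := msum R (fun i : WQall => (tag i).+1).

Definition ND_predual : set (dual ND) := @msum_predual R WQall (fun i => (tag i).+1).

Let mu_fun (x : D) : dprod (fun i : WQall => matmo R (tag i).+1) :=
  fun i => sval (tagged i) x.

Fact mu_subproof (x : D) :
  mu_fun x \in lset (LSpace (@bounded_family0 R WQall (fun i => (tag i).+1))
    (@bounded_familyZD R WQall (fun i => (tag i).+1))).
Proof.
apply/mem_set; exists (nrm x) => -[n [phi [[h1 phi1] h2]]] /=.
by have := phi1 1%N (const_mx x); rewrite map_const_mx.
Qed.

Definition mu (x : D) : ND := Subl (mu_subproof x).

Fact mu_range0 : range mu 0.
Proof.
exists 0 => //; apply: val_inj; apply: functional_extensionality_dep.
move=> [n [phi [[[[phil h1] h2] h3] h4]]] /=; rewrite /mu_fun /=.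
by have := phil (-1) 0 0; rewrite scaler0 addr0 scaleN1r addNr.
Qed.

Fact mu_rangeZD (a : C) u v : range mu u -> range mu v -> range mu (a *: u + v).
Proof.
move=> [x _ <-] [y _ <-]; exists (a *: x + y) => //.
apply: val_inj; apply: functional_extensionality_dep.
by move=> [n [phi [[[[phil h1] h2] h3] h4]]] /=; rewrite /mu_fun /= phil.
Qed.

Fact mu_range_star u : range mu u -> range mu (star u).
Proof.
move=> [x _ <-]; exists (star x) => //=.
apply: val_inj; rewrite /= val_insubd.
have -> : (fun i => star (val (mu x) i)) = mu_fun (star x).
  apply: functional_extensionality_dep.
  by move=> [n [phi [[[[h1 phis] h2] h3] h4]]] /=; rewrite /mu_fun /= phis.
by rewrite mu_subproof.
Qed.

Definition mu_range : saspace ND :=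
  @SASpace R ND (LSpace mu_range0 mu_rangeZD) mu_range_star.

Fact mu_range_in (x : D) : mu x \in lset mu_range.
Proof. by apply/mem_set; exists x. Qed.

End Mu.

Arguments mu_range {R D} F.
Arguments ND_predual {R D} F _.
Arguments mu_range_in {R D} F x.

Section DualOperatorSystems.
Variable R : realType.

Record opsys := Opsys {
  opsys_hilbert : hilbert R;
  opsys_space : saspace (BH opsys_hilbert) }.

Definition opsys_modata (S : opsys) : modata R := submo (opsys_space S).
Coercion opsys_modata : opsys >-> modata.

Definition is_quasi_opsys (T : modata R) : Prop :=
  is_mos T /\ exists (S : opsys) (phi : T -> S), mos_iso phi.

Definition weak_star_representation (D : modata R) (F : saspace (dual D))
    (H : hilbert R) (V : saspace (BH H)) (phi : D -> submo V) : Prop :=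
  [/\ closed (V : set (wstar (BH_predual H))), mos_iso phi &
      whomeo F (restrict (BH_predual H) V) phi].

Definition is_dual_quasi_opsys (D : modata R) (F : saspace (dual D)) : Prop :=
  is_dual_mos F /\
  exists (H : hilbert R) (V : saspace (BH H)) (phi : D -> submo V),
    weak_star_representation F phi.

Definition is_dual_opsys (D : modata R) (F : saspace (dual D)) : Prop :=
  is_dual_mos F /\
  exists (H : hilbert R) (V : saspace (BH H)) (phi : D -> submo V),
    weak_star_representation F phi /\ complete_isometry phi.

(* The predual of T^* is T, i.e. the range of kappa. *)
Definition dualizable (T : modata R) : Prop :=
  is_quasi_opsys T /\
  exists F : saspace (dual (dual T)),
    lset F = range (@kappa R T) /\ is_dual_quasi_opsys F.

Variable T : modata R.

(* T^d, a subspace of N(T^* ) *)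
Definition td : modata R := submo (mu_range (range (@kappa R T))).

Definition td_predual : set (dual td) :=
  restrict (ND_predual (range (@kappa R T))) (mu_range (range (@kappa R T))).

(* mu_{T^*} with codomain T^d *)
Definition mu_td (f : dual T) : td := Subl (mu_range_in (range (@kappa R T)) f).

End DualOperatorSystems.

Section DualMap.
Variables (R : realType).

(* xget picks the preimage of u under the dual map of mu_td *)
Definition tau (T : modata R) (u : dual (dual T)) : td (td T) :=
  mu_td (xget (0 : dual (td T)) [set g | dual_map (@mu_td R T) g = u]).

Variables S T : modata R.

Definition is_phid (phi : S -> T) (chi : td T -> td S) : Prop :=
  CBpw (@td_predual R T) (@td_predual R S) chi /\
  chi \o @mu_td R T = @mu_td R S \o dual_map phi.

(* fun=> 0 only when no chi satisfies is_phid phi *)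
Definition phid (phi : S -> T) : td T -> td S :=
  xget (fun=> 0 : td S) [set chi | is_phid phi chi].

End DualMap.

Arguments tau {R} T u.
Arguments kappa {R} X x.
Arguments mu_td {R} T f.
Arguments td_predual {R} T _.

(* Main.v *)
(* An element of M_n(BH) is determined, together with its norm and positivity,
   by its compressions to finite-dimensional frames, and these are maps into
   matrix algebras; so all norm and order comparisons reduce to matrices.
   The functor is phi^d = mu_S o phi^* o mu_T^-1.  It is contractive when phi is
   because composition with the contraction phi^* maps the index set of mu_S
   into that of mu_T.  Conversely a weak*-continuous chi : T^d -> S^d gives a map
   T^* -> S^* continuous for the topologies induced by T and S, hence a map
   phi : S -> T, and compressions of T, being matrices over T^*, show that phi is
   completely bounded and completely positive.  If chi is an isomorphism then
   phi has closed range, S being closed in S^**, and dense range by Hahn-Banach.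
   For (d), S_0 is the image of the predual of D under a representation of D^*,
   and S_0^* is again D.  For (e), tau_T (kappa_T (phi s)) is mu applied to
   chi^* of a functional whose image under mu is tau_S (kappa_S s). *)
Require Import Defs.
From mathcomp Require Import all_boot all_order all_algebra.
From mathcomp Require Import complex ring lra.
From mathcomp Require Import all_classical all_reals all_analysis.

Set Implicit Arguments.
Unset Strict Implicit.
Unset Printing Implicit Defensive.

Import Order.TTheory GRing.Theory Num.Theory numFieldNormedType.Exports.

Local Open Scope classical_set_scope.
Local Open Scope ring_scope.
Local Open Scope complex_scope.
Local Open Scope sesquilinear_scope.

(** * Matrices of matrices *)

(** The pivot is a universal property of [mu]. If f is a weak*-continuous completely positive map
    into a matrix algebra with bound M, then f / M is one of the coordinates of [mu]; hence f is
    bounded by M times the norm of [mu], and f is positive wherever [mu] is. Fed with compressions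
    of a representation, this makes [mu] bounded below and order reflecting; fed with coordinates of
    a second [mu] composed with a map psi, it carries the bound of psi over without loss. The
    constant M cannot be avoided, since a representation is only a MOS isomorphism and need not be
    contractive. Weak* continuity is used in algebraic form: a continuous functional is a finite
    linear combination of the functionals that define the topology. This recovers phi from its dual
    and places matrix entries in the predual. Infinite sums occur only between the predual of N(D)
    and the predual of D or of B(H), where norm closedness of the predual of D absorbs the limit. *)

Section Scalars.
Variable R : realType.
Local Notation C := R[i].

Lemma Rnorm0 (V : normedZmodType C) : Rnorm (0 : V) = 0.
Proof. by rewrite /Rnorm normr0. Qed.

Lemma Rnorm_eq0 (V : normedZmodType C) (v : V) : Rnorm v = 0 -> v = 0.
Proof. by move=> h; apply/eqP; rewrite -normr_eq0 -RnormE h. Qed.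

Lemma RnormN (V : normedZmodType C) (v : V) : Rnorm (- v) = Rnorm v.
Proof. by rewrite /Rnorm normrN. Qed.

Lemma Rnorm_sum (V : normedZmodType C) I (r : seq I) P (F : I -> V) :
  Rnorm (\sum_(i <- r | P i) F i) <= \sum_(i <- r | P i) Rnorm (F i).
Proof.
elim/big_rec2: _ => [|i y x _ le_xy]; first by rewrite Rnorm0.
by apply: le_trans (RnormD _ _) _; rewrite lerD2l.
Qed.

Lemma Rnorm_conj (z : C) : Rnorm (conjc z) = Rnorm z.
Proof. by rewrite /Rnorm; congr complex.Re; exact: (norm_conjC z). Qed.

Lemma Rnorm_sqr (z : C) : (Rnorm z ^+ 2)%:C = z * conjc z.
Proof. by rewrite rmorphXn /= RnormE; exact: normCK. Qed.

Lemma Rnorm_real (x : R) : 0 <= x -> Rnorm (x%:C) = x.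
Proof. by move=> x0; apply: (@complexI R); rewrite RnormE ger0_norm ?lecR. Qed.

Lemma Rnorm_ge0C (z : C) : 0 <= z -> z = (Rnorm z)%:C.
Proof. by move=> z0; rewrite RnormE ger0_norm. Qed.

Lemma conjcM (a b : C) : conjc (a * b) = conjc a * conjc b.
Proof. exact: rmorphM. Qed.

Lemma RnormV (z : C) : Rnorm z^-1 = (Rnorm z)^-1.
Proof. by apply: (@complexI R); rewrite fmorphV /= !RnormE normfV. Qed.

Lemma Re_le_Rnorm (z : C) : `|complex.Re z| <= Rnorm z.
Proof.
case: z => x y; rewrite /Rnorm /= -sqrtr_sqr ler_wsqrtr//.
by rewrite lerDl sqr_ge0.
Qed.

Lemma Im_le_Rnorm (z : C) : `|complex.Im z| <= Rnorm z.
Proof.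
case: z => x y; rewrite /Rnorm /= -sqrtr_sqr ler_wsqrtr//.
by rewrite lerDr sqr_ge0.
Qed.

Lemma ge0_approx (z : C) :
  (forall e : R, 0 < e -> exists2 t : C, 0 <= t & Rnorm (z - t) <= e) -> 0 <= z.
Proof.
move=> approx; rewrite lecE /=; apply/andP; split.
  rewrite -normr_eq0 eq_le normr_ge0 andbT; apply/ler_addgt0Pr => e e0; rewrite add0r.
  have [t t0 ht] := approx e e0; move: t0; rewrite lecE => /andP[/eqP t0 _].
  by have := le_trans (Im_le_Rnorm _) ht; rewrite raddfB /= t0 subr0.
apply/ler_addgt0Pr => e e0; have [t t0 ht] := approx e e0.
move: t0; rewrite lecE => /andP[_ /= t0].
have := le_trans (Re_le_Rnorm _) ht; rewrite raddfB /= ler_norml => /andP[].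
by move: t0; lra.
Qed.

Lemma Rnorm_le_ReIm (z : C) : Rnorm z <= `|complex.Re z| + `|complex.Im z|.
Proof.
case: z => x y; rewrite /Rnorm /= -[leRHS]ger0_norm ?addr_ge0//.
rewrite -sqrtr_sqr ler_wsqrtr// sqrrD !real_normK ?num_real//.
by have := mulr_ge0 (normr_ge0 x) (normr_ge0 y); lra.
Qed.

(* AM-GM with weight t, and t chosen to balance both sides *)
Lemma cauchy_schwarz_sum I (r : seq I) (P : pred I) (a b : I -> R) :
  (\sum_(i <- r | P i) a i * b i) <=
  Num.sqrt (\sum_(i <- r | P i) a i ^+ 2) * Num.sqrt (\sum_(i <- r | P i) b i ^+ 2).
Proof.
set A := \sum_(i <- r | P i) a i ^+ 2; set B := \sum_(i <- r | P i) b i ^+ 2.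
have A0 : 0 <= A by apply: sumr_ge0 => i _; exact: sqr_ge0.
have B0 : 0 <= B by apply: sumr_ge0 => i _; exact: sqr_ge0.
set S := \sum_(i <- r | P i) a i * b i.
have h (t : R) : 2 * t * S <= A + t ^+ 2 * B.
  rewrite /S /A /B !mulr_sumr -big_split /=; apply: ler_sum => i _.
  by have := sqr_ge0 (a i - t * b i); nra.
rewrite -sqrtrM//; apply: le_trans (ler_norm _) _; rewrite -sqrtr_sqr ler_wsqrtr//.
have [B00|B00] := eqVneq B 0.
  have [->|S0] := eqVneq S 0; first by rewrite expr0n /= mulr_ge0.
  (* With B = 0 the bound [h] is linear in t, and this t turns it into A + 1 <= A. *)
  have := h ((A + 1) / (2 * S)); rewrite B00 mulr0 addr0.
  have -> : 2 * ((A + 1) / (2 * S)) * S = A + 1 by field.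
  by lra.
have Bp : 0 < B by rewrite lt_def B00.
have := h (S / B); have e : S / B * B = S by rewrite mulfVK.
set u := S / B in e *; rewrite -e; nra.
Qed.

Definition hs n m (v : 'M[C]_(n, m)) : R :=
  Num.sqrt (\sum_i \sum_a Rnorm (v i a) ^+ 2).

(** An n x m matrix v stands for a vector of the tensor product of C^n and C^m, its rows being the n
    components. Then [form x v w] is the inner product of x v with w, and [hs] is the Hilbert norm;
    writing both as entrywise sums avoids block indices. *)
Definition form n m (x : 'M['M[C]_m]_n) (v w : 'M[C]_(n, m)) : C :=
  \sum_i \sum_j \sum_a \sum_b x i j a b * (v j b * conjc (w i a)).

Lemma hs_ge0 n m (v : 'M[C]_(n, m)) : 0 <= hs v.
Proof. exact: sqrtr_ge0. Qed.

Lemma hsE n m (v : 'M[C]_(n, m)) : hs v ^+ 2 = \sum_i \sum_a Rnorm (v i a) ^+ 2.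
Proof.
by rewrite sqr_sqrtr// sumr_ge0// => i _; rewrite sumr_ge0// => j _; exact: sqr_ge0.
Qed.

Lemma hs_tr n m (v : 'M[C]_(n, m)) : hs v^T = hs v.
Proof.
rewrite /hs exchange_big; congr Num.sqrt; apply: eq_bigr => i _.
by apply: eq_bigr => j _; rewrite mxE.
Qed.

Lemma formD n m (x y : 'M['M[C]_m]_n) v w : form (x + y) v w = form x v w + form y v w.
Proof.
rewrite /form -big_split; apply: eq_bigr => i _; rewrite -big_split.
apply: eq_bigr => j _; rewrite -big_split; apply: eq_bigr => a _.
by rewrite -big_split; apply: eq_bigr => b _; rewrite !mxE mulrDl.
Qed.

Lemma formZ n m (c : C) (x : 'M['M[C]_m]_n) v w :
  form (map_mx ( *:%R c) x) v w = c * form x v w.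
Proof.
rewrite /form mulr_sumr; apply: eq_bigr => i _; rewrite mulr_sumr.
apply: eq_bigr => j _; rewrite mulr_sumr; apply: eq_bigr => a _.
by rewrite mulr_sumr; apply: eq_bigr => b _; rewrite !mxE -mulrA.
Qed.

Lemma form0 n m v w : form (0 : 'M['M[C]_m]_n) v w = 0.
Proof.
rewrite /form big1// => i _; rewrite big1// => j _; rewrite big1// => a _.
by rewrite big1// => b _; rewrite !mxE mul0r.
Qed.

Lemma formZl n m (c : C) (x : 'M['M[C]_m]_n) v w : form x (c *: v) w = c * form x v w.
Proof.
rewrite /form mulr_sumr; apply: eq_bigr => i _; rewrite mulr_sumr.
apply: eq_bigr => j _; rewrite mulr_sumr; apply: eq_bigr => a _.
rewrite mulr_sumr; apply: eq_bigr => b _; rewrite !mxE mulrCA -!mulrA.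
by congr (_ * _); rewrite mulrCA.
Qed.

Lemma formDl n m (x : 'M['M[C]_m]_n) v v' w :
  form x (v + v') w = form x v w + form x v' w.
Proof.
rewrite /form -big_split; apply: eq_bigr => i _; rewrite -big_split.
apply: eq_bigr => j _; rewrite -big_split; apply: eq_bigr => a _.
by rewrite -big_split; apply: eq_bigr => b _; rewrite !mxE mulrDl mulrDr.
Qed.

Lemma form_adj n m (x : 'M['M[C]_m]_n) v w :
  form (map_mx (fun a : 'M[C]_m => a^t*) x^T) v w = conjc (form x w v).
Proof.
rewrite /form rmorph_sum exchange_big /=; apply: eq_bigr => i _.
rewrite rmorph_sum /=; apply: eq_bigr => j _.
rewrite rmorph_sum exchange_big /=; apply: eq_bigr => a _.
rewrite rmorph_sum /=; apply: eq_bigr => b _.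
by rewrite !mxE !rmorphM /= conjcK; congr (_ * _); rewrite mulrC.
Qed.

Lemma formDr n m (x : 'M['M[C]_m]_n) v w w' :
  form x v (w + w') = form x v w + form x v w'.
Proof.
by apply: (can_inj (@conjcK R)); rewrite rmorphD /= -!form_adj formDl.
Qed.

Lemma formZr n m (c : C) (x : 'M['M[C]_m]_n) v w : form x v (c *: w) = conjc c * form x v w.
Proof.
by apply: (can_inj (@conjcK R)); rewrite rmorphM /= -!form_adj formZl conjcK.
Qed.

Lemma form_delta n m (x : 'M['M[C]_m]_n) i j a b :
  form x (delta_mx j b) (delta_mx i a) = x i j a b.
Proof.
rewrite /form (bigD1 i)//= [X in _ + X]big1 ?addr0; last first.
  move=> k /negPf nk; rewrite big1// => l _; rewrite big1// => c _; rewrite big1// => d _.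
  by rewrite !mxE nk conjc_nat !mulr0.
rewrite (bigD1 j)//= [X in _ + X]big1 ?addr0; last first.
  move=> l /negPf nl; rewrite big1// => c _; rewrite big1// => d _.
  by rewrite !mxE nl mul0r mulr0.
rewrite (bigD1 a)//= [X in _ + X]big1 ?addr0; last first.
  move=> c /negPf nc; rewrite big1// => d _.
  by rewrite !mxE nc andbF conjc_nat !mulr0.
rewrite (bigD1 b)//= [X in _ + X]big1 ?addr0; last first.
  by move=> d /negPf nd; rewrite !mxE nd andbF /= mul0r mulr0.
by rewrite !mxE !eqxx conjc_nat !mulr1.
Qed.

Lemma hs_delta n m i a : hs (delta_mx i a : 'M[C]_(n, m)) = 1.
Proof.
rewrite /hs (bigD1 i)//= [X in _ + X]big1 ?addr0; last first.
  move=> k /negPf nk; rewrite big1// => c _.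
  by rewrite !mxE nk Rnorm0 expr0n.
rewrite (bigD1 a)//= [X in _ + X]big1 ?addr0; last first.
  by move=> c /negPf nc; rewrite !mxE nc andbF Rnorm0 expr0n.
by rewrite !mxE !eqxx /= Rnorm_real// expr1n sqrtr1.
Qed.

(* polarization *)
Lemma form_real_hermitian n m (x : 'M['M[C]_m]_n) :
  (forall v, form x v v \is Num.real) -> map_mx (fun a : 'M[C]_m => a^t*) x^T = x.
Proof.
move=> xr.
have rE v : conjc (form x v v) = form x v v.
  by have /CrealP := xr v.
have h v w : form x w v + form x v w = conjc (form x w v + form x v w).
  have := rE (v + w); rewrite formDl !formDr !rmorphD /= !rE.
  have aux (a b c d p q : C) : a + p + (q + d) = a + b + (c + d) -> c + b = q + p.
    move=> e; apply: (addrI a); apply: (addIr d).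
    transitivity (a + b + (c + d)); first by ring.
    by rewrite -e; ring.
  exact: aux.
have h2 v w : form x w v = conjc (form x v w).
  (* For w the two values have opposite imaginary parts; for i w the same statement says that their
     real parts agree. *)
  have := h v w; have := h v (Complex 0 1 *: w).
  rewrite formZl formZr.
  case: (form x w v) => a b; case: (form x v w) => c d.
  move=> /eqP; rewrite eq_complex /= => /andP[/eqP e1 /eqP e2].
  move=> /eqP; rewrite eq_complex /= => /andP[/eqP e3 /eqP e4].
  by apply/eqP; rewrite eq_complex /=; apply/andP; split; apply/eqP; lra.
apply/matrixP => i j; apply/matrixP => a b.
by rewrite -!form_delta form_adj -h2.
Qed.

End Scalars.

Section MatrixNorm.
Variable R : realType.
Local Notation C := R[i].

Lemma vnorm_ip m (v : 'cV[C]_m) : (v^t* *m v) 0 0 = (vnorm v ^+ 2)%:C.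
Proof.
rewrite mxE vnormE rmorph_sum /=; apply: eq_bigr => i _.
by rewrite !mxE Rnorm_sqr mulrC.
Qed.

Lemma vnorm_cauchy_schwarz m (v w : 'cV[C]_m) :
  Rnorm ((w^t* *m v) 0 0) <= vnorm w * vnorm v.
Proof.
rewrite mxE; apply: le_trans (Rnorm_sum _ _ _) _.
rewrite (eq_bigr (fun i => Rnorm (w i 0) * Rnorm (v i 0))).
  exact: cauchy_schwarz_sum.
by move=> i _; rewrite RnormM !mxE [Rnorm (Num.conj _)]Rnorm_conj.
Qed.

Lemma vnorm_eq0 m (v : 'cV[C]_m) : vnorm v = 0 -> v = 0.
Proof.
move=> h; apply/matrixP => i j; rewrite mxE ord1; apply: Rnorm_eq0.
by apply/eqP; rewrite eq_le Rnorm_ge0 -h vnorm_coord.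
Qed.

Lemma vnorm0 m : vnorm (0 : 'cV[C]_m) = 0.
Proof. by rewrite -[0](scale0r 0) vnormZ Rnorm0 mul0r. Qed.

Lemma mxnorm_ge0 m n (A : 'M[C]_(m, n)) : 0 <= mxnorm A.
Proof. by have := @mxnorm_ub _ _ _ A 0; rewrite mulmx0 !vnorm0; apply. Qed.

Lemma vnorm_mulmx m n (A : 'M[C]_(m, n)) v : vnorm (A *m v) <= mxnorm A * vnorm v.
Proof.
have [/vnorm_eq0 ->|v0] := eqVneq (vnorm v) 0; first by rewrite mulmx0 !vnorm0 mulr0.
have vp : 0 < vnorm v by rewrite lt_def v0 vnorm_ge0.
have := @mxnorm_ub _ _ _ A (((vnorm v)^-1)%:C *: v).
rewrite -scalemxAr !vnormZ Rnorm_real ?invr_ge0 ?vnorm_ge0// mulVf// => /(_ (lexx _)).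
by rewrite mulrC ler_pdivrMr.
Qed.

Lemma mxnorm_leP m n (A : 'M[C]_(m, n)) (c : R) : 0 <= c ->
  mxnorm A <= c <->
  forall v w, Rnorm ((w^t* *m A *m v) 0 0) <= c * vnorm v * vnorm w.
Proof.
move=> c0; split=> [Ac v w|h].
  rewrite -mulmxA; apply: le_trans (vnorm_cauchy_schwarz _ _) _.
  rewrite mulrC ler_wpM2r ?vnorm_ge0//; apply: le_trans (vnorm_mulmx _ _) _.
  by rewrite ler_wpM2r ?vnorm_ge0.
apply: ge_sup; first by case: (mxnorm_has_sup A).
(* Testing against w = A v turns the form into the square of the norm of A v. *)
move=> _ [v /= v1 <-]; have := h v (A *m v).
rewrite -mulmxA vnorm_ip Rnorm_real ?sqr_ge0// expr2.
have [->//|n0] := eqVneq (vnorm (A *m v)) 0.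
rewrite ler_pM2r ?lt_def ?n0 ?vnorm_ge0// => /le_trans; apply.
by rewrite -[leRHS]mulr1 ler_wpM2l.
Qed.

(** The bridge from [form] and [hs] to the block matrices in the definition of [matmo]. It serves to
    prove [matmo_norm_leP] and [matmo_coneP], after which norm and cone are handled through
    [form]. *)
Definition unroll n m (v : 'M[C]_(n, m)) : 'cV[C]_(\sum_(i < n) m) :=
  \mxcol_(i < n) (row i v)^T.

Lemma unroll_surj n m (u : 'cV[C]_(\sum_(i < n) m)) : exists v : 'M[C]_(n, m), u = unroll v.
Proof.
exists (\matrix_(i, a) submxcol (p_ := fun=> m) u i a 0); rewrite /unroll.
apply/(mxcolP (p_ := fun=> m)) => i; rewrite mxcolK.
by apply/matrixP => a b; rewrite !mxE ord1.
Qed.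

Lemma adjoint_unroll n m (w : 'M[C]_(n, m)) :
  (unroll w)^t* = \mxrow_(i < n) (map_mx conjc (row i w)).
Proof.
by apply/matrixP => a b; rewrite /unroll !mxE.
Qed.

Lemma vnorm_unroll n m (v : 'M[C]_(n, m)) : vnorm (unroll v) = hs v.
Proof.
apply: (@pexpIrn _ 2) => //; rewrite ?nnegrE ?hs_ge0 ?vnorm_ge0//.
apply: (@complexI R); rewrite -vnorm_ip adjoint_unroll /unroll mul_mxrow_mxcol.
rewrite summxE hsE rmorph_sum; apply: eq_bigr => i _.
rewrite mxE rmorph_sum; apply: eq_bigr => a _.
by rewrite !mxE /= Rnorm_sqr mulrC.
Qed.

Lemma form_unroll n m (x : 'M['M[C]_m]_n) (v w : 'M[C]_(n, m)) :
  ((unroll w)^t* *m (\mxblock_(i < n, j < n) x i j) *m unroll v) 0 0 = form x v w.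
Proof.
rewrite -mulmxA mul_mxblock_mxrow adjoint_unroll mul_mxrow_mxcol summxE.
apply: eq_bigr => i _; rewrite mulmx_sumr summxE; apply: eq_bigr => j _.
rewrite mxE; apply: eq_bigr => a _; rewrite !mxE mulr_sumr; apply: eq_bigr => b _.
by rewrite !mxE mulrC mulrA.
Qed.

Lemma matmo_norm_leP n m (x : 'M[matmo R m]_n) (c : R) : 0 <= c ->
  mnorm x <= c <-> forall v w, Rnorm (form x v w) <= c * hs v * hs w.
Proof.
move=> c0; apply: (iff_trans (mxnorm_leP _ c0)); split=> h v w.
  by have := h (unroll v) (unroll w); rewrite form_unroll !vnorm_unroll.
have [v' ->] := unroll_surj v; have [w' ->] := unroll_surj w.
by rewrite form_unroll !vnorm_unroll.
Qed.

Lemma matmo_coneP n m (x : 'M[matmo R m]_n) :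
  mcone x <-> forall v, 0 <= form x v v.
Proof.
split=> h v; first by have := h (unroll v); rewrite form_unroll.
by have [v' ->] := unroll_surj v; rewrite form_unroll.
Qed.

Lemma matmo_norm_ge0 n m (x : 'M[matmo R m]_n) : 0 <= mnorm x.
Proof. exact: mxnorm_ge0. Qed.

Lemma matmo_form_le n m (x : 'M[matmo R m]_n) v w :
  Rnorm (form x v w) <= mnorm x * hs v * hs w.
Proof. by have /matmo_norm_leP := lexx (mnorm x); apply; exact: matmo_norm_ge0. Qed.

Lemma form_const m (x : matmo R m) (v w : 'cV[C]_m) :
  form (const_mx x : 'M[matmo R m]_1) v^T w^T = (w^t* *m x *m v) 0 0.
Proof.
rewrite /form big_ord1 big_ord1 [RHS]mxE [LHS]exchange_big; apply: eq_bigr => b _.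
rewrite [in RHS]mxE mulr_suml; apply: eq_bigr => a _.
by rewrite !mxE mulrCA mulrA mulrC mulrA mulrC mulrAC -mulrA mulrC -!mulrA mulrCA.
Qed.

Lemma hs_col m (v : 'cV[C]_m) : hs v = vnorm v.
Proof.
by rewrite /hs /vnorm; congr Num.sqrt; apply: eq_bigr => i _; rewrite big_ord1.
Qed.

Lemma matmo_vector_form_le m (x : matmo R m) (v w : 'cV[C]_m) :
  Rnorm ((w^t* *m x *m v) 0 0) <= nrm x * vnorm v * vnorm w.
Proof. by rewrite -form_const -!hs_col -(hs_tr v) -(hs_tr w) matmo_form_le. Qed.

Lemma hs_mulmx n m (b : 'M[C]_n) (v : 'M[C]_(n, m)) :
  (hs (b *m v) ^+ 2)%:C = \sum_a ((col a v)^t* *m (b^t* *m b) *m col a v) 0 0.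
Proof.
rewrite -hs_tr hsE rmorph_sum; apply: eq_bigr => a _ /=.
have -> : (col a v)^t* *m (b^t* *m b) *m col a v = (b *m col a v)^t* *m (b *m col a v).
  by rewrite trmx_mul map_mxM /= !mulmxA.
rewrite vnorm_ip vnormE; congr (_%:C); apply: eq_bigr => i _.
by rewrite !mxE; congr (Rnorm _ ^+ 2); apply: eq_bigr => j _; rewrite mxE.
Qed.

(** Column by column the left-hand side is the quadratic form of the sum of the b_i^* b_i, which the
    norm of that matrix bounds. *)
Lemma sum_hs_mulmx n m k (b : 'I_k -> 'M[C]_n) (v : 'M[C]_(n, m)) :
  \sum_i hs (b i *m v) ^+ 2 <= mxnorm (\sum_i ((b i)^t*) *m b i) * hs v ^+ 2.
Proof.
set B := (X in mxnorm X).
have -> : \sum_i hs (b i *m v) ^+ 2 = Rnorm (\sum_a ((col a v)^t* *m B *m col a v) 0 0).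
  rewrite -[LHS]Rnorm_real; last by apply: sumr_ge0 => i _; exact: sqr_ge0.
  congr Rnorm; rewrite rmorph_sum /=; under eq_bigr do rewrite hs_mulmx.
  rewrite exchange_big; apply: eq_bigr => a _.
  by rewrite /B mulmx_sumr mulmx_suml summxE.
rewrite -(hs_tr v) hsE mulr_sumr; apply: le_trans (Rnorm_sum _ _ _) _.
apply: ler_sum => a _.
have /mxnorm_leP := lexx (mxnorm B) => /(_ (mxnorm_ge0 _) (col a v) (col a v)).
rewrite -mulrA -expr2 vnormE => /le_trans; apply; rewrite ler_wpM2l ?mxnorm_ge0//.
by rewrite le_eqVlt; apply/orP; left; apply/eqP; apply: eq_bigr => i _; rewrite !mxE.
Qed.

(** Scalar coefficients move onto the vectors. With [sum_hs_mulmx] this reduces the operator space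
    inequality for [matmo] to Cauchy-Schwarz, and it makes stability of the cone immediate. *)
Lemma form_mxact n m (a b : 'M[C]_n) (x : 'M[matmo R m]_n) v w :
  form (mxact (a^t*) x b) v w = form x (b *m v) (a *m w).
Proof.
rewrite /form.
transitivity (\sum_i \sum_j \sum_k \sum_l \sum_c \sum_d
   x k l c d * (b l j * v j d * (conjc (a k i) * conjc (w i c)))).
  apply: eq_bigr => i _; apply: eq_bigr => j _.
  rewrite [RHS](eq_bigr (fun k => \sum_c \sum_d \sum_l
     x k l c d * (b l j * v j d * (conjc (a k i) * conjc (w i c))))); last first.
    move=> k _; rewrite exchange_big; apply: eq_bigr => c _.
    by rewrite exchange_big.
  rewrite [RHS]exchange_big; apply: eq_bigr => c _.
  rewrite [RHS]exchange_big; apply: eq_bigr => d _.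
  rewrite !mxE !summxE mulr_suml; apply: eq_bigr => k _.
  rewrite !summxE mulr_suml; apply: eq_bigr => l _.
  by rewrite !mxE -[Num.conj _]/(conjc _); ring.
rewrite exchange_big.
rewrite [LHS](eq_bigr (fun j => \sum_k \sum_l \sum_c \sum_d \sum_i
   x k l c d * (b l j * v j d * (conjc (a k i) * conjc (w i c))))); last first.
  move=> j _; rewrite exchange_big; apply: eq_bigr => k _.
  rewrite exchange_big; apply: eq_bigr => l _.
  rewrite exchange_big; apply: eq_bigr => c _.
  by rewrite exchange_big.
rewrite exchange_big; apply: eq_bigr => k _.
rewrite exchange_big; apply: eq_bigr => l _.
rewrite exchange_big; apply: eq_bigr => c _.
rewrite exchange_big; apply: eq_bigr => d _.
rewrite !mxE rmorph_sum mulr_suml mulr_sumr; apply: eq_bigr => j _.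
rewrite !mulr_sumr; apply: eq_bigr => i _.
by rewrite rmorphM.
Qed.

Lemma form_sum n m k (x : 'I_k -> 'M[matmo R m]_n) v w :
  form (\sum_i x i) v w = \sum_i form (x i) v w.
Proof.
elim/big_rec2: _ => [|i y1 y2 _ <-]; first exact: form0.
by rewrite -formD.
Qed.

Lemma cauchy_schwarz_scaled k (f g : 'I_k -> R) (A B M s t : R) :
  0 <= A -> 0 <= B -> 0 <= M -> 0 <= s -> 0 <= t ->
  \sum_i f i ^+ 2 <= A * s ^+ 2 -> \sum_i g i ^+ 2 <= B * t ^+ 2 ->
  M * (\sum_i g i * f i) <= Num.sqrt A * Num.sqrt B * M * t * s.
Proof.
move=> A0 B0 M0 s0 t0 hf hg.
have -> : Num.sqrt A * Num.sqrt B * M * t * s = M * ((Num.sqrt B * t) * (Num.sqrt A * s)).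
  by ring.
rewrite ler_wpM2l//; apply: le_trans (cauchy_schwarz_sum _ _ _ _) _.
have e c u : 0 <= c -> 0 <= u -> Num.sqrt c * u = Num.sqrt (c * u ^+ 2) :> R.
  by move=> c0 u0; rewrite sqrtrM// sqrtr_sqr ger0_norm.
rewrite (e B t)// (e A s)//.
by apply: ler_pM; rewrite ?sqrtr_ge0 ?ler_wsqrtr.
Qed.

Lemma matmo_mxact_le n m k (a b : 'I_k -> 'M[C]_n) (x : 'I_k -> 'M[matmo R m]_n) :
  mnorm (\sum_i mxact ((a i)^t*) (x i) (b i)) <=
    Num.sqrt (mxnorm (\sum_i ((a i)^t*) *m a i)) *
    Num.sqrt (mxnorm (\sum_i ((b i)^t*) *m b i)) *
    \big[Num.max/0]_i mnorm (x i).
Proof.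
set M := \big[Num.max/0]_i _.
have M0 : 0 <= M by rewrite /M; elim/big_rec: _ => // i y _ y0; rewrite le_max y0 orbT.
have xM i : mnorm (x i) <= M by rewrite /M (bigD1 i) //= le_max lexx.
move: M M0 xM => M M0 xM.
apply/matmo_norm_leP; first by rewrite !mulr_ge0 ?sqrtr_ge0.
move=> v w; rewrite form_sum.
have := sum_hs_mulmx b v; have := sum_hs_mulmx a w.
move: (mxnorm _) (mxnorm_ge0 (\sum_i ((a i)^t*) *m a i)) => A A0 hA.
move: (mxnorm _) (mxnorm_ge0 (\sum_i ((b i)^t*) *m b i)) => B B0 hB.
apply: le_trans (Rnorm_sum _ _ _) _.
apply: (@le_trans _ _ (M * \sum_i hs (b i *m v) * hs (a i *m w))).
  rewrite mulr_sumr; apply: ler_sum => i _; rewrite form_mxact.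
  apply: le_trans (matmo_form_le _ _ _) _; rewrite -mulrA ler_wpM2r//.
  by rewrite mulr_ge0 ?hs_ge0.
by apply: cauchy_schwarz_scaled; rewrite ?hs_ge0.
Qed.

Lemma form_corner n m (x : 'M[matmo R m]_n) v w :
  form (corner x) v w = form x (usubmx v) (usubmx w).
Proof.
rewrite /form big_split_ord /= [X in _ + X]big1 ?addr0; last first.
  move=> i _; rewrite big1// => j _; rewrite big1// => a _; rewrite big1// => b _.
  rewrite /corner mxE; case: splitP => // k /= ek.
    by move: (ltn_ord k); rewrite -ek ltnNge leq_addr.
  by rewrite mxE; case: splitP => l _; rewrite !mxE mul0r.
apply: eq_bigr => i _; rewrite big_split_ord /= [X in _ + X]big1 ?addr0; last first.
  move=> j _; rewrite big1// => a _; rewrite big1// => b _.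
  by rewrite /corner block_mxEur !mxE mul0r.
apply: eq_bigr => j _; apply: eq_bigr => a _; apply: eq_bigr => b _.
by rewrite /corner block_mxEul !mxE.
Qed.

Lemma hs_usubmx n k m (v : 'M[C]_(n + k, m)) : hs (usubmx v) <= hs v.
Proof.
rewrite ler_wsqrtr// big_split_ord /= -[leLHS]addr0; apply: lerD.
  by apply: ler_sum => i _; apply: ler_sum => a _; rewrite mxE.
by apply: sumr_ge0 => i _; apply: sumr_ge0 => a _; exact: sqr_ge0.
Qed.

Lemma hs_col_mx0 n k m (v : 'M[C]_(n, m)) : hs (col_mx v (0 : 'M[C]_(k, m))) = hs v.
Proof.
congr Num.sqrt; rewrite big_split_ord /= [X in _ + X]big1 ?addr0.
  by apply: eq_bigr => i _; apply: eq_bigr => a _; rewrite col_mxEu.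
by move=> i _; rewrite big1// => a _; rewrite col_mxEd mxE Rnorm0 expr0n.
Qed.

Lemma matmo_norm_corner n m (x : 'M[matmo R m]_n) : mnorm (corner x) = mnorm x.
Proof.
apply/eqP; rewrite eq_le; apply/andP; split; apply/matmo_norm_leP;
  rewrite ?matmo_norm_ge0// => v w.
  rewrite form_corner; apply: le_trans (matmo_form_le _ _ _) _.
  by rewrite -!mulrA ler_wpM2l ?matmo_norm_ge0// ler_pM ?hs_ge0 ?hs_usubmx.
have := matmo_form_le (corner x) (col_mx v 0) (col_mx w 0).
by rewrite form_corner !col_mxKu !hs_col_mx0.
Qed.

Lemma matmo_cone_corner n m (x : 'M[matmo R m]_n) : mcone (corner x) <-> mcone x.
Proof.
split=> /matmo_coneP h; apply/matmo_coneP => v; last by rewrite form_corner.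
by have := h (col_mx v 0); rewrite form_corner col_mxKu.
Qed.

Lemma matmo_normD n m (x y : 'M[matmo R m]_n) : mnorm (x + y) <= mnorm x + mnorm y.
Proof.
apply/matmo_norm_leP; first by rewrite addr_ge0 ?matmo_norm_ge0.
move=> v w; rewrite formD !mulrDl; apply: le_trans (RnormD _ _) _.
by rewrite lerD ?matmo_form_le.
Qed.

Lemma matmo_normZ n m (c : C) (x : 'M[matmo R m]_n) :
  mnorm (map_mx ( *:%R c) x) = Rnorm c * mnorm x.
Proof.
have h c' (y : 'M[matmo R m]_n) : mnorm (map_mx ( *:%R c') y) <= Rnorm c' * mnorm y.
  apply/matmo_norm_leP; first by rewrite mulr_ge0 ?Rnorm_ge0 ?matmo_norm_ge0.
  by move=> v w; rewrite formZ RnormM -!mulrA ler_wpM2l ?Rnorm_ge0// mulrA matmo_form_le.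
apply/eqP; rewrite eq_le h andTb.
have [->|c0] := eqVneq c 0; first by rewrite Rnorm0 mul0r matmo_norm_ge0.
have := h c^-1 (map_mx ( *:%R c) x).
have -> : map_mx ( *:%R c^-1) (map_mx ( *:%R c) x) = x.
  by apply/matrixP => i j; rewrite !mxE scalerA mulVf// scale1r.
have n0 : 0 < Rnorm c.
  by rewrite lt_def Rnorm_ge0 andbT; apply: contra_neq c0 => /Rnorm_eq0.
rewrite RnormV.
by rewrite ler_pdivlMl.
Qed.

Lemma matmo_norm0_eq0 n m (x : 'M[matmo R m]_n) : mnorm x = 0 -> x = 0.
Proof.
move=> x0; apply/matrixP => i j; apply/matrixP => a b; rewrite -form_delta !mxE.
apply: Rnorm_eq0; apply/eqP; rewrite eq_le Rnorm_ge0 andbT.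
by apply: le_trans (matmo_form_le _ _ _) _; rewrite x0 !mul0r.
Qed.

Lemma matmo_norm_star n m (x : 'M[matmo R m]_n) : mnorm (mstar x) = mnorm x.
Proof.
have h (y : 'M[matmo R m]_n) : mnorm (mstar y) <= mnorm y.
  apply/matmo_norm_leP; rewrite ?matmo_norm_ge0// => v w.
  rewrite [form _ _ _]form_adj Rnorm_conj; apply: le_trans (matmo_form_le _ _ _) _.
  by rewrite -!mulrA [hs w * _]mulrC.
have h2 := h (mstar x).
have e : mstar (mstar x) = x.
  by apply/matrixP => i j; rewrite !mxE; apply/matrixP => a b; rewrite !mxE conjCK.
by apply: le_anti; apply/andP; split; [exact: (h x)|rewrite -{1}e].
Qed.

Lemma matmo_cone_sa n m (x : 'M[matmo R m]_n) : mcone x -> mstar x = x.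
Proof.
move=> /matmo_coneP h; apply: form_real_hermitian => v.
by rewrite ger0_real.
Qed.

Lemma matmo_cone_mxact n m k (a : 'I_k -> 'M[C]_n) (x : 'I_k -> 'M[matmo R m]_n) :
  (forall i, mcone (x i)) -> mcone (\sum_i mxact ((a i)^t*) (x i) (a i)).
Proof.
move=> h; apply/matmo_coneP => v; rewrite form_sum; apply: sumr_ge0 => i _.
by rewrite form_mxact; have /matmo_coneP := h i; apply.
Qed.

Lemma matmo_cone_closed n m (x : 'M[matmo R m]_n) :
  (forall e : R, 0 < e -> exists2 y, mcone y & mnorm (x - y) < e) -> mcone x.
Proof.
move=> h; apply/matmo_coneP => v; apply: ge0_approx => e e0.
(* The summand 1 keeps the denominator positive when v = 0. *)
have s0 : 0 < hs v ^+ 2 + 1 by rewrite ltr_wpDl ?sqr_ge0.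
have [y /matmo_coneP yc yx] := h (e / (hs v ^+ 2 + 1)) (divr_gt0 e0 s0).
exists (form y v v); first exact: yc.
have -> : form x v v - form y v v = form (x - y) v v.
  by rewrite -[in form x v v](subrK y x) formD addrK.
apply: le_trans (matmo_form_le _ _ _) _; rewrite -mulrA -expr2.
apply: (@le_trans _ _ (e / (hs v ^+ 2 + 1) * hs v ^+ 2)).
  by rewrite ler_wpM2r ?sqr_ge0 ?ltW.
by rewrite mulrAC ler_pdivrMr// ler_pM2l// lerDl.
Qed.

(** The canonical shuffle between M_n(M_m(C)) and M_m(M_n(C)). It permutes coordinates of the
    vectors only, so norm and cone survive; it is what exchanges the roles of X and its dual in a
    pairing of matrices. *)
Definition mxswap n m (x : 'M['M[C]_m]_n) : 'M['M[C]_n]_m :=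
  \matrix_(a, b) \matrix_(i, j) x i j a b.

Lemma form_swap n m (x : 'M['M[C]_m]_n) v w : form (mxswap x) v^T w^T = form x v w.
Proof.
rewrite /form; transitivity (\sum_a \sum_i \sum_b \sum_j x i j a b * (v j b * conjc (w i a))).
  apply: eq_bigr => a _; rewrite exchange_big; apply: eq_bigr => i _.
  by apply: eq_bigr => b _; apply: eq_bigr => j _; rewrite !mxE.
rewrite exchange_big; apply: eq_bigr => i _; rewrite [RHS]exchange_big.
by apply: eq_bigr => a _; rewrite exchange_big.
Qed.

Lemma mxswap_norm n m (x : 'M[matmo R m]_n) :
  mnorm (mxswap x : 'M[matmo R n]_m) = mnorm x.
Proof.
have h p q (y : 'M[matmo R q]_p) (z : 'M[matmo R p]_q) :
    (forall v w, form z v^T w^T = form y v w) -> mnorm y <= mnorm z.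
  move=> e; apply/matmo_norm_leP; rewrite ?matmo_norm_ge0// => v w.
  by rewrite -e -(hs_tr v) -(hs_tr w) matmo_form_le.
apply/eqP; rewrite eq_le; apply/andP; split; apply: h => v w; last exact: form_swap.
by rewrite -{2}(trmxK v) -{2}(trmxK w) form_swap.
Qed.

Lemma mxswap_cone n m (x : 'M[matmo R m]_n) :
  mcone (mxswap x : 'M[matmo R n]_m) <-> mcone x.
Proof.
split=> /matmo_coneP h; apply/matmo_coneP => v; first by rewrite -form_swap.
by rewrite -(trmxK v) form_swap.
Qed.

End MatrixNorm.

#[local] Opaque mxnorm psdmx.

(** * Operator spaces *)

Lemma map_mx_entry (A B : Type) (h : A -> B) n (x : 'M[A]_n) i j :
  map_mx h x i j = h (x i j).
Proof. exact: mxE. Qed.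

Lemma map_mx_comp_ext (A B X : Type) (f : A -> B) (g : B -> X) (h : A -> X) n
    (x : 'M[A]_n) : (forall y, g (f y) = h y) -> map_mx g (map_mx f x) = map_mx h x.
Proof. by move=> E; apply/matrixP => i j; rewrite !mxE. Qed.

Lemma map_mx_surj (A B : Type) (f : A -> B) : (forall y, exists x, y = f x) ->
  forall n (y : 'M[B]_n), exists x : 'M[A]_n, y = map_mx f x.
Proof.
move=> /choice [g gE] n y; exists (map_mx g y); apply/matrixP => i j.
by rewrite !mxE -gE.
Qed.

Section Linear.
Variables (R : realType) (U V : lmodType R[i]) (f : U -> V).
Hypothesis lf : linear f.

Lemma lin0 : f 0 = 0.
Proof. by have := lf (-1) 0 0; rewrite scaler0 addr0 scaleN1r addNr. Qed.

Lemma linD x y : f (x + y) = f x + f y.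
Proof. by have := lf 1 x y; rewrite !scale1r. Qed.

Lemma linZ a x : f (a *: x) = a *: f x.
Proof. by have := lf a x 0; rewrite !addr0 lin0 addr0. Qed.

Lemma linN x : f (- x) = - f x.
Proof. by rewrite -scaleN1r linZ scaleN1r. Qed.

Lemma linB x y : f (x - y) = f x - f y.
Proof. by rewrite linD linN. Qed.

Lemma lin_sum I (r : seq I) (P : pred I) (F : I -> U) :
  f (\sum_(i <- r | P i) F i) = \sum_(i <- r | P i) f (F i).
Proof. by elim/big_rec2: _ => [|i y1 y2 _ <-]; rewrite ?lin0 ?linD. Qed.

Lemma map_lin0 n : map_mx f (0 : 'M[U]_n) = 0.
Proof. by apply/matrixP => i j; rewrite !mxE lin0. Qed.

Lemma map_linD n (x y : 'M[U]_n) : map_mx f (x + y) = map_mx f x + map_mx f y.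
Proof. by apply/matrixP => i j; rewrite !mxE linD. Qed.

Lemma map_linN n (x : 'M[U]_n) : map_mx f (- x) = - map_mx f x.
Proof. by apply/matrixP => i j; rewrite !mxE linN. Qed.

Lemma map_linB n (x y : 'M[U]_n) : map_mx f (x - y) = map_mx f x - map_mx f y.
Proof. by rewrite map_linD map_linN. Qed.

Lemma map_linZ n a (x : 'M[U]_n) :
  map_mx f (map_mx ( *:%R a) x) = map_mx ( *:%R a) (map_mx f x).
Proof. by apply/matrixP => i j; rewrite !mxE linZ. Qed.

Lemma map_lin_sum n I (r : seq I) (P : pred I) (F : I -> 'M[U]_n) :
  map_mx f (\sum_(i <- r | P i) F i) = \sum_(i <- r | P i) map_mx f (F i).
Proof. by elim/big_rec2: _ => [|i y1 y2 _ <-]; rewrite ?map_lin0 ?map_linD. Qed.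

End Linear.

Section LinearModata.
Variables (R : realType) (X Y : modata R) (f : X -> Y).
Local Notation C := R[i].
Hypothesis lf : linear f.

Lemma map_lin_mxact n (a b : 'M[C]_n) (x : 'M[X]_n) :
  map_mx f (mxact a x b) = mxact a (map_mx f x) b.
Proof.
apply/matrixP => i j; rewrite !mxE (lin_sum lf); apply: eq_bigr => k _.
by rewrite (lin_sum lf); apply: eq_bigr => l _; rewrite (linZ lf) !mxE.
Qed.

Lemma map_lin_corner n (x : 'M[X]_n) : map_mx f (corner x) = corner (map_mx f x).
Proof.
rewrite /corner map_block_mx; congr block_mx;
  by apply/matrixP => i j; rewrite !mxE (lin0 lf).
Qed.

Lemma map_mstar n (x : 'M[X]_n) :
  (forall x, f (star x) = star (f x)) -> map_mx f (mstar x) = mstar (map_mx f x).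
Proof. by move=> sf; apply/matrixP => i j; rewrite !mxE sf. Qed.

End LinearModata.

Section OperatorSpace.
Variables (R : realType) (X : modata R).
Local Notation C := R[i].
Hypothesis oX : is_operator_space X.

Lemma os_norm0 n : mnorm (0 : 'M[X]_n) = 0.
Proof.
case: oX => _ h _ _ _; have := h n 0 0; rewrite Rnorm0 mul0r => <-; congr mnorm.
by apply/matrixP => i j; rewrite !mxE scale0r.
Qed.

Lemma os_normN n (x : 'M[X]_n) : mnorm (- x) = mnorm x.
Proof.
case: oX => _ h _ _ _; have := h n (-1) x; rewrite RnormN.
rewrite -[X in Rnorm X]/((1 : R)%:C) Rnorm_real// mul1r => <-; congr mnorm.
by apply/matrixP => i j; rewrite !mxE scaleN1r.
Qed.

Lemma os_norm_ge0 n (x : 'M[X]_n) : 0 <= mnorm x.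
Proof.
case: oX => h _ _ _ _; have := h n x (- x); rewrite subrr os_norm0 os_normN; lra.
Qed.

Lemma os_normB n (x y : 'M[X]_n) : mnorm (x - y) = mnorm (y - x).
Proof. by rewrite -os_normN opprB. Qed.

Lemma nrm_ge0 (x : X) : 0 <= nrm x.
Proof. exact: os_norm_ge0. Qed.

Lemma nrm_eq0 (x : X) : nrm x = 0 -> x = 0.
Proof.
case: oX => _ _ h _ _ /h /matrixP /(_ 0 0).
by rewrite !mxE.
Qed.

Definition pad k (z : X) : 'M[X]_k :=
  \matrix_(i, j) if (i == 0%N :> nat) && (j == 0%N :> nat) then z else 0.

Lemma corner_pad k z : corner (pad k.+1 z) = pad (k.+1 + 1) z.
Proof.
rewrite /corner; apply/matrixP => i j; rewrite !mxE.
case: splitP => i' ei; rewrite mxE; case: splitP => j' ej; rewrite !mxE ?ei ?ej//.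
by rewrite andbF.
Qed.

Lemma pad_norm k z : mnorm (pad k.+1 z) = nrm z.
Proof.
elim: k => [|k <-].
  rewrite /nrm; congr mnorm; apply/matrixP => i j; rewrite !mxE.
  by rewrite !ord1.
by rewrite -[k.+2]addn1 -corner_pad; case: oX => _ _ _ ->.
Qed.

(** The operator space inequality for coefficient matrices whose first column is w or v and whose
    other columns are 0: the product then has the scalar compression in its upper left entry and
    zeros elsewhere, so [pad_norm] computes its norm. The padding is needed because coefficients are
    square. *)
Lemma compress_norm n (x : 'M[X]_n) (v w : 'I_n -> C) :
  nrm (\sum_i \sum_j (conjc (w i) * v j) *: x i j) <=
  Num.sqrt (\sum_i Rnorm (w i) ^+ 2) * Num.sqrt (\sum_i Rnorm (v i) ^+ 2) * mnorm x.
Proof.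
case: n x v w => [x v w|n x v w].
  have -> : \sum_i \sum_j (conjc (w i) * v j) *: x i j = 0 by rewrite big_ord0.
  have -> : nrm (0 : X) = 0.
    by rewrite /nrm -[RHS](os_norm0 1); congr mnorm; apply/matrixP => i j; rewrite !mxE.
  by rewrite !mulr_ge0 ?sqrtr_ge0 ?os_norm_ge0.
pose m (u : 'I_n.+1 -> C) : 'M[C]_n.+1 := \matrix_(i, j) if j == 0 then u i else 0.
have mle u : mxnorm ((m u)^t* *m m u) <= \sum_i Rnorm (u i) ^+ 2.
  apply/mxnorm_leP; first by apply: sumr_ge0 => i _; exact: sqr_ge0.
  move=> p q; rewrite mulmxA -mulmxA.
  have -> : q^t* *m (m u)^t* = (m u *m q)^t* by rewrite trmx_mul map_mxM.
  apply: le_trans (vnorm_cauchy_schwarz _ _) _.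
  pose U : 'cV[C]_n.+1 := \col_i u i.
  have mE (z : 'cV[C]_n.+1) : m u *m z = z 0 0 *: U.
    apply/matrixP => i j; rewrite !mxE big_ord_recl big1 ?addr0; last first.
      by move=> k _; rewrite !mxE /= mul0r.
    by rewrite !mxE /= mulrC !ord1.
  have UE : \sum_i Rnorm (u i) ^+ 2 = vnorm U ^+ 2.
    by rewrite vnormE; apply: eq_bigr => i _; rewrite mxE.
  rewrite !mE !vnormZ UE.
  have -> : Rnorm (q 0 0) * vnorm U * (Rnorm (p 0 0) * vnorm U) =
    vnorm U ^+ 2 * (Rnorm (p 0 0) * Rnorm (q 0 0)) by ring.
  by rewrite -mulrA ler_wpM2l ?sqr_ge0// ler_pM ?Rnorm_ge0// vnorm_coord.
case: (oX) => _ _ _ _ /(_ n.+1 1%N (fun=> m w) (fun=> m v) (fun=> x)).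
rewrite !big_ord1.
have -> : mxact ((m w)^t*) x (m v) = pad n.+1 (\sum_i \sum_j (conjc (w i) * v j) *: x i j).
  apply/matrixP => i j; rewrite !mxE.
  have [i0|i0] := eqVneq i 0; last first.
    rewrite (_ : (i == 0%N :> nat) = (i == 0))// (negPf i0).
    rewrite big1 // => k _; rewrite big1// => l _; rewrite !mxE (negPf i0).
    by rewrite [Num.conj 0]conjc0 mul0r scale0r.
  have [j0|j0] := eqVneq j 0; last first.
    rewrite (_ : (j == 0%N :> nat) = (j == 0))// (negPf j0) andbF.
    rewrite big1 // => k _; rewrite big1// => l _; rewrite !mxE (negPf j0).
    by rewrite mulr0 scale0r.
  rewrite i0 j0 /=; apply: eq_bigr => k _; apply: eq_bigr => l _.
  by rewrite !mxE.
rewrite pad_norm => /le_trans; apply.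
rewrite big_ord_recl big_ord0 (_ : Num.max _ _ = mnorm x); last first.
  by apply/max_idPl; exact: os_norm_ge0.
by rewrite ler_wpM2r ?os_norm_ge0// ler_pM ?sqrtr_ge0// ler_wsqrtr.
Qed.

End OperatorSpace.

Lemma smos_os (R : realType) (X : modata R) : is_smos X -> is_operator_space X.
Proof. by case. Qed.

Section Involution.
Variables (R : realType) (X : modata R).
Hypothesis iX : is_involution X.

Lemma star0 : star (0 : X) = 0.
Proof.
have [_ sZ _] := iX; have := sZ 0 0; rewrite scale0r => ->.
by rewrite [Num.conj 0]conjc0 scale0r.
Qed.

Lemma star_sum I (r : seq I) (P : pred I) (F : I -> X) :
  star (\sum_(i <- r | P i) F i) = \sum_(i <- r | P i) star (F i).
Proof.
have [sD _ _] := iX.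
by elim/big_rec2: _ => [|i y1 y2 _ <-]; rewrite ?star0 ?sD.
Qed.

Lemma mstarB n (x y : 'M[X]_n) : mstar (x - y) = mstar x - mstar y.
Proof.
have [sD sZ _] := iX; apply/matrixP => i j; rewrite !mxE sD; congr (_ + _).
by rewrite -scaleN1r sZ rmorphN rmorph1 scaleN1r.
Qed.

Lemma mstar_sum n I (r : seq I) (P : pred I) (F : I -> 'M[X]_n) :
  mstar (\sum_(i <- r | P i) F i) = \sum_(i <- r | P i) mstar (F i).
Proof.
have [sD _ _] := iX; elim/big_rec2: _ => [|k y1 y2 _ <-].
  by apply/matrixP => i j; rewrite !mxE star0.
by apply/matrixP => i j; rewrite !mxE sD.
Qed.

End Involution.

Section Families.
Variables (R : realType) (X : modata R) (I : Type) (d : I -> nat).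
Variable om : forall i, X -> matmo R (d i).
Local Notation C := R[i].
Implicit Types om : forall i, X -> matmo R (d i).

(** The pattern shared by dual spaces, ranges of [mu] and operator systems: the norm is a supremum
    over maps into matrix algebras, so the axioms are inherited from [matmo]. Requiring 0 <= c lets
    the family be empty. *)
Definition norming : Prop :=
  [/\ forall i, linear (om i), forall n (x : 'M[X]_n), 0 <= mnorm x,
      forall i n (x : 'M[X]_n), mnorm (map_mx (om i) x) <= mnorm x &
      forall n (x : 'M[X]_n) c, 0 <= c ->
        (forall i, mnorm (map_mx (om i) x) <= c) -> mnorm x <= c].

Lemma norming_operator_space : norming ->
  (forall x, (forall i, om i x = 0) -> x = 0) -> is_operator_space X.
Proof.
move=> [lom n0 nle nlub] sep.
have nZ n (a : C) (x : 'M[X]_n) : mnorm (map_mx ( *:%R a) x) <= Rnorm a * mnorm x.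
  apply: nlub; first by rewrite mulr_ge0 ?Rnorm_ge0.
  by move=> i; rewrite (map_linZ (lom i)) matmo_normZ ler_wpM2l ?Rnorm_ge0.
split.
- move=> n x y; apply: nlub; first by rewrite addr_ge0.
  move=> i; rewrite (map_linD (lom i)); apply: le_trans (matmo_normD _ _) _.
  by rewrite lerD.
- move=> n a x; apply: le_anti; rewrite nZ/=.
  have [->|a0] := eqVneq a 0; first by rewrite Rnorm0 mul0r.
  have := nZ n a^-1 (map_mx ( *:%R a) x).
  have -> : map_mx ( *:%R a^-1) (map_mx ( *:%R a) x) = x.
    by apply/matrixP => i j; rewrite !mxE scalerA mulVf// scale1r.
  have ap : 0 < Rnorm a.
    by rewrite lt_def Rnorm_ge0 andbT; apply: contra_neq a0 => /Rnorm_eq0.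
  by rewrite RnormV ler_pdivlMl.
- move=> n x x0; apply/matrixP => i j; rewrite mxE; apply: sep => k.
  have := nle k n x; rewrite x0 => h.
  have /matmo_norm0_eq0 : mnorm (map_mx (om k) x) = 0.
    by apply: le_anti; rewrite h matmo_norm_ge0.
  by move=> /matrixP /(_ i j); rewrite !mxE.
- move=> n x; apply: le_anti; apply/andP; split; apply: nlub => // i.
    by rewrite (map_lin_corner (lom i)) matmo_norm_corner.
  by rewrite -matmo_norm_corner -(map_lin_corner (lom i)).
- move=> n k a b x; apply: nlub.
    rewrite !mulr_ge0 ?sqrtr_ge0//.
    by elim/big_rec: _ => // i y _ y0; rewrite le_max y0 orbT.
  move=> i; rewrite (map_lin_sum (lom i)).
  under eq_bigr do rewrite (map_lin_mxact (lom i)).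
  apply: le_trans (matmo_mxact_le _ _ _) _.
  rewrite ler_wpM2l ?mulr_ge0 ?sqrtr_ge0//.
  elim/big_ind2: _ => // x1 x2 y1 y2 h1 h2.
  by rewrite ge_max !le_max h1 h2 orbT.
Qed.

(** The cone is the preimage of matrix cones under a family that need not be the one giving the
    norm: for a dual space the norm comes from the unit balls over X, the cone from the positive
    matrices over X. Such a family need not separate points, so self-adjointness is a separate
    clause. *)
Lemma family_matrix_cone :
  is_operator_space X -> is_involution X ->
  (forall n (x : 'M[X]_n), mnorm (mstar x) = mnorm x) ->
  (forall i, star_linear (om i)) ->
  (forall i, completely_bounded (om i)) ->
  (forall n (x : 'M[X]_n), mcone x <->
     mstar x = x /\ forall i, mcone (map_mx (om i) x)) ->
  is_matrix_cone X.
Proof.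
move=> oX iX nS lom bom cP; split.
- by move=> n x /cP[].
- have sc n (x : 'M[X]_n) : mstar (corner x) = corner (mstar x).
    rewrite /mstar /corner tr_block_mx map_block_mx; congr block_mx;
    by apply/matrixP => i j; rewrite !mxE ?star0.
  move=> n x; rewrite !cP sc; split=> -[xs h]; split.
  + by move/(congr1 ulsubmx): xs; rewrite /corner !block_mxKul.
  + by move=> i; apply/matmo_cone_corner; rewrite -map_lin_corner//; case: (lom i).
  + by rewrite xs.
  + by move=> i; rewrite map_lin_corner//; [apply/matmo_cone_corner|case: (lom i)].
- move=> n x h; apply/cP; split.
    apply/eqP; rewrite -subr_eq0; apply/eqP; case: (oX) => _ _ h0 _ _; apply: h0.
    apply: le_anti; rewrite os_norm_ge0// andbT; apply/ler_addgt0Pr => e e0.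
    rewrite add0r; have [y /cP[ys _] yx] := h (e / 2) (divr_gt0 e0 (ltr0Sn _ 1)).
    (* As y is self-adjoint, x differs from its adjoint by at most twice the distance to y. *)
    have -> : mstar x - x = mstar (x - y) + (y - x).
      by rewrite mstarB// ys addrA subrK.
    case: (oX) => hD _ _ _ _; apply: le_trans (hD _ _ _) _.
    by rewrite nS (os_normB oX y); lra.
  move=> i; apply: matmo_cone_closed => e e0; have [M Mb] := bom i.
  have M1 : 0 < `|M| + 1 by rewrite ltr_wpDl.
  have [y /cP[_ yc] yx] := h (e / (`|M| + 1)) (divr_gt0 e0 M1).
  exists (map_mx (om i) y); first exact: yc.
  rewrite -map_linB; last by case: (lom i).
  apply: le_lt_trans (Mb _ _) _.
  apply: (@le_lt_trans _ _ ((`|M| + 1) * mnorm (x - y))).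
    rewrite ler_wpM2r ?os_norm_ge0//; apply: le_trans (ler_norm _) _; by rewrite lerDl.
  by rewrite mulrC -ltr_pdivlMr.
- have sact n (a : 'M[C]_n) (x : 'M[X]_n) :
      mstar x = x -> mstar (mxact (a^t*) x a) = mxact (a^t*) x a.
    move=> xs; apply/matrixP => i j; rewrite !mxE.
    rewrite star_sum//; under eq_bigr do rewrite star_sum//; rewrite exchange_big.
    have [_ sZ _] := iX.
    apply: eq_bigr => k _; apply: eq_bigr => l _.
    rewrite -[in RHS]xs sZ !mxE; congr (_ *: _); rewrite rmorphM mulrC; congr (_ * _).
    exact: conjcK.
  move=> n k a x h; apply/cP; split.
    by rewrite mstar_sum//; apply: eq_bigr => i _; rewrite sact//; have /cP[] := h i.
  move=> i; have li : linear (om i) by case: (lom i).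
  rewrite (map_lin_sum li); under eq_bigr do rewrite (map_lin_mxact li).
  by apply: matmo_cone_mxact => j; have /cP[_] := h j.
Qed.

End Families.

(** * The dual of a matrix ordered space *)

Section SubspaceElements.
Variables (R : realType) (W : lmodType R[i]) (V : lspace W).

Lemma subl_val0 : val (0 : subl V) = 0. Proof. exact: raddf0. Qed.
Lemma subl_valD (f g : subl V) : val (f + g) = val f + val g.
Proof. exact: raddfD. Qed.
Lemma subl_valB (f g : subl V) : val (f - g) = val f - val g.
Proof. exact: raddfB. Qed.
Lemma subl_valZ a (f : subl V) : val (a *: f) = a *: val f.
Proof. exact: linearZ. Qed.
End SubspaceElements.

Section Inclusion.
Variables (R : realType) (X : modata R) (V : saspace X).

Definition incl (x : submo V) : X := val x.

Lemma incl_lin : linear incl.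
Proof. by move=> a x y; rewrite /incl subl_valD subl_valZ. Qed.

Lemma incl_inj : injective incl.
Proof. exact: val_inj. Qed.

Lemma inclP (x : submo V) : lset V (incl x).
Proof. exact: (set_mem (valP x)). Qed.

Lemma incl_surj (x : X) : lset V x -> exists y : submo V, incl y = x.
Proof. by move=> Vx; exists (Subl (mem_set Vx)). Qed.

Lemma incl_star x : incl (star x) = star (incl x).
Proof. by []. Qed.

Lemma incl_norm n (x : 'M[submo V]_n) : mnorm x = mnorm (map_mx incl x).
Proof. by []. Qed.

Lemma incl_coneP n (x : 'M[submo V]_n) : mcone x <-> mcone (map_mx incl x).
Proof. by []. Qed.

End Inclusion.

Section DualElements.
Variables (R : realType) (X : modata R).
Local Notation C := R[i].

Lemma dualP (f : dual X) : bounded_functional (val f).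
Proof. exact: (set_mem (valP f)). Qed.

Lemma dual_lin (f : dual X) : linear (val f).
Proof. by case: (dualP f). Qed.

Lemma dual_val (g : X -> C^o) :
  bounded_functional g -> val (insubd (0 : dual X) g) = g.
Proof. by move=> h; rewrite insubdK//; apply/mem_set. Qed.

Lemma dual_eq (f g : dual X) : (forall x, val f x = val g x) -> f = g.
Proof. by move=> h; apply: val_inj; apply/funext. Qed.

Lemma dual_val0 x : val (0 : dual X) x = 0. Proof. by rewrite subl_val0. Qed.
Lemma dual_valD (f g : dual X) x : val (f + g) x = val f x + val g x.
Proof. by rewrite subl_valD. Qed.
Lemma dual_valZ a (f : dual X) x : val (a *: f) x = a * val f x.
Proof. by rewrite subl_valZ. Qed.
Lemma dual_valB (f g : dual X) x : val (f - g) x = val f x - val g x.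
Proof. by rewrite subl_valB. Qed.

Lemma theta_lin m (f : 'M[dual X]_m) : linear (theta f).
Proof.
by move=> a x y; apply/matrixP => i j; rewrite !mxE dual_lin.
Qed.

Lemma form_theta n m (f : 'M[dual X]_m) (x : 'M[X]_n) v w :
  form (map_mx (theta f) x) v w =
  \sum_i \sum_j \sum_a \sum_b val (f a b) (x i j) * (v j b * conjc (w i a)).
Proof.
apply: eq_bigr => i _; apply: eq_bigr => j _; apply: eq_bigr => a _.
by apply: eq_bigr => b _; rewrite !mxE.
Qed.

End DualElements.

Section DualNorm.
Variables (R : realType) (X : modata R).
Local Notation C := R[i].
Hypothesis oX : is_operator_space X.

Lemma dual_bound (f : dual X) :
  exists M : R, 0 <= M /\ forall x, Rnorm (val f x) <= M * nrm x.
Proof.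
have [_ [M h]] := dualP f; exists `|M|; split=> // x; apply: le_trans (h x) _.
by rewrite ler_wpM2r ?ler_norm ?nrm_ge0.
Qed.

(* A functional is automatically completely bounded: compressing x by scalar
   vectors v and w gives a single element of X of norm at most |v||w||x|. *)
Lemma functional_form_le (g : X -> C^o) (M : R) n (x : 'M[X]_n) (v w : 'I_n -> C) :
  linear g -> 0 <= M -> (forall y, Rnorm (g y) <= M * nrm y) ->
  Rnorm (\sum_i \sum_j (g (x i j) : C) * (v j * conjc (w i))) <=
  M * mnorm x * Num.sqrt (\sum_i Rnorm (v i) ^+ 2) * Num.sqrt (\sum_i Rnorm (w i) ^+ 2).
Proof.
move=> lg M0 gM.
have -> : \sum_i \sum_j (g (x i j) : C) * (v j * conjc (w i)) =
          g (\sum_i \sum_j (conjc (w i) * v j) *: x i j).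
  rewrite (lin_sum lg); apply: eq_bigr => i _; rewrite (lin_sum lg).
  apply: eq_bigr => j _; rewrite (linZ lg) -[RHS]/(_ * _) [RHS]mulrC.
  by congr (_ * _); rewrite mulrC.
apply: le_trans (gM _) _; rewrite -!mulrA ler_wpM2l//.
apply: le_trans (compress_norm oX x v w) _.
by rewrite mulrC [X in _ * X]mulrC.
Qed.

(** Any finite bound will do, and the sum of the bounds of the entries is one. It shows that the
    supremum defining the dual norm is taken over a bounded set. *)
Lemma theta_bounded m (f : 'M[dual X]_m) :
  exists2 B : R, 0 <= B & forall n (x : 'M[X]_n),
    mnorm (map_mx (theta f) x) <= B * mnorm x.
Proof.
pose M a b := sval (cid (dual_bound (f a b))).
have M0 a b : 0 <= M a b by rewrite /M; case: cid => ? [].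
have MP a b x : Rnorm (val (f a b) x) <= M a b * nrm x.
  by rewrite /M; case: cid => ? [].
have B0 : 0 <= \sum_a \sum_b M a b by apply: sumr_ge0 => a _; apply: sumr_ge0.
exists (\sum_a \sum_b M a b) => // n x.
apply/matmo_norm_leP; first by rewrite mulr_ge0 ?os_norm_ge0.
move=> v w; rewrite form_theta.
have -> : \sum_i \sum_j \sum_a \sum_b val (f a b) (x i j) * (v j b * conjc (w i a)) =
  \sum_a \sum_b \sum_i \sum_j (val (f a b) (x i j) : C) * (v j b * conjc (w i a)).
  under eq_bigr do rewrite exchange_big; rewrite exchange_big; apply: eq_bigr => a _.
  under eq_bigr do rewrite exchange_big; by rewrite exchange_big.
have col_le (u : 'M[C]_(n, m)) a : Num.sqrt (\sum_i Rnorm (u i a) ^+ 2) <= hs u.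
  rewrite ler_wsqrtr//; apply: ler_sum => i _.
  by rewrite (bigD1 a)//= lerDl sumr_ge0// => c _; exact: sqr_ge0.
rewrite !mulr_suml; apply: le_trans (Rnorm_sum _ _ _) _; apply: ler_sum => a _.
rewrite !mulr_suml; apply: le_trans (Rnorm_sum _ _ _) _; apply: ler_sum => b _.
have := functional_form_le x (v^~ b) (w^~ a) (@dual_lin _ _ (f a b)) (M0 a b) (MP a b).
move=> /le_trans; apply.
apply: ler_pM; rewrite ?mulr_ge0 ?os_norm_ge0 ?sqrtr_ge0//.
by rewrite ler_wpM2l// mulr_ge0 ?os_norm_ge0.
Qed.

Lemma dual_norm_has_sup m (f : 'M[dual X]_m) :
  has_sup [set r : R | exists n (x : 'M[X]_n),
    mnorm x <= 1 /\ r = mnorm (map_mx (theta f) x)].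
Proof.
have [B B0 h] := theta_bounded f; split.
  by exists (mnorm (map_mx (theta f) (0 : 'M[X]_0))), 0%N, 0; rewrite (os_norm0 oX).
exists B => _ [n [x [x1 ->]]]; apply: le_trans (h _ _) _.
by rewrite -[leRHS]mulr1 ler_wpM2l.
Qed.

Lemma dual_norm_ge0 m (f : 'M[dual X]_m) : 0 <= mnorm f.
Proof.
have /ub_le_sup h : has_ubound [set r : R | exists n (x : 'M[X]_n),
    mnorm x <= 1 /\ r = mnorm (map_mx (theta f) x)].
  by case: (dual_norm_has_sup f).
apply: (@le_trans _ _ (mnorm (map_mx (theta f) (0 : 'M[X]_0)))).
  exact: matmo_norm_ge0.
by apply: h; exists 0%N, 0; rewrite (os_norm0 oX).
Qed.

Lemma dual_norm_bound m (f : 'M[dual X]_m) n (x : 'M[X]_n) :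
  mnorm (map_mx (theta f) x) <= mnorm f * mnorm x.
Proof.
have h (y : 'M[X]_n) : mnorm y <= 1 -> mnorm (map_mx (theta f) y) <= mnorm f.
  move=> y1; apply: ub_le_sup; last by exists n, y.
  by case: (dual_norm_has_sup f).
have [x0|x0] := eqVneq (mnorm x) 0.
  have -> : x = 0 by case: oX => _ _ + _ _; apply.
  rewrite (map_lin0 (theta_lin f)) (os_norm0 oX) mulr0.
  apply/matmo_norm_leP => // v w; by rewrite form0 Rnorm0 !mul0r.
have xp : 0 < mnorm x by rewrite lt_def x0 os_norm_ge0.
have hZ : forall (a : C) (y : 'M[X]_n), mnorm (map_mx ( *:%R a) y) = Rnorm a * mnorm y.
  by case: oX => _ + _ _ _; apply.
have := h (map_mx ( *:%R ((mnorm x)^-1)%:C) x).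
rewrite (map_linZ (theta_lin f)) matmo_normZ hZ Rnorm_real ?invr_ge0 ?(ltW xp)//.
by rewrite mulVf ?lt0r_neq0// lexx => /(_ isT); rewrite ler_pdivrMl// mulrC.
Qed.

Lemma dual_norm_lub m (f : 'M[dual X]_m) (c : R) : 0 <= c ->
  (forall n (x : 'M[X]_n), mnorm (map_mx (theta f) x) <= c * mnorm x) -> mnorm f <= c.
Proof.
move=> c0 h; apply: ge_sup; first by case: (dual_norm_has_sup f).
move=> _ [n [x [x1 ->]]]; apply: le_trans (h _ _) _.
by rewrite -[leRHS]mulr1 ler_wpM2l.
Qed.

Lemma dual_apply_le (f : dual X) x : Rnorm (val f x) <= nrm f * nrm x.
Proof.
have := dual_norm_bound (const_mx f : 'M[dual X]_1) (const_mx x : 'M[X]_1).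
move=> /le_trans h; have := matmo_form_le (map_mx (theta (const_mx f : 'M[dual X]_1))
  (const_mx x : 'M[X]_1)) (delta_mx 0 0) (delta_mx 0 0).
rewrite form_delta !mxE !hs_delta !mulr1 => /le_trans; apply; exact: h.
Qed.

(** For a single functional the completely bounded norm is the ordinary norm, by
    [functional_form_le]; estimates in the dual can therefore be made on elements of X. *)
Lemma dual_nrm_le (f : dual X) (c : R) : 0 <= c ->
  (forall x, Rnorm (val f x) <= c * nrm x) -> nrm f <= c.
Proof.
move=> c0 h; apply: dual_norm_lub => // n x.
apply/matmo_norm_leP; first by rewrite mulr_ge0 ?os_norm_ge0.
move=> v w; rewrite form_theta.
have := functional_form_le x (v^~ 0) (w^~ 0) (@dual_lin _ _ f) c0 h.
have hE (u : 'M[C]_(n, 1)) : Num.sqrt (\sum_i Rnorm (u i 0) ^+ 2) = hs u.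
  by congr Num.sqrt; apply: eq_bigr => i _; rewrite big_ord1.
rewrite !hE => /(le_trans _); apply; rewrite le_eqVlt; apply/orP; left; apply/eqP.
congr Rnorm; apply: eq_bigr => i _; apply: eq_bigr => j _.
by rewrite !big_ord1 !mxE.
Qed.

(** [theta] read from the other side: a matrix over X becomes a map from the dual into matrices,
    equal to [theta] up to the shuffle. The matrices in the unit balls over X thus form a norming
    family for [dual X]. *)
Definition evmx n (x : 'M[X]_n) (f : dual X) : matmo R n :=
  \matrix_(i, j) (val f (x i j) : C).

Lemma map_evmx n (x : 'M[X]_n) m (f : 'M[dual X]_m) :
  map_mx (evmx x) f = mxswap (map_mx (theta f) x).
Proof.
apply/matrixP => a b; rewrite !mxE; apply/matrixP => i j.
by rewrite !mxE.
Qed.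

Lemma evmx_norm n (x : 'M[X]_n) m (f : 'M[dual X]_m) :
  mnorm (map_mx (evmx x) f) = mnorm (map_mx (theta f) x).
Proof. by rewrite map_evmx mxswap_norm. Qed.

Lemma evmx_cone n (x : 'M[X]_n) m (f : 'M[dual X]_m) :
  mcone (map_mx (evmx x) f) <-> mcone (map_mx (theta f) x).
Proof. by rewrite map_evmx mxswap_cone. Qed.

Lemma evmx_lin n (x : 'M[X]_n) : linear (evmx x).
Proof. by move=> a f g; apply/matrixP => i j; rewrite !mxE dual_valD dual_valZ. Qed.

Lemma dual_operator_space : is_operator_space (dual X).
Proof.
apply: (@norming_operator_space R (dual X) {n & {x : 'M[X]_n | mnorm x <= 1}}
  (fun i => tag i) (fun i => evmx (sval (tagged i)))).
  split.
  - by move=> i; exact: evmx_lin.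
  - by move=> n f; exact: dual_norm_ge0.
  - move=> [k [x x1]] n f; rewrite evmx_norm /=.
    apply: le_trans (dual_norm_bound _ _) _.
    by rewrite -[leRHS]mulr1 ler_wpM2l ?dual_norm_ge0.
  - move=> n f c c0 h; apply: ge_sup; first by case: (dual_norm_has_sup f).
    move=> _ [k [x [x1 ->]]].
    by have := h (existT _ k (exist _ x x1)); rewrite evmx_norm.
move=> f h; apply: dual_eq => x.
have [x0|x0] := eqVneq (nrm x) 0.
  by rewrite (nrm_eq0 oX x0) (lin0 (@dual_lin _ _ f)) (lin0 (@dual_lin _ _ 0)).
have xp : 0 < nrm x by rewrite lt_def x0 nrm_ge0.
have y1 : mnorm (const_mx (((nrm x)^-1)%:C *: x) : 'M[X]_1) <= 1.
  have -> : const_mx (((nrm x)^-1)%:C *: x) =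
            map_mx ( *:%R ((nrm x)^-1)%:C) (const_mx x : 'M[X]_1).
    by apply/matrixP => i j; rewrite !mxE.
  case: oX => _ -> _ _ _; rewrite Rnorm_real ?invr_ge0 ?(ltW xp)//.
  by rewrite -/(nrm x) mulVf.
have := h (existT (fun n => {z : 'M[X]_n | mnorm z <= 1}) 1%N
  (exist (fun z : 'M[X]_1 => is_true (mnorm z <= 1)) _ y1)) => /matrixP /(_ 0 0).
rewrite !mxE /= (linZ (@dual_lin _ _ f)) => /eqP.
rewrite mulf_eq0 => /orP[|/eqP//].
by rewrite (inj_eq (@complexI R) _ 0) invr_eq0 (negPf x0).
Qed.

Lemma kappaE (x : X) (f : dual X) : val (kappa X x) f = val f x.
Proof.
have b : bounded_functional (fun g : dual X => val g x).
  split; first by move=> a g h; rewrite dual_valD dual_valZ.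
  by exists (nrm x) => g; rewrite mulrC; exact: dual_apply_le.
by rewrite /kappa (dual_val b).
Qed.

Lemma kappaD a x y : kappa X (a *: x + y) = a *: kappa X x + kappa X y.
Proof. by apply: dual_eq => f; rewrite dual_valD dual_valZ !kappaE dual_lin. Qed.

Lemma kappa0 : kappa X 0 = 0.
Proof. by apply: dual_eq => f; rewrite kappaE (lin0 (@dual_lin _ _ f)). Qed.

End DualNorm.

Section DualCone.
Variables (R : realType) (X : modata R).
Local Notation C := R[i].
Hypothesis sX : is_smos X.

Let oX := smos_os sX.

Lemma smos_star_lin : [/\ forall x y : X, star (x + y) = star x + star y,
      forall (a : C) (x : X), star (a *: x) = conjc a *: star x &
      forall x : X, star (star x) = x].
Proof. by case: sX => _ []. Qed.

Lemma nrm_star (x : X) : nrm (star x) = nrm x.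
Proof.
case: sX => _ _ h _; rewrite /nrm -(h 1%N (const_mx x)); congr mnorm.
by apply/matrixP => i j; rewrite !mxE.
Qed.

(** The involution is isometric, so the conjugated functional is bounded and the default of
    [dual_star] does not occur. *)
Lemma dual_starE (f : dual X) x : val (star f) x = conjc (val f (star x)).
Proof.
have [sD sZ sK] := smos_star_lin.
have b : bounded_functional (fun y : X => conjc (val f (star y)) : C^o).
  split.
    move=> a y z; rewrite sD sZ dual_lin rmorphD /=; congr (_ + _).
    by rewrite -[X in conjc X]/(_ * _) rmorphM /= conjcK.
  have [M [M0 h]] := dual_bound oX f; exists M => y.
  by rewrite [Rnorm _]Rnorm_conj -(nrm_star y); exact: h.
by rewrite [star f]/(dual_star f) /dual_star (dual_val b).
Qed.

Lemma dual_involution : is_involution (dual X).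
Proof.
have [sD sZ sK] := smos_star_lin; split.
- by move=> f g; apply: dual_eq => x; rewrite dual_valD !dual_starE dual_valD rmorphD.
- by move=> a f; apply: dual_eq => x; rewrite dual_valZ !dual_starE dual_valZ rmorphM.
- by move=> f; apply: dual_eq => x; rewrite !dual_starE conjcK sK.
Qed.

Lemma theta_mstar n m (f : 'M[dual X]_m) (x : 'M[X]_n) :
  map_mx (theta (mstar f)) x = mstar (map_mx (theta f) (mstar x)).
Proof.
apply/matrixP => i j; rewrite !mxE; apply/matrixP => a b; rewrite !mxE.
by rewrite dual_starE.
Qed.

Lemma dual_norm_star m (f : 'M[dual X]_m) : mnorm (mstar f) = mnorm f.
Proof.
have [sD sZ sK] := smos_star_lin.
have h (g : 'M[dual X]_m) : mnorm (mstar g) <= mnorm g.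
  apply: (dual_norm_lub oX); first exact: dual_norm_ge0.
  move=> n x; rewrite theta_mstar matmo_norm_star.
  by case: sX => _ _ <- _; exact: dual_norm_bound.
apply: le_anti; apply/andP; split; first exact: h.
have e : mstar (mstar f) = f.
  by apply/matrixP => i j; rewrite !mxE; have [_ _ ->] := dual_involution.
by rewrite -{1}e; exact: h.
Qed.

Lemma dual_coneP m (f : 'M[dual X]_m) :
  mcone f <-> mstar f = f /\ forall n (x : 'M[X]_n), mcone x -> mcone (map_mx (theta f) x).
Proof.
have [sD sZ sK] := smos_star_lin.
split=> -[fs h]; split=> //; first by case: h.
split=> //; split; first exact: theta_lin.
move=> x; apply/matrixP => i j; rewrite !mxE -[in LHS]fs !mxE.
by rewrite [in LHS]dual_starE sK.
Qed.

Lemma evmx_star n (x : 'M[X]_n) (f : dual X) : mstar x = x -> evmx x (star f) = star (evmx x f).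
Proof.
move=> xs; apply/matrixP => i j; rewrite !mxE dual_starE.
by rewrite -[in RHS]xs !mxE.
Qed.

Lemma dual_smos : is_smos (dual X).
Proof.
have oD := dual_operator_space oX; have iD := dual_involution.
split; [exact: oD|exact: iD|by move=> n f; exact: dual_norm_star|].
apply: (@family_matrix_cone R (dual X) {n & {x : 'M[X]_n | mcone x}}
  (fun i => tag i) (fun i => evmx (sval (tagged i)))).
- exact: oD.
- exact: iD.
- by move=> n f; exact: dual_norm_star.
- move=> [n [x xc]]; split; first exact: evmx_lin.
  by move=> f /=; apply: evmx_star; case: sX => _ _ _ [h _ _ _]; exact: h.
- move=> [k [x xc]]; exists (mnorm x) => n f; rewrite evmx_norm mulrC.
  exact: dual_norm_bound.
- move=> n f; apply: (iff_trans (dual_coneP f)); split=> -[fs h]; split=> //.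
    by move=> [k [x xc]]; apply: (iffRL (evmx_cone x f)); exact: h.
  move=> k x xc; apply: (iffLR (evmx_cone x f)).
  exact: (h (existT (fun k => {z : 'M[X]_k | mcone z}) k
    (exist (fun z : 'M[X]_k => mcone z) x xc))).
Qed.

End DualCone.

Section DualMapTheory.
Variables (R : realType) (X Y : modata R) (phi : X -> Y).
Hypotheses (oX : is_operator_space X) (oY : is_operator_space Y).
Hypotheses (lphi : linear phi) (bphi : completely_bounded phi).

Lemma cb_bound : exists2 M : R, 0 < M & forall n (x : 'M[X]_n),
  mnorm (map_mx phi x) <= M * mnorm x.
Proof.
have [M h] := bphi; exists (`|M| + 1); first by rewrite ltr_wpDl.
move=> n x; apply: le_trans (h _ _) _; rewrite ler_wpM2r ?os_norm_ge0//.
by apply: le_trans (ler_norm _) _; rewrite lerDl.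
Qed.

Lemma dual_mapE (g : dual Y) x : val (dual_map phi g) x = val g (phi x).
Proof.
have b : bounded_functional (fun x : X => val g (phi x)).
  split; first by move=> a u v; rewrite lphi dual_lin.
  have [M M0 h] := cb_bound; have [N [N0 k]] := dual_bound oY g.
  exists (N * M) => u; apply: le_trans (k _) _; rewrite -mulrA ler_wpM2l//.
  by have := h 1%N (const_mx u); rewrite map_const_mx.
by rewrite /dual_map (dual_val b).
Qed.

Lemma theta_dual_map n m (g : 'M[dual Y]_m) (x : 'M[X]_n) :
  map_mx (theta (map_mx (dual_map phi) g)) x = map_mx (theta g) (map_mx phi x).
Proof.
apply/matrixP => i j; rewrite !mxE; apply/matrixP => a b.
by rewrite !mxE dual_mapE.
Qed.

Lemma dual_map_lin : linear (dual_map phi).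
Proof. move=> a f g; apply: dual_eq => x.
by rewrite dual_mapE !dual_valD !dual_valZ !dual_mapE. Qed.

Lemma dual_map_bound (M : R) : 0 <= M ->
  (forall n (x : 'M[X]_n), mnorm (map_mx phi x) <= M * mnorm x) ->
  forall m (g : 'M[dual Y]_m), mnorm (map_mx (dual_map phi) g) <= M * mnorm g.
Proof.
move=> M0 h m g; apply: dual_norm_lub => //; first by rewrite mulr_ge0 ?dual_norm_ge0.
move=> n x; rewrite theta_dual_map; apply: le_trans (dual_norm_bound oY _ _) _.
by rewrite [M * _]mulrC -mulrA ler_wpM2l ?dual_norm_ge0.
Qed.

Lemma dual_map_cb : completely_bounded (dual_map phi).
Proof.
have [M M0 h] := cb_bound; exists M => m g; exact: (dual_map_bound (ltW M0)).
Qed.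

End DualMapTheory.

Section DualMapPositive.
Variables (R : realType) (X Y : modata R) (phi : X -> Y).
Hypotheses (sX : is_smos X) (sY : is_smos Y).

Lemma dual_map_CBp : CBp phi -> CBp (@dual_map R X Y phi).
Proof.
move=> [[[lphi sphi] pphi] bphi].
have oX := smos_os sX.
have oY := smos_os sY.
have sE g : dual_map phi (star g) = star (dual_map phi g).
  by apply: dual_eq => x; rewrite dual_mapE// !dual_starE// dual_mapE// sphi.
split; last exact: dual_map_cb.
split; first by split=> //; exact: dual_map_lin.
move=> m g /(dual_coneP sY) [gs gp]; apply/dual_coneP => //; split.
  by rewrite -map_mstar// gs.
by move=> n x xc; rewrite theta_dual_map//; apply: gp; exact: pphi.
Qed.

End DualMapPositive.

(** * Bounded operators and their compressions *)

Section Hilbert.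
Variables (R : realType) (H : hilbert R).
Local Notation C := R[i].
Local Notation "''[' u , v ]" := (ip H u v).

Lemma ipDl (u v w : H) : '[u + v, w] = '[u, w] + '[v, w].
Proof. exact: linearDl. Qed.

Lemma ipZl a (u w : H) : '[a *: u, w] = a * '[u, w].
Proof. exact: linearZl_LR. Qed.

Lemma ipC (u w : H) : '[u, w] = conjc '[w, u].
Proof. by have := hermC (ip H) u w; rewrite expr0 mul1r. Qed.

Lemma ipDr (u v w : H) : '[w, u + v] = '[w, u] + '[w, v].
Proof. exact: linearDr. Qed.

Lemma ipZr a (u w : H) : '[w, a *: u] = conjc a * '[w, u].
Proof. exact: linearZr_LR. Qed.

Lemma ip0l (w : H) : '[0, w] = 0.
Proof. by rewrite -(scale0r 0) ipZl mul0r. Qed.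

Lemma ip0r (w : H) : '[w, 0] = 0.
Proof. by rewrite ipC ip0l conjc0. Qed.

Lemma ipBl (u v w : H) : '[u - v, w] = '[u, w] - '[v, w].
Proof. by rewrite ipDl -scaleN1r ipZl mulN1r. Qed.

Lemma ipBr (u v w : H) : '[w, u - v] = '[w, u] - '[w, v].
Proof. by rewrite ipC ipBl rmorphB /= -!ipC. Qed.

Lemma ip_suml I (r : seq I) (P : pred I) (F : I -> H) w :
  '[\sum_(i <- r | P i) F i, w] = \sum_(i <- r | P i) '[F i, w].
Proof. by elim/big_rec2: _ => [|i y1 y2 _ <-]; rewrite ?ip0l ?ipDl. Qed.

Lemma ip_sumr I (r : seq I) (P : pred I) (F : I -> H) w :
  '[w, \sum_(i <- r | P i) F i] = \sum_(i <- r | P i) '[w, F i].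
Proof. by elim/big_rec2: _ => [|i y1 y2 _ <-]; rewrite ?ip0r ?ipDr. Qed.

Lemma ipE (v : H) : '[v, v] = (Rnorm v ^+ 2)%:C.
Proof. by rewrite ip_norm rmorphXn /= RnormE. Qed.

Lemma ip_ext (u v : H) : (forall w, '[u, w] = '[v, w]) -> u = v.
Proof.
move=> h; apply/eqP; rewrite -subr_eq0; apply/eqP; apply: Rnorm_eq0.
have : '[u - v, u - v] = 0 by rewrite ipBl h subrr.
rewrite ipE => /(@complexI R _ 0) /eqP.
by rewrite sqrf_eq0 => /eqP.
Qed.

Lemma ip_cauchy_schwarz (u v : H) : Rnorm '[u, v] <= Rnorm u * Rnorm v.
Proof.
have [v0|v0] := eqVneq (Rnorm v) 0.
  by rewrite (Rnorm_eq0 v0) ip0r !Rnorm0 mulr0.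
have vp : 0 < Rnorm v by rewrite lt_def v0 Rnorm_ge0.
set t := '[u, v]; pose N := Rnorm v ^+ 2.
have N0 : N != 0 by rewrite expf_neq0.
pose a : C := t * (N^-1)%:C.
have : '[u - a *: v, u - a *: v] = (Rnorm u ^+ 2 - Rnorm t ^+ 2 / N)%:C.
  rewrite ipBl !ipBr !ipZl !ipZr !ipE -/t (ipC v u) -/t -/N.
  have aN : a * N%:C = t.
    by rewrite /a -mulrA -rmorphM /= mulVf// mulr1.
  have aC : conjc a * N%:C = conjc t.
    by rewrite -[in RHS]aN [RHS]conjcM conjc_real.
  have tN : (Rnorm t ^+ 2 / N)%:C = conjc a * t.
    have aE : conjc a = conjc t * (N^-1)%:C.
      transitivity (conjc t * conjc (N^-1)%:C); first exact: conjcM.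
      by rewrite conjc_real.
    transitivity ((Rnorm t ^+ 2)%:C * (N^-1)%:C); first exact: rmorphM.
    by rewrite Rnorm_sqr aE [RHS]mulrAC [t * _]mulrC.
  by rewrite aC subrr subr0 [RHS](rmorphB (@real_complex R)) /= tN.
rewrite ipE => /(@complexI R) e.
have : 0 <= Rnorm u ^+ 2 - Rnorm t ^+ 2 / N by rewrite -e sqr_ge0.
rewrite subr_ge0 ler_pdivrMr ?exprn_gt0// -exprMn.
by rewrite ler_pXn2r// nnegrE ?mulr_ge0 ?Rnorm_ge0.
Qed.

Lemma hnorm_ge0 n (v : 'I_n -> H) : 0 <= hnorm v.
Proof. exact: sqrtr_ge0. Qed.

Lemma hnormE n (v : 'I_n -> H) : hnorm v ^+ 2 = \sum_i Rnorm (v i) ^+ 2.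
Proof. by rewrite sqr_sqrtr// sumr_ge0// => i _; exact: sqr_ge0. Qed.

Lemma hnorm_eq0 n (v : 'I_n -> H) : hnorm v = 0 -> v = fun=> 0.
Proof.
move=> h; have : hnorm v ^+ 2 = 0 by rewrite h expr0n.
rewrite hnormE => /psumr_eq0P h1; apply/funext => i.
apply: Rnorm_eq0; apply/eqP; rewrite -sqrf_eq0; apply/eqP; apply: h1 => // j _.
exact: sqr_ge0.
Qed.

Lemma hnorm_sum_ip n (v w : 'I_n -> H) :
  Rnorm (\sum_i '[v i, w i]) <= hnorm v * hnorm w.
Proof.
apply: le_trans (Rnorm_sum _ _ _) _.
apply: (le_trans _ (cauchy_schwarz_sum _ _ _ _)).
by apply: ler_sum => i _; exact: ip_cauchy_schwarz.
Qed.

Lemma hnormZ n (a : C) (v : 'I_n -> H) : hnorm (fun i => a *: v i) = Rnorm a * hnorm v.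
Proof.
rewrite /hnorm -[Rnorm a in RHS]ger0_norm ?Rnorm_ge0// -sqrtr_sqr.
rewrite -sqrtrM ?sqr_ge0// mulr_sumr; congr Num.sqrt; apply: eq_bigr => i _.
by rewrite RnormZ exprMn.
Qed.

Definition contractive_frame m (e : 'I_m -> H) : Prop :=
  forall c : 'I_m -> C, Rnorm (\sum_i c i *: e i) ^+ 2 <= \sum_i Rnorm (c i) ^+ 2.

(* A vector depending on the previous ones contributes r = 0, and then Rocq's
   r / |r| is again 0. *)
Lemma gram_schmidt (s : seq H) : exists (m : nat) (e : nat -> H),
  [/\ forall i j, i != j -> '[e i, e j] = 0, forall i, e i = 0 \/ Rnorm (e i) = 1,
      forall i, (m <= i)%N -> e i = 0 &
      forall u, u \in s -> u = \sum_(i < m) '[u, e i] *: e i].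
Proof.
elim: s => [|u s [m [e [orth norm1 e0 span]]]].
  exists 0%N, (fun=> 0); split; [by move=> *; rewrite ip0l|by left| by []|by []].
pose r := u - \sum_(i < m) '[u, e i] *: e i.
pose f i := if i == m then ((Rnorm r)^-1)%:C *: r else e i.
have sq (v : H) i : '[v, e i] * '[e i, e i] = '[v, e i].
  case: (norm1 i) => [->|h]; first by rewrite ip0r mul0r.
  by rewrite ipE h expr1n mulr1.
have r_e j : (j < m)%N -> '[r, e j] = 0.
  move=> jm; rewrite ipBl ip_suml (bigD1 (Ordinal jm))//= big1 ?addr0; last first.
    by move=> i ij; rewrite ipZl orth ?mulr0//; apply: contra_neq ij => /= ij; exact: val_inj.
  by rewrite ipZl sq subrr.
have fm : f m = ((Rnorm r)^-1)%:C *: r by rewrite /f eqxx.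
have fe i : i != m -> f i = e i by rewrite /f => /negPf ->.
have f_e j : j != m -> '[f m, f j] = 0.
  move=> jm; rewrite fm fe// ipZl; have [lt|ge] := ltnP j m; first by rewrite r_e// mulr0.
  by rewrite (e0 j)// ip0r mulr0.
have e_fm (i : 'I_m) : '[e i, f m] = 0.
  by rewrite ipC -(fe i) ?f_e ?conjc0// neq_ltn ltn_ord.
have fr : '[r, f m] *: f m = r.
  have [r0|r0] := eqVneq (Rnorm r) 0; first by rewrite fm (Rnorm_eq0 r0) scaler0 scaler0.
  rewrite fm ipZr ipE scalerA.
  have -> : conjc ((Rnorm r)^-1)%:C * (Rnorm r ^+ 2)%:C * ((Rnorm r)^-1)%:C = 1.
    rewrite [conjc _]conjc_real -!rmorphM /= expr2 mulrA mulVf// mul1r divff//.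
  by rewrite scale1r.
have expand v : v = \sum_(i < m) '[v, e i] *: e i ->
    v = \sum_(i < m.+1) '[v, f i] *: f i.
  move=> ve; rewrite big_ord_recr /= {1}ve.
  have -> : '[v, f m] = 0.
    by rewrite {1}ve ip_suml big1// => i _; rewrite ipZl e_fm mulr0.
  rewrite scale0r addr0; apply: eq_bigr => i _.
  by rewrite fe// neq_ltn ltn_ord.
exists m.+1, f; split.
- move=> i j ij; have [im|im] := eqVneq i m.
    by rewrite im f_e// -im eq_sym.
  have [jm|jm] := eqVneq j m; first by rewrite jm ipC f_e// conjc0.
  by rewrite !fe// orth.
- move=> i; have [->|im] := eqVneq i m; last by rewrite fe.
  rewrite fm; have [r0|r0] := eqVneq (Rnorm r) 0.
    by left; rewrite (Rnorm_eq0 r0) scaler0.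
  by right; rewrite RnormZ Rnorm_real ?invr_ge0 ?Rnorm_ge0// mulVf.
- by move=> i mi; rewrite fe ?gtn_eqF// e0// ltnW.
- move=> v; rewrite inE => /orP[/eqP ->|vs]; last by apply: expand; exact: span.
  have uE : u = r + \sum_(i < m) '[u, e i] *: e i by rewrite subrK.
  have ue i : i != m -> '[u, f i] = '[u, e i] by move=> im; rewrite fe.
  have ur : '[u, f m] = '[r, f m].
    rewrite {1}uE ipDl ip_suml [X in _ + X]big1 ?addr0// => i _.
    by rewrite ipZl e_fm mulr0.
  rewrite big_ord_recr /= ur fr addrC {1}uE; congr (_ + _).
  by apply: eq_bigr => i _; rewrite fe// neq_ltn ltn_ord.
Qed.

(** One orthogonal frame of unit or zero vectors spans both families, and the coefficients have the
    Hilbert norms of the families. A zero vector is appended so that the size is a successor, as in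
    the index set [WQ] of [mu]. *)
Lemma frame_exists n (v w : 'I_n -> H) : exists m (e : 'I_m.+1 -> H) (c d : 'M[C]_(n, m.+1)),
  [/\ contractive_frame e, forall j, v j = \sum_b c j b *: e b,
      forall i, w i = \sum_a d i a *: e a, hs c = hnorm v & hs d = hnorm w].
Proof.
have [m [f [orth norm1 e0 span]]] := gram_schmidt (codom v ++ codom w).
pose e (i : 'I_m.+1) := f i.
have normE (c : 'I_m.+1 -> C) :
    '[\sum_i c i *: e i, \sum_i c i *: e i] = (\sum_i (Rnorm (c i) * Rnorm (e i)) ^+ 2)%:C.
  rewrite ip_suml rmorph_sum /=; apply: eq_bigr => i _.
  rewrite ipZl ip_sumr (bigD1 i)//= [X in _ + X]big1 ?addr0; last first.
    move=> j ji; rewrite ipZr orth ?mulr0// eq_sym.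
    by apply: contra_neq ji => ji; exact: val_inj.
  by rewrite ipZr ipE mulrA -Rnorm_sqr -rmorphM exprMn.
have spanE u : u \in codom v ++ codom w -> u = \sum_(b < m.+1) '[u, e b] *: e b.
  have em : e ord_max = 0 by rewrite /e e0.
  move=> /span ue; rewrite big_ord_recr /= em scaler0 addr0.
  by rewrite {1}ue; apply: eq_bigr => i _.
have hsE' (u : 'I_n -> H) : (forall j, u j \in codom v ++ codom w) ->
    hs (\matrix_(j, b) '[u j, e b]) = hnorm u.
  move=> hu; congr Num.sqrt; apply: eq_bigr => j _.
  apply: (@complexI R); rewrite -ipE (spanE (u j) (hu j)) normE; congr (_%:C).
  apply: eq_bigr => b _; rewrite mxE.
  case: (norm1 b) => [eb|eb]; last by rewrite /e eb mulr1.
  by rewrite /e eb ip0r !Rnorm0 mul0r.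
have vin j : v j \in codom v ++ codom w by rewrite mem_cat codom_f.
have win j : w j \in codom v ++ codom w by rewrite mem_cat codom_f orbT.
exists m, e, (\matrix_(j, b) '[v j, e b]), (\matrix_(j, b) '[w j, e b]); split.
- move=> c; apply: (@le_trans _ _ (\sum_i (Rnorm (c i) * Rnorm (e i)) ^+ 2)).
    by rewrite -lecR -normE ipE.
  apply: ler_sum => i _; rewrite ler_pXn2r ?nnegrE ?mulr_ge0 ?Rnorm_ge0//.
  rewrite ler_piMr ?Rnorm_ge0//.
  by case: (norm1 i) => [h|h]; rewrite /e h ?Rnorm0.
- by move=> j; rewrite [LHS]spanE//; apply: eq_bigr => b _; rewrite mxE.
- by move=> j; rewrite [LHS]spanE//; apply: eq_bigr => b _; rewrite mxE.
- exact: hsE'.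
- exact: hsE'.
Qed.

Lemma contractive_hnorm n m (e : 'I_m -> H) (c : 'M[C]_(n, m)) :
  contractive_frame e -> hnorm (fun i => \sum_a c i a *: e a) <= hs c.
Proof. by move=> h; rewrite ler_wsqrtr//; apply: ler_sum => i _; exact: h. Qed.

End Hilbert.

Section BoundedOperators.
Variables (R : realType) (H : hilbert R).
Local Notation C := R[i].
Local Notation "''[' u , v ]" := (ip H u v).

Lemma bopP (x : BH H) : bounded_operator (val x).
Proof. exact: (set_mem (valP x)). Qed.

Lemma bop_lin (x : BH H) : linear (val x).
Proof. by case: (bopP x). Qed.

Lemma bop_eq (x y : BH H) : (forall u, val x u = val y u) -> x = y.
Proof. by move=> h; apply: val_inj; apply/funext. Qed.

Definition opform n (x : 'M[BH H]_n) (v w : 'I_n -> H) : C :=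
  \sum_i '[bop_amp x v i, w i].

Lemma opformE n (x : 'M[BH H]_n) v w :
  opform x v w = \sum_i \sum_j '[val (x i j) (v j), w i].
Proof. by apply: eq_bigr => i _; rewrite ip_suml. Qed.

Lemma bop_ampZ n (x : 'M[BH H]_n) a v :
  bop_amp x (fun i => a *: v i) = fun i => a *: bop_amp x v i.
Proof.
apply/funext => i; rewrite /bop_amp scaler_sumr; apply: eq_bigr => j _.
by rewrite (linZ (@bop_lin _)).
Qed.

Lemma bop_bound (x : BH H) :
  exists M : R, 0 <= M /\ forall u, Rnorm (val x u) <= M * Rnorm u.
Proof.
have [_ [M h]] := bopP x; exists `|M|; split=> // u; apply: le_trans (h u) _.
by rewrite ler_wpM2r ?ler_norm ?Rnorm_ge0.
Qed.

Lemma BH_norm_has_sup n (x : 'M[BH H]_n) :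
  has_sup [set hnorm (bop_amp x v) | v in [set v : 'I_n -> H | hnorm v <= 1]].
Proof.
pose M i j := sval (cid (bop_bound (x i j))).
have M0 i j : 0 <= M i j by rewrite /M; case: cid => ? [].
have MP i j u : Rnorm (val (x i j) u) <= M i j * Rnorm u.
  by rewrite /M; case: cid => ? [].
split.
  exists (hnorm (bop_amp x (fun=> 0))), (fun=> 0) => //=.
  rewrite /hnorm big1 ?sqrtr0// => i _.
  by rewrite Rnorm0 expr0n.
exists (Num.sqrt (\sum_i (\sum_j M i j) ^+ 2)) => _ [v /= v1 <-].
rewrite ler_wsqrtr//; apply: ler_sum => i _.
rewrite ler_pXn2r ?nnegrE ?Rnorm_ge0 ?sumr_ge0//.
apply: le_trans (Rnorm_sum _ _ _) _; apply: ler_sum => j _.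
apply: le_trans (MP _ _ _) _; rewrite ler_piMr//; apply: le_trans v1.
rewrite -(ler_pXn2r (n := 2)) ?nnegrE ?hnorm_ge0 ?Rnorm_ge0// hnormE.
by rewrite (bigD1 j)//= lerDl sumr_ge0// => k _; exact: sqr_ge0.
Qed.

Lemma BH_norm_ge0 n (x : 'M[BH H]_n) : 0 <= mnorm x.
Proof.
have [_ /ub_le_sup ub] := BH_norm_has_sup x.
apply: (@le_trans _ _ (hnorm (bop_amp x (fun=> 0)))); first exact: hnorm_ge0.
apply: ub; exists (fun=> 0) => //=.
by rewrite /hnorm big1 ?sqrtr0// => i _; rewrite Rnorm0 expr0n.
Qed.

Lemma bop_amp_le n (x : 'M[BH H]_n) v : hnorm (bop_amp x v) <= mnorm x * hnorm v.
Proof.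
have [v0|v0] := eqVneq (hnorm v) 0.
  rewrite v0 mulr0 (hnorm_eq0 v0) /hnorm big1 ?sqrtr0// => i _.
  by rewrite /bop_amp big1 ?Rnorm0 ?expr0n// => j _; rewrite (lin0 (@bop_lin _)).
have vp : 0 < hnorm v by rewrite lt_def v0 hnorm_ge0.
have [_ /ub_le_sup ub] := BH_norm_has_sup x.
pose u i := ((hnorm v)^-1)%:C *: v i.
have : hnorm (bop_amp x u) <= mnorm x.
  apply: ub; exists u => //=.
  by rewrite hnormZ Rnorm_real ?invr_ge0 ?(ltW vp)// mulVf.
by rewrite bop_ampZ hnormZ Rnorm_real ?invr_ge0 ?(ltW vp)// ler_pdivrMl// mulrC.
Qed.

Lemma opform_le n (x : 'M[BH H]_n) v w :
  Rnorm (opform x v w) <= mnorm x * hnorm v * hnorm w.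
Proof.
apply: le_trans (hnorm_sum_ip _ _) _.
by rewrite ler_wpM2r ?hnorm_ge0// bop_amp_le.
Qed.

Lemma BH_norm_lub n (x : 'M[BH H]_n) (c : R) : 0 <= c ->
  (forall v w, Rnorm (opform x v w) <= c * hnorm v * hnorm w) -> mnorm x <= c.
Proof.
move=> c0 h; apply: ge_sup; first by case: (BH_norm_has_sup x).
move=> _ [v /= v1 <-]; have := h v (bop_amp x v).
rewrite /opform; under eq_bigr do rewrite ipE.
rewrite -rmorph_sum /= -hnormE Rnorm_real ?sqr_ge0// expr2.
have [->//|n0] := eqVneq (hnorm (bop_amp x v)) 0.
rewrite ler_pM2r ?lt_def ?n0 ?hnorm_ge0// => /le_trans; apply.
by rewrite -[leRHS]mulr1 ler_wpM2l.
Qed.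

Definition compression m (e : 'I_m -> H) (x : BH H) : matmo R m :=
  \matrix_(a, b) ('[val x (e b), e a] : C).

Lemma compression_lin m (e : 'I_m -> H) : linear (compression e).
Proof.
move=> a x y; apply/matrixP => i j; rewrite !mxE.
by rewrite subl_valD subl_valZ ipDl ipZl.
Qed.

Lemma form_compression n m (e : 'I_m -> H) (x : 'M[BH H]_n) v w :
  form (map_mx (compression e) x) v w =
  opform x (fun j => \sum_b v j b *: e b) (fun i => \sum_a w i a *: e a).
Proof.
rewrite opformE; apply: eq_bigr => i _; apply: eq_bigr => j _.
rewrite ip_sumr; apply: eq_bigr => a _; rewrite (lin_sum (@bop_lin _)) ip_suml.
apply: eq_bigr => b _; rewrite !mxE (linZ (@bop_lin _)) ipZl ipZr.
by rewrite mulrC mulrA.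
Qed.

Lemma compression_norm_le m (e : 'I_m -> H) n (x : 'M[BH H]_n) :
  contractive_frame e -> mnorm (map_mx (compression e) x) <= mnorm x.
Proof.
move=> he; apply/matmo_norm_leP; first exact: BH_norm_ge0.
move=> v w; rewrite form_compression; apply: le_trans (opform_le _ _ _) _.
rewrite -!mulrA ler_wpM2l ?BH_norm_ge0//.
by apply: ler_pM; rewrite ?hnorm_ge0// contractive_hnorm.
Qed.

Lemma compression_norm_lub n (x : 'M[BH H]_n) (c : R) : 0 <= c ->
  (forall m (e : 'I_m.+1 -> H), contractive_frame e ->
     mnorm (map_mx (compression e) x) <= c) -> mnorm x <= c.
Proof.
move=> c0 h; apply: BH_norm_lub => // v w.
have [m [e [p [q [he vE wE hp hq]]]]] := frame_exists v w.
have -> : v = fun j => \sum_b p j b *: e b by apply/funext.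
have -> : w = fun j => \sum_b q j b *: e b by apply/funext.
rewrite -form_compression; apply: le_trans (matmo_form_le _ _ _) _.
have -> : hnorm (fun j => \sum_b p j b *: e b) = hs p.
  by rewrite hp; congr hnorm; apply/funext => j; rewrite vE.
have -> : hnorm (fun j => \sum_b q j b *: e b) = hs q.
  by rewrite hq; congr hnorm; apply/funext => j; rewrite wE.
by rewrite -!mulrA ler_wpM2r ?mulr_ge0 ?hs_ge0// h.
Qed.

Lemma compression_coneP n (x : 'M[BH H]_n) :
  mcone x <-> forall m (e : 'I_m.+1 -> H), contractive_frame e ->
     mcone (map_mx (compression e) x).
Proof.
split=> [h m e he|h v].
  by apply/matmo_coneP => v; rewrite form_compression; exact: h.
have [m [e [p [q [he vE _ _ _]]]]] := frame_exists v v.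
have -> : v = fun j => \sum_b p j b *: e b by apply/funext.
have /matmo_coneP := h m e he => /(_ p).
by rewrite form_compression.
Qed.

Lemma compression_ext (x y : BH H) :
  (forall m (e : 'I_m.+1 -> H), contractive_frame e -> compression e x = compression e y) ->
  x = y.
Proof.
move=> h; apply: bop_eq => u; apply: ip_ext => w.
have [m [e [p [q [he vE wE _ _]]]]] := frame_exists (fun _ : 'I_1 => u) (fun=> w).
rewrite (vE 0) (wE 0) !(lin_sum (@bop_lin _)) !ip_suml; apply: eq_bigr => b _.
rewrite !ip_sumr; apply: eq_bigr => a _; rewrite !(linZ (@bop_lin _)) !ipZl !ipZr.
by have /matrixP /(_ a b) := h m e he; rewrite !mxE => ->.
Qed.

(* BH has no adjoints by definition: star x is 0 when x has none, and then
   star (star x) = x forces x = 0. *)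
Lemma adjoint_of_involutive (x : BH H) : star (star x) = x ->
  forall u v, '[val x u, v] = '[u, val (star x) v].
Proof.
pose A (z : BH H) := [set T : bop H | forall u v, '[val z u, v] = '[u, val T v]].
have starE z : star z = xget 0 (A z) by [].
have [[T hT]|noadj] := pselect (exists T, A x T).
  by move=> _; rewrite starE; exact: (xgetPex 0 (ex_intro _ T hT)).
have x0 : star x = 0.
  by rewrite starE; apply: xgetPN => T hT; apply: noadj; exists T.
rewrite x0 starE => xE; exfalso; apply: noadj; exists 0 => u v.
have hx : A 0 x.
  by rewrite -xE; apply: xgetPex; exists 0 => ? ?; rewrite subl_val0 ip0l ip0r.
have -> : val x u = 0.
  apply: ip_ext => w; have := hx w u; rewrite subl_val0 ip0l ip0l.
  by rewrite (ipC w) => /(congr1 conjc); rewrite conjcK conjc0.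
by rewrite subl_val0 ip0l ip0r.
Qed.

Lemma compression_star m (e : 'I_m -> H) (x : BH H) : star (star x) = x ->
  compression e (star x) = star (compression e x).
Proof.
move=> /adjoint_of_involutive h; apply/matrixP => a b; rewrite !mxE.
by rewrite [LHS]ipC -h.
Qed.

End BoundedOperators.

(** * The weak* topology *)

Section ComplexLimits.
Variable R : realType.
Local Notation C := R[i].

Lemma cvgCP (T : Type) (FF : set_system T) (f : T -> C^o) (l : C^o) : Filter FF ->
  f @ FF --> l <-> forall e : R, 0 < e -> \forall x \near FF, Rnorm (f x - l) < e.
Proof.
move=> FFF; split.
  move=> /cvgrPdist_lt h e e0.
  have e0' : 0 < e%:C :> C by rewrite ltcR.
  have := h _ e0'; apply: filterS => x.
  by rewrite distrC -RnormE ltcR.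
move=> h; apply/cvgrPdist_lt => e e0.
have := h (Rnorm e); rewrite -ltcR -Rnorm_ge0C ?(ltW e0)// => /(_ e0).
by apply: filterS => x; rewrite -ltcR RnormE -Rnorm_ge0C ?(ltW e0)// distrC.
Qed.

Lemma nbhsCP (l : C^o) (B : set C^o) : nbhs l B ->
  exists e : R, 0 < e /\ forall z, Rnorm (z - l) < e -> B z.
Proof.
move=> /nbhs_normP [e /= e0 h]; exists (Rnorm e).
have e0' : 0 < Rnorm e by rewrite -ltcR -Rnorm_ge0C ?(ltW e0).
split=> // z hz; apply: h; rewrite /= distrC -RnormE [ltRHS]Rnorm_ge0C ?(ltW e0)//.
by rewrite ltcR.
Qed.

End ComplexLimits.

Section WeakStarTopology.
Variables (R : realType) (D : modata R) (F : set (dual D)).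
Local Notation C := R[i].

(** The sets given by finitely many inequalities form a filter G in the product space. Each
    coordinate converges along G, hence so does the point, and G contains every neighbourhood. *)
Lemma wstar_nbhsP (x : D) (A : set D) : nbhs (x : wstar F) A ->
  exists (s : seq F) (e : R), 0 < e /\ forall y : D,
    (forall f, f \in s -> Rnorm (val (val f) y - val (val f) x) < e) -> A y.
Proof.
pose ev (y : D) : prod_topology (fun _ : F => C^o) := fun f : F => val (val f) y.
pose G : set_system (prod_topology (fun _ : F => C^o)) := [set U |
  exists (s : seq F) (e : R), 0 < e /\ forall p : F -> C,
    (forall f, f \in s -> Rnorm (p f - ev x f) < e) -> U p].
have GF : Filter G.
  split.
  - by exists [::], 1; split.
  - move=> U V [s [e [e0 hU]]] [t [d [d0 hV]]].
    exists (s ++ t), (Num.min e d); split; first by rewrite lt_min e0.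
    move=> p hp; split.
      by apply: hU => f fs; have := hp f; rewrite mem_cat fs lt_min => /(_ isT) /andP[].
    by apply: hV => f fs; have := hp f; rewrite mem_cat fs orbT lt_min => /(_ isT) /andP[].
  - by move=> U V UV [s [e [e0 hU]]]; exists s, e; split=> // p hp; apply/UV/hU.
have Gcvg : G --> ev x.
  apply/cvg_sup => f U [B [[B' B'o <-] B'x] BU].
  have : nbhs (ev x f) B' by exact: open_nbhs_nbhs.
  move=> /nbhsCP [e [e0 he]].
  exists [:: f], e; split=> // p hp; apply: BU; apply: he.
  by apply: hp; rewrite inE.
move=> [B [[B' B'o <-] B'x] BA].
have : nbhs (ev x) B' by exact: open_nbhs_nbhs.
move=> /Gcvg [s [e [e0 h]]]; exists s, e; split=> // y hy.
by apply: BA; apply: h.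
Qed.

Lemma wstar_eval_continuous (f : dual D) : F f ->
  continuous (val f : wstar F -> C^o).
Proof.
move=> Ff x.
pose f' : F := SigSub (mem_set Ff).
have c1 : continuous ((fun y : D => (fun g : F => val (val g) y)) :
    wstar F -> prod_topology (fun _ : F => C^o)).
  exact: initial_continuous.
have := @proj_continuous F (fun=> C^o) f' ((fun g : F => val (val g) x)).
exact: (continuous_comp (c1 x)).
Qed.

Lemma wstar_continuousD (g h : wstar F -> C^o) :
  continuous g -> continuous h -> continuous (fun x => g x + h x : C^o).
Proof. by move=> cg ch x; apply: (cvgD (cg x) (ch x)). Qed.

Lemma wstar_continuousZ (a : C) (g : wstar F -> C^o) :
  continuous g -> continuous (fun x => a * g x : C^o).
Proof.
move=> cg x; apply: (iffRL (@cvgCP R _ (nbhs (x : wstar F)) _ _ (nbhs_filter _))) => e e0.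
have a0 : 0 < Rnorm a + 1 by rewrite ltr_wpDl ?Rnorm_ge0.
have := cg x => /(cvgCP _ _) /(_ _ (divr_gt0 e0 a0)); apply: filterS => y.
rewrite -mulrBr RnormM ltr_pdivlMr// mulrC => /(le_lt_trans _); apply.
by rewrite ler_wpM2r ?Rnorm_ge0// lerDl.
Qed.

Lemma wstar_continuous_kernel (g : D -> C^o) :
  linear g -> continuous (g : wstar F -> C^o) ->
  exists s : seq F, forall y, (forall f, f \in s -> val (val f) y = 0) -> g y = 0.
Proof.
move=> lg cg; have nb : nbhs ((0 : D) : wstar F) [set y : D | Rnorm (g y) < 1].
  have := cg 0 => /(cvgCP _ _) /(_ 1 ltr01); apply: filterS => y.
  by rewrite (lin0 lg) subr0.
have [s [e [e0 h]]] := wstar_nbhsP nb; exists s => y fy.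
apply: Rnorm_eq0; apply/eqP; rewrite eq_le Rnorm_ge0 andbT leNgt; apply/negP => gy.
(* Scaling y keeps the functionals in s at 0 but brings |g| to exactly 1, outside the neighbourhood
   where it is smaller than 1. *)
pose t : C := ((Rnorm (g y))^-1)%:C.
have := h (t *: y).
have hs f : f \in s -> Rnorm (val (val f) (t *: y) - val (val f) 0) < e.
  move=> fs; rewrite (linZ (@dual_lin _ _ (val f))) (lin0 (@dual_lin _ _ (val f))).
  by rewrite fy// scaler0 subr0 Rnorm0.
move=> /(_ hs) /=; rewrite (linZ lg) [Rnorm _]RnormM Rnorm_real ?invr_ge0 ?(ltW gy)//.
by rewrite mulVf ?lt0r_neq0// ltxx.
Qed.

(* Induction on the number of functionals: either some x0 is killed by all the
   others but not by f, and then g - g(x0) f is handled by induction, or f is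
   redundant. *)
Lemma kernel_span_ind (P : (D -> C^o) -> Prop) : P (fun=> 0) ->
  (forall a (f : dual D) h, F f -> P h -> P (fun x => a * val f x + h x : C^o)) ->
  forall (s : seq F) (g : D -> C^o), linear g ->
  (forall y, (forall f, f \in s -> val (val f) y = 0) -> g y = 0) -> P g.
Proof.
move=> P0 PD; elim=> [|f s IH] g lg gs.
  suff -> : g = fun=> 0 by [].
  by apply/funext => y; apply: gs.
have [[x0 [sx0 fx0]]|nx0] := pselect (exists x0, (forall h : F, h \in s -> val (val h) x0 = 0) /\
    val (val f) x0 != 0).
  have lf := @dual_lin _ _ (val f).
  pose a : C := g x0 / val (val f) x0.
  pose g' : D -> C^o := fun y => g y - a * val (val f) y.
  have -> : g = fun y => a * val (val f) y + g' y.
    by apply/funext => y; rewrite /g' addrC subrK.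
  apply: PD; first by exact: (set_mem (valP f)).
  apply: IH; first by move=> b y z; rewrite /g' lg lf /GRing.scale /=; ring.
  move=> y hy; pose z := y - (val (val f) y / val (val f) x0) *: x0.
  have gz : g z = 0.
    apply: gs => h; rewrite inE => /orP[/eqP ->|hs].
      by rewrite (linB lf) (linZ lf) -[_ *: _]/(_ * _) divfK// subrr.
    by rewrite (linB (@dual_lin _ _ (val h))) (linZ (@dual_lin _ _ (val h))) (hy _ hs) (sx0 _ hs) scaler0 subr0.
  have gy : g y = (val (val f) y / val (val f) x0) * g x0.
    by move: gz; rewrite (linB lg) (linZ lg) => /eqP; rewrite subr_eq0 => /eqP.
  rewrite /g' gy /a; move: (g x0) (val (val f) y) (val (val f) x0) => p q r.
  by apply/eqP; rewrite subr_eq0 mulrC mulrCA [X in _ == X]mulrC.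
apply: IH => // y hy; apply: gs => h; rewrite inE => /orP[/eqP ->|]; last exact: hy.
by apply/eqP; apply: contra_notT nx0 => fy; exists y.
Qed.

(** A weak*-continuous linear functional is a finite linear combination of elements of F. As an
    induction principle this applies to F that is given as a mere set, such as the range of [kappa]
    or the restrictions of the predual of B(H). *)
Lemma wstar_continuous_ind (P : (D -> C^o) -> Prop) : P (fun=> 0) ->
  (forall a (f : dual D) h, F f -> P h -> P (fun x => a * val f x + h x : C^o)) ->
  forall g : D -> C^o, linear g -> continuous (g : wstar F -> C^o) -> P g.
Proof.
move=> P0 PD g lg cg; have [s h] := wstar_continuous_kernel lg cg.
exact: (kernel_span_ind P0 PD lg h).
Qed.

End WeakStarTopology.

Section WeakStarMaps.
Variable R : realType.
Local Notation C := R[i].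

Lemma wstar_continuous_mem (D : modata R) (F : lspace (dual D)) (g : D -> C^o) :
  linear g -> continuous (g : wstar F -> C^o) -> exists2 f, lset F f & g = val f.
Proof.
apply: (wstar_continuous_ind (P := fun g => exists2 f, lset F f & g = val f)).
  by exists 0; [exact: lset0|apply/funext => x; rewrite dual_val0].
move=> a f h Ff [k Fk ->]; exists (a *: f + k); first exact: lsetZD.
by apply/funext => x; rewrite dual_valD dual_valZ.
Qed.

Lemma wcontinuousP (D E : modata R) (F : set (dual D)) (G : set (dual E)) (phi : D -> E) :
  wcontinuous F G phi <->
  forall g, G g -> continuous ((fun x => val g (phi x)) : wstar F -> C^o).
Proof.
split=> [cphi g Gg x|h x A /wstar_nbhsP [s [e [e0 hA]]]].
  exact: (continuous_comp (cphi x) (wstar_eval_continuous Gg (x := phi x))).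
pose B := [set y : D | forall f, f \in s ->
   Rnorm (val (val f) (phi y) - val (val f) (phi x)) < e].
suff : nbhs (x : wstar F) B by apply: filterS => y By; exact: hA.
rewrite /B; elim: s {hA B} => [|f s IH].
  by apply: filterS filterT => y _ f; rewrite in_nil.
have nf : \forall y \near (x : wstar F), Rnorm (val (val f) (phi y) - val (val f) (phi x)) < e.
  have := h (val f) (set_mem (valP f)) x => /(cvgCP _ _); exact.
by apply: filterS2 nf IH => y hf hs k; rewrite inE => /orP[/eqP ->|/hs].
Qed.

Lemma wcontinuous_comp (D E K : modata R) (F : set (dual D)) (G : set (dual E))
  (L : set (dual K)) (phi : D -> E) (psi : E -> K) :
  wcontinuous F G phi -> wcontinuous G L psi -> wcontinuous F L (psi \o phi).
Proof. by move=> c1 c2 x; exact: (continuous_comp (c1 x) (c2 (phi x))). Qed.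

Lemma wstar_matrix_continuousP (D : modata R) (F : set (dual D)) n
    (phi : D -> 'M[C^o]_n) :
  continuous (phi : wstar F -> 'M[C^o]_n) <->
  forall i j, continuous ((fun x => phi x i j) : wstar F -> C^o).
Proof.
split=> [c i j x|c x A [P MP PA]].
  move=> A /= nA; have nb : nbhs (phi x) [set M : 'M[C^o]_n | A (M i j)].
    exists (fun k l => if (k == i) && (l == j) then A else setT).
      by move=> k l; case: ifP => [/andP[/eqP -> /eqP ->]//|_]; exact: filterT.
    by move=> M /= /(_ i j); rewrite !eqxx.
  exact: (c x _ nb).
have h1 i j : nbhs (x : wstar F) [set y : D | P i j (phi y i j)] := c i j x _ (MP i j).
have h2 i := @filter_forall _ _ (fun j (y : wstar F) => P i j (phi y i j)) _ (nbhs_filter (x : wstar F)) (h1 i).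
have h3 := @filter_forall _ _ (fun i (y : wstar F) => forall j, P i j (phi y i j)) _
  (nbhs_filter (x : wstar F)) h2.
by apply: filterS h3 => y hy; exact: PA.
Qed.

End WeakStarMaps.

(** * The map mu *)

Section MatrixSumTheory.
Variables (R : realType) (I : Type) (d : I -> nat).
Local Notation C := R[i].
Local Notation N := (Defs.msum R d).

(** Crude, but free of any factor depending on m: this bounds the supremum over all summands in the
    norm of [msum]. *)
Lemma matmo_norm_le_sum n m (x : 'M[matmo R m]_n) :
  mnorm x <= \sum_i \sum_j nrm (x i j).
Proof.
apply/matmo_norm_leP.
  by apply: sumr_ge0 => i _; apply: sumr_ge0 => j _; exact: matmo_norm_ge0.
move=> v w.
have row_le (u : 'M[C]_(n, m)) i : vnorm (row i u)^T <= hs u.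
  rewrite /vnorm /hs ler_wsqrtr// (bigD1 i)//=.
  rewrite [leLHS](_ : _ = \sum_a Rnorm (u i a) ^+ 2); last first.
    by apply: eq_bigr => a _; rewrite !mxE.
  by rewrite lerDl sumr_ge0// => k _; rewrite sumr_ge0// => a _; exact: sqr_ge0.
have -> : form x v w = \sum_i \sum_j ((row i w)^T^t* *m x i j *m (row j v)^T) 0 0.
  apply: eq_bigr => i _; apply: eq_bigr => j _.
  rewrite mxE exchange_big; apply: eq_bigr => b _; rewrite mxE mulr_suml.
  by apply: eq_bigr => a _; rewrite !mxE -[Num.conj _]/(conjc _); ring.
rewrite !mulr_suml; apply: le_trans (Rnorm_sum _ _ _) _; apply: ler_sum => i _.
rewrite !mulr_suml; apply: le_trans (Rnorm_sum _ _ _) _; apply: ler_sum => j _.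
apply: le_trans (matmo_vector_form_le _ _ _) _.
apply: ler_pM; rewrite ?mulr_ge0 ?vnorm_ge0 ?matmo_norm_ge0// ?row_le//.
by rewrite ler_wpM2l ?row_le// matmo_norm_ge0.
Qed.

Definition mcoord (i : I) (y : N) : matmo R (d i) := val y i.

Lemma mcoord_lin i : linear (mcoord i).
Proof. by move=> a x y; rewrite /mcoord subl_valD subl_valZ. Qed.

Lemma msum_bounded (y : N) : bounded_family (val y).
Proof. exact: (set_mem (valP y)). Qed.

Lemma msum_has_ubound n (x : 'M[N]_n) :
  has_ubound [set mnorm (map_mx (mcoord i) x) | i in [set: I]].
Proof.
pose M k l := sval (cid (msum_bounded (x k l))).
have MP k l i : nrm (mcoord i (x k l)) <= M k l by rewrite /M; case: cid => ? /=; exact.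
exists (\sum_k \sum_l M k l) => _ [i _ <-].
apply: le_trans (matmo_norm_le_sum _) _.
by apply: ler_sum => k _; apply: ler_sum => l _; rewrite mxE.
Qed.

Lemma mcoord_norm_le i n (x : 'M[N]_n) : mnorm (map_mx (mcoord i) x) <= mnorm x.
Proof. by apply: (ub_le_sup (msum_has_ubound x)); exists i. Qed.

Lemma msum_norm_ge0 n (x : 'M[N]_n) : 0 <= mnorm x.
Proof.
have [[j]|nI] := pselect (inhabited I).
  by apply: le_trans (mcoord_norm_le j x); exact: matmo_norm_ge0.
have e : [set mnorm (map_mx (mcoord i) x) | i in [set: I]] = set0.
  by rewrite -subset0 => y [k _ _]; case: nI; exists.
by rewrite -[mnorm x]/(sup [set mnorm (map_mx (mcoord i) x) | i in [set: I]]) e sup0.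
Qed.

Lemma msum_norm_lub n (x : 'M[N]_n) (c : R) : 0 <= c ->
  (forall i, mnorm (map_mx (mcoord i) x) <= c) -> mnorm x <= c.
Proof.
move=> c0 h; have [[j]|nI] := pselect (inhabited I).
  apply: ge_sup; first by exists (mnorm (map_mx (mcoord j) x)), j.
  by move=> _ [k _ <-].
have e : [set mnorm (map_mx (mcoord i) x) | i in [set: I]] = set0.
  by rewrite -subset0 => y [k _ _]; case: nI; exists.
by rewrite -[mnorm x]/(sup [set mnorm (map_mx (mcoord i) x) | i in [set: I]]) e sup0.
Qed.

Lemma msum_starE (y : N) i : mcoord i (star y) = star (mcoord i y).
Proof.
rewrite /mcoord; set z := fun j => star (val y j) : matmo R (d j).
have bz : bounded_family z.
  have [M h] := msum_bounded y; exists M => j.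
  have -> : nrm (z j) = nrm (val y j).
    rewrite /nrm -(matmo_norm_star (const_mx (val y j))); congr mnorm.
    by apply/matrixP => k l; rewrite !mxE.
  exact: h.
have zm : z \in lset (LSpace (@bounded_family0 R I d) (@bounded_familyZD R I d)).
  exact/mem_set.
rewrite [star y](_ : _ = insubd (0 : msum_car R d) z)//.
by rewrite insubdK.
Qed.

End MatrixSumTheory.

Section Series.
Variable R : realType.
Local Notation C := R[i].

(** Convergence is obtained from real and imaginary parts. The remainder estimate is the point:
    later it turns convergence of a series of functionals on each element into convergence in
    norm. *)
Lemma series_dominated (t : nat -> C) (a : nat -> R) :
  (forall k, Rnorm (t k) <= a k) -> cvgn (series a) ->
  exists l : C, series (t : nat -> C^o) @ \oo --> (l : C^o) /\
    forall n, Rnorm (l - series t n) <= limn (series a) - series a n.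
Proof.
move=> ta ca.
have a0 k : 0 <= a k by apply: le_trans (ta k); exact: Rnorm_ge0.
have real_cvg (u : nat -> R) : (forall k, `|u k| <= a k) -> cvgn (series u).
  move=> ua; apply: (@normed_cvg R R^o); apply: series_le_cvg ca => // k.
  exact: normr_ge0.
have cr : cvgn (series (fun k => complex.Re (t k))).
  by apply: real_cvg => k; apply: le_trans (Re_le_Rnorm _) (ta k).
have ci : cvgn (series (fun k => complex.Im (t k))).
  by apply: real_cvg => k; apply: le_trans (Im_le_Rnorm _) (ta k).
pose l : C := Complex (limn (series (fun k => complex.Re (t k))))
                      (limn (series (fun k => complex.Im (t k)))).
have seriesE n : series t n = Complex (series (fun k => complex.Re (t k)) n)
                                      (series (fun k => complex.Im (t k)) n).
  apply/eqP; rewrite eq_complex /= /series /=.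
  by rewrite !raddf_sum !eqxx.
have cl : series (t : nat -> C^o) @ \oo --> (l : C^o).
  apply/cvgCP => e e0.
  have e2 : 0 < e / 2 by rewrite divr_gt0.
  have /cvgrPdist_lt /(_ _ e2) h1 := cr.
  have /cvgrPdist_lt /(_ _ e2) h2 := ci.
  apply: filterS2 h1 h2 => n h1 h2; rewrite seriesE.
  apply: le_lt_trans (Rnorm_le_ReIm _) _.
  by rewrite /= -[`|_ - _|]normrN opprB -[X in _ + X]normrN opprB; lra.
exists l; split=> // n; apply/ler_addgt0Pr => e e0.
have := cl => /(cvgCP _ _) /(_ e e0) [K _ hK].
pose m := maxn K n; have := hK m; rewrite /= leq_maxl => /(_ isT) hm.
have -> : l - series t n = (series t m - series t n) - (series t m - l).
  by move: (series _ _) (series _ _) => p q; ring.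
apply: le_trans (RnormD _ _) _; rewrite RnormN; apply: lerD; last exact: ltW.
apply: (@le_trans _ _ (series a m - series a n)).
  rewrite !sub_series_geq ?leq_maxr//; apply: le_trans (Rnorm_sum _ _ _) _.
  exact: ler_sum.
rewrite lerD2r; apply: nondecreasing_cvgn_le => //.
by apply: nondecreasing_series => k _ _.
Qed.

End Series.

Section MuTheory.
Variables (R : realType) (D : modata R) (F : set (dual D)).
Local Notation C := R[i].
Local Notation TD := (submo (mu_range F)).

(** [mu] with its range as codomain, for any set F of functionals; [mu_td] is the case where F is
    the range of [kappa]. *)
Definition mus (x : D) : TD := Subl (mu_range_in F x).

Definition wq (i : WQall F) : D -> matmo R (tag i).+1 := sval (tagged i).

Definition tcoord (i : WQall F) (u : TD) : matmo R (tag i).+1 := mcoord i (val u).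

Lemma wqP i : [/\ star_linear (wq i),
  forall n (x : 'M[D]_n), mcone x -> mcone (map_mx (wq i) x),
  complete_contraction (wq i) &
  forall k l, continuous ((fun x => wq i x k l) : wstar F -> C^o)].
Proof.
case: i => n [phi [[[sl cp] cc] c]]; split=> //.
by move=> k l; have /wstar_matrix_continuousP := c; exact.
Qed.

Lemma tcoord_mus i x : tcoord i (mus x) = wq i x.
Proof. by []. Qed.

Lemma map_tcoord_mus i n (x : 'M[D]_n) :
  map_mx (tcoord i) (map_mx mus x) = map_mx (wq i) x.
Proof. by apply/matrixP => k l; rewrite !mxE tcoord_mus. Qed.

Lemma tcoord_lin i : linear (tcoord i).
Proof.
by move=> a u v; rewrite /tcoord subl_valD subl_valZ mcoord_lin.
Qed.

Lemma td_norm_ge0 n (u : 'M[TD]_n) : 0 <= mnorm u.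
Proof. exact: msum_norm_ge0. Qed.

Lemma map_tcoord i n (u : 'M[TD]_n) :
  map_mx (tcoord i) u = map_mx (mcoord i) (map_mx val u).
Proof.
by apply: esym; exact: map_mx_comp_ext.
Qed.

Lemma td_norming : norming tcoord.
Proof.
split.
- exact: tcoord_lin.
- exact: td_norm_ge0.
- by move=> i n u; rewrite map_tcoord; exact: (mcoord_norm_le i (map_mx val u)).
- move=> n u c c0 h; apply: (msum_norm_lub c0) => i.
  by rewrite -map_tcoord.
Qed.

Lemma td_ext (u v : TD) : (forall i, tcoord i u = tcoord i v) -> u = v.
Proof.
move=> h; apply: val_inj; apply: val_inj; apply: functional_extensionality_dep => i.
exact: h.
Qed.

Lemma td_operator_space : is_operator_space TD.
Proof.
apply: (norming_operator_space td_norming) => u h; apply: td_ext => i.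
by rewrite h (lin0 (@tcoord_lin i)).
Qed.

Lemma td_coneP n (u : 'M[TD]_n) : mcone u <-> forall i, mcone (map_mx (tcoord i) u).
Proof.
split=> h i; first by rewrite map_tcoord; exact: h.
by rewrite -[X in mcone X]map_tcoord; exact: h.
Qed.

Lemma tcoord_star i u : tcoord i (star u) = star (tcoord i u).
Proof. exact: msum_starE. Qed.

Lemma td_cone_sa n (u : 'M[TD]_n) : mcone u -> mstar u = u.
Proof.
move=> /td_coneP uc; apply/matrixP => k l; apply: td_ext => i.
rewrite !mxE tcoord_star; have /matrixP /(_ k l) := matmo_cone_sa (uc i).
by rewrite !mxE.
Qed.

Lemma mus_surj (u : TD) : exists x, u = mus x.
Proof.
have [x _ ex] := set_mem (valP u); exists x; apply: val_inj.
by rewrite -ex.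
Qed.

Lemma mus_lin : linear mus.
Proof.
move=> a x y; apply: td_ext => i; rewrite tcoord_lin !tcoord_mus.
by have [[li _] _ _ _] := wqP i; rewrite li.
Qed.

Lemma mus_star x : mus (star x) = star (mus x).
Proof.
apply: td_ext => i; rewrite tcoord_star !tcoord_mus.
by have [[_ si] _ _ _] := wqP i; rewrite si.
Qed.

Lemma wq_norm_le i n (x : 'M[D]_n) : mnorm (map_mx (wq i) x) <= mnorm (map_mx mus x).
Proof. by rewrite -map_tcoord_mus; case: td_norming => _ _ h _; exact: h. Qed.

Lemma mus_norm_lub n (x : 'M[D]_n) (c : R) : 0 <= c ->
  (forall i, mnorm (map_mx (wq i) x) <= c) -> mnorm (map_mx mus x) <= c.
Proof.
move=> c0 h; case: td_norming => _ _ _ lub; apply: (lub n (map_mx mus x) c c0) => i.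
by rewrite map_tcoord_mus; exact: h.
Qed.

Lemma mus_norm_le n (x : 'M[D]_n) : is_operator_space D ->
  mnorm (map_mx mus x) <= mnorm x.
Proof.
move=> oD; apply: mus_norm_lub; first exact: (os_norm_ge0 oD).
by move=> i; have [_ _ cc _] := wqP i; exact: cc.
Qed.

Lemma mus_coneP n (x : 'M[D]_n) :
  mcone (map_mx mus x) <-> forall i, mcone (map_mx (wq i) x).
Proof.
split=> [/td_coneP h i|h]; first by rewrite -map_tcoord_mus.
by apply/td_coneP => i; rewrite map_tcoord_mus.
Qed.

Lemma mus_pos n (x : 'M[D]_n) : mcone x -> mcone (map_mx mus x).
Proof. by move=> xc; apply/mus_coneP => i; have [_ cp _ _] := wqP i; exact: cp. Qed.

Lemma mus_CBp : is_operator_space D -> CBp mus.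
Proof.
move=> oD; split; last by exists 1 => n x; rewrite mul1r mus_norm_le.
split; first by split; [exact: mus_lin|exact: mus_star].
exact: mus_pos.
Qed.

Lemma matmo_coneZ n m (a : R) (x : 'M[matmo R m]_n) : 0 <= a ->
  mcone x -> mcone (map_mx ( *:%R a%:C) x).
Proof.
move=> a0 /matmo_coneP h; apply/matmo_coneP => v.
by rewrite formZ mulr_ge0 ?lecR.
Qed.

Lemma WQ_intro n (f : D -> matmo R n.+1) (M : R) : 0 < M -> star_linear f ->
  (forall k (x : 'M[D]_k), mcone x -> mcone (map_mx f x)) ->
  (forall k (x : 'M[D]_k), mnorm (map_mx f x) <= M * mnorm x) ->
  (forall k l, continuous ((fun x => f x k l) : wstar F -> C^o)) ->
  exists phi : WQ F n, forall x, sval phi x = (M^-1)%:C *: f x.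
Proof.
move=> M0 [lf sf] cf nf ctf.
pose g (x : D) : matmo R n.+1 := (M^-1)%:C *: f x.
have gE k (x : 'M[D]_k) : map_mx g x = map_mx ( *:%R (M^-1)%:C) (map_mx f x).
  by apply/matrixP => i j; rewrite !mxE.
have hg : CCp g /\ continuous (g : wstar F -> 'M[C^o]_n.+1).
  split; last first.
    apply/wstar_matrix_continuousP => i j.
    have -> : (fun x => g x i j) = (fun x => (M^-1)%:C * f x i j).
      by apply/funext => x; rewrite /g mxE.
    exact: wstar_continuousZ.
  split; last first.
    move=> k x; rewrite gE matmo_normZ Rnorm_real ?invr_ge0 ?(ltW M0)//.
    by rewrite ler_pdivrMl.
  split; last by move=> k x xc; rewrite gE; apply: matmo_coneZ; rewrite ?invr_ge0 ?(ltW M0)//; exact: cf.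
  split.
    move=> a x y; rewrite /g lf; apply/matrixP => i j; rewrite !mxE.
    by rewrite mulrDr mulrCA.
  move=> x; rewrite /g sf; apply/matrixP => i j; rewrite !mxE rmorphM; congr (_ * _).
  by rewrite [RHS]conjc_real.
by exists (exist _ g hg).
Qed.

Lemma wq_transfer n (f : D -> matmo R n.+1) (M : R) : 0 < M -> star_linear f ->
  (forall k (x : 'M[D]_k), mcone x -> mcone (map_mx f x)) ->
  (forall k (x : 'M[D]_k), mnorm (map_mx f x) <= M * mnorm x) ->
  (forall k l, continuous ((fun x => f x k l) : wstar F -> C^o)) ->
  forall k (x : 'M[D]_k), mnorm (map_mx f x) <= M * mnorm (map_mx mus x) /\
    (mcone (map_mx mus x) -> mcone (map_mx f x)).
Proof.
move=> M0 sf cf nf ctf k x; have [phi phiE] := WQ_intro M0 sf cf nf ctf.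
pose i : WQall F := Tagged _ phi.
have fE : map_mx f x = map_mx ( *:%R M%:C) (map_mx (wq i) x).
  apply/matrixP => p q; rewrite !mxE [wq i _]phiE scalerA -rmorphM /=.
  by rewrite mulfV ?lt0r_neq0// scale1r.
rewrite fE; split.
  rewrite matmo_normZ Rnorm_real ?(ltW M0)//.
  by apply: ler_wpM2l; [exact: ltW|exact: (wq_norm_le i x)].
by move=> /mus_coneP h; exact: (matmo_coneZ (ltW M0) (h i)).
Qed.

End MuTheory.

Section MuFunctorial.
Variables (R : realType) (D E : modata R) (F : set (dual D)) (G : set (dual E)).

(** A coordinate of [mus G] composed with psi is again weak*-continuous, completely positive and
    bounded by M, so [wq_transfer] applies to it. With M = 1 this gives the contractivity in (a),
    and one dual higher the one in (e). *)
Lemma mus_transfer (psi : D -> E) (M : R) : 0 < M -> completely_positive psi ->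
  (forall k (x : 'M[D]_k), mnorm (map_mx psi x) <= M * mnorm x) ->
  wcontinuous F G psi ->
  forall k (x : 'M[D]_k),
    mnorm (map_mx (mus G) (map_mx psi x)) <= M * mnorm (map_mx (mus F) x) /\
    (mcone (map_mx (mus F) x) -> mcone (map_mx (mus G) (map_mx psi x))).
Proof.
move=> M0 [[lp sp] cp] np ctp k x.
have h i : mnorm (map_mx (wq i) (map_mx psi x)) <= M * mnorm (map_mx (mus F) x) /\
    (mcone (map_mx (mus F) x) -> mcone (map_mx (wq (F := G) i) (map_mx psi x))).
  have [[li si] ci cci cti] := wqP i.
  rewrite -map_mx_comp; apply: wq_transfer => //.
  - split; first by move=> a u v /=; rewrite lp li.
    by move=> u /=; rewrite sp si.
  - by move=> p u uc; rewrite map_mx_comp; apply: ci; exact: cp.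
  - move=> p u; rewrite map_mx_comp; apply: le_trans (cci _ _) _; exact: np.
  - by move=> p q u; exact: (continuous_comp (ctp u) (cti p q (psi u))).
split; last by move=> xc; apply/mus_coneP => i; have [_] := h i; exact.
apply: mus_norm_lub; last by move=> i; have [] := h i.
by rewrite mulr_ge0 ?(ltW M0)// td_norm_ge0.
Qed.

End MuFunctorial.

Section Restriction.
Variables (R : realType) (X : modata R) (V : saspace X).

Lemma sub_nrm (x : submo V) : nrm x = nrm (val x).
Proof.
rewrite /nrm; have -> : const_mx (val x) = map_mx val (const_mx x : 'M[submo V]_1).
  by rewrite map_const_mx.
by [].
Qed.

Lemma restrict_dual (g : dual X) : exists h : dual (submo V),
  forall x, val h x = val g (val x).
Proof.
have b : bounded_functional (fun x : submo V => val g (val x)).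
  split; first by move=> a u v; rewrite subl_valD subl_valZ dual_lin.
  have [_ [M h]] := dualP g; exists M => x; rewrite sub_nrm; exact: h.
by exists (insubd 0 (fun x : submo V => val g (val x))) => x; rewrite (dual_val b).
Qed.

End Restriction.

Section VectorFunctionals.
Variables (R : realType) (H : hilbert R).
Local Notation C := R[i].
Local Notation "''[' u , v ]" := (ip H u v).

Lemma bop_apply_le (y : BH H) u : Rnorm (val y u) <= nrm y * Rnorm u.
Proof.
have := bop_amp_le (const_mx y : 'M[BH H]_1) (fun=> u).
have hE (w : 'I_1 -> H) : hnorm w = Rnorm (w 0).
  by rewrite /hnorm big_ord1 sqrtr_sqr ger0_norm ?Rnorm_ge0.
by rewrite !hE /bop_amp big_ord1 mxE.
Qed.

Lemma series_finite (t : nat -> C) : (forall k, (0 < k)%N -> t k = 0) ->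
  series (t : nat -> C^o) @ \oo --> (t 0%N : C^o).
Proof.
move=> t0; apply/cvgCP => e e0; exists 1%N => // n /= n1.
rewrite /series /= big_ltn// big_nat_cond big1 ?addr0 ?subrr ?Rnorm0//.
by move=> k /andP[/andP[k0 _] _]; exact: t0.
Qed.

Lemma vector_functional (u w : H) : exists2 g : dual (BH H),
  BH_predual H g & forall y, val g y = '[val y u, w].
Proof.
have b : bounded_functional (fun y : BH H => '[val y u, w] : C^o).
  split; first by move=> a x y; rewrite subl_valD subl_valZ ipDl ipZl.
  exists (Rnorm u * Rnorm w) => y; apply: le_trans (ip_cauchy_schwarz _ _) _.
  rewrite mulrC [X in _ <= X]mulrAC mulrC ler_wpM2r ?Rnorm_ge0// mulrC.
  exact: bop_apply_le.
exists (insubd 0 (fun y : BH H => '[val y u, w] : C^o)); last first.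
  by move=> y; rewrite (dual_val b).
pose xi (v : H) k := if k == 0%N then v else 0.
have cx (v : H) : cvgn (series (fun k => Rnorm (xi v k) ^+ 2)).
  apply/cvg_ex; exists (Rnorm v ^+ 2); apply/cvgrPdist_lt => e e0; exists 1%N => // n /= n1.
  rewrite /series /= big_ltn// big_nat_cond big1 ?addr0 ?subrr ?normr0//.
  move=> k /andP[/andP[k0 _] _]; rewrite /xi gtn_eqF// Rnorm0 expr0n//.
exists (xi u), (xi w); split; [exact: cx|exact: cx|move=> y].
rewrite (dual_val b); apply: (@series_finite (fun k => '[val y (xi u k), xi w k])).
by move=> k k0; rewrite /xi gtn_eqF// ip0r.
Qed.

(** A vector functional of B(H) is a vector functional of a compression, with vectors of the same
    norms. This turns square-summable sequences in H into sequences admissible for the predual of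
    N(D). *)
Lemma vector_form_compression (u w : H) : exists m (e : 'I_m.+1 -> H) (c d : 'cV[C]_m.+1),
  [/\ contractive_frame e, vnorm c = Rnorm u, vnorm d = Rnorm w &
      forall y : BH H, '[val y u, w] = (d^t* *m compression e y *m c) 0 0].
Proof.
have [m [e [p [q [he vE wE hp hq]]]]] := frame_exists (fun _ : 'I_1 => u) (fun=> w).
have hE (v : H) : hnorm (fun _ : 'I_1 => v) = Rnorm v.
  by rewrite /hnorm big_ord1 sqrtr_sqr ger0_norm ?Rnorm_ge0.
exists m, e, p^T, q^T; split=> //.
- by rewrite -hs_col hs_tr hp hE.
- by rewrite -hs_col hs_tr hq hE.
move=> y; rewrite -form_const !trmxK.
have -> : const_mx (compression e y) = map_mx (compression e) (const_mx y : 'M[BH H]_1).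
  by rewrite map_const_mx.
rewrite form_compression opformE !big_ord1 mxE.
by rewrite -(vE 0) -(wE 0).
Qed.

End VectorFunctionals.

(** * Weak* representations control the map mu *)

Section Representation.
Variables (R : realType) (D : modata R) (F : saspace (dual D)).
Variables (H : hilbert R) (V : saspace (BH H)) (rho : D -> submo V).
Local Notation C := R[i].
Local Notation "''[' u , v ]" := (ip H u v).
Hypothesis sD : is_smos D.
Hypothesis mrho : mos_iso rho.
Hypothesis wrho : whomeo (lset F) (Defs.restrict (BH_predual H) V) rho.

Let oD := smos_os sD.

Definition rep_op (x : D) : BH H := val (rho x).

Lemma rep_star_linear : star_linear rho.
Proof. by case: mrho => _ []. Qed.

(** This is the condition under which [star] on B(H) acts as the adjoint and commutes with
    compressions; the operators in the image of rho inherit it from the involution of D. *)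
Lemma rep_involutive x : star (star (val (rho x))) = val (rho x).
Proof.
have [_ sr] := rep_star_linear.
have e : star (star (rho x)) = rho x by rewrite -!sr; case: sD => _ [_ _ ->].
by rewrite -[val (rho x)]/(incl (rho x)) -!incl_star e.
Qed.

Lemma rep_vector_continuous u w :
  continuous ((fun x => '[val (rep_op x) u, w]) : wstar (lset F) -> C^o).
Proof.
have [g Bg gE] := vector_functional u w; have [h hE] := restrict_dual V g.
have [_ [_ _ /wcontinuousP c _]] := wrho.
have -> : (fun x => '[val (rep_op x) u, w]) = (fun x => val h (rho x)).
  by apply/funext => x; rewrite hE gE.
by apply: c; exists g.
Qed.

Definition rep_compression m (e : 'I_m -> H) (x : D) : matmo R m :=
  compression e (val (rho x)).

Lemma map_rep_compression m (e : 'I_m -> H) n (x : 'M[D]_n) :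
  map_mx (rep_compression e) x = map_mx (compression e) (map_mx val (map_mx rho x)).
Proof. by rewrite -!map_mx_comp. Qed.

Lemma rep_compression_star_linear m (e : 'I_m -> H) : star_linear (rep_compression e).
Proof.
have [lr sr] := rep_star_linear; split.
  by move=> a x y; rewrite /rep_compression lr subl_valD subl_valZ compression_lin.
by move=> x; rewrite /rep_compression sr; exact/compression_star/rep_involutive.
Qed.

Lemma rep_bound : exists2 M : R, 0 < M & forall n (x : 'M[D]_n),
  mnorm (map_mx rho x) <= M * mnorm x.
Proof.
by case: mrho => _ _ [cb _]; exact: (cb_bound oD cb).
Qed.

Lemma rep_cone n (x : 'M[D]_n) : mstar x = x -> (mcone x <-> mcone (map_mx rho x)).
Proof. by case: mrho => _ [_ _ h] _; exact: h. Qed.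

Lemma rep_compression_pos m (e : 'I_m.+1 -> H) n (x : 'M[D]_n) :
  contractive_frame e -> mcone x -> mcone (map_mx (rep_compression e) x).
Proof.
move=> he xc; have xs : mstar x = x by case: sD => _ _ _ [h _ _ _]; exact: h.
rewrite map_rep_compression; have /(rep_cone xs) := xc.
by move=> /(iffLR (compression_coneP _)); exact.
Qed.

Lemma rep_compression_continuous m (e : 'I_m -> H) a b :
  continuous ((fun x => rep_compression e x a b) : wstar (lset F) -> C^o).
Proof.
have -> : (fun x => rep_compression e x a b) = (fun x => '[val (rep_op x) (e b), e a]).
  by apply/funext => x; rewrite /rep_compression mxE.
exact: rep_vector_continuous.
Qed.

Lemma rep_WQ (M : R) m (e : 'I_m.+1 -> H) : 0 < M ->
  (forall n (x : 'M[D]_n), mnorm (map_mx rho x) <= M * mnorm x) ->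
  contractive_frame e ->
  exists phi : WQ (lset F) m, forall x, sval phi x = (M^-1)%:C *: rep_compression e x.
Proof.
move=> M0 hM he; apply: WQ_intro => //.
- exact: rep_compression_star_linear.
- by move=> k x; exact: rep_compression_pos.
- move=> k x; rewrite map_rep_compression.
  by apply: le_trans (compression_norm_le _ he) _; exact: hM.
- by move=> k l; exact: rep_compression_continuous.
Qed.

Lemma rep_transfer (M : R) m (e : 'I_m.+1 -> H) : 0 < M ->
  (forall n (x : 'M[D]_n), mnorm (map_mx rho x) <= M * mnorm x) ->
  contractive_frame e -> forall k (x : 'M[D]_k),
  mnorm (map_mx (rep_compression e) x) <= M * mnorm (map_mx (mus (lset F)) x) /\
    (mcone (map_mx (mus (lset F)) x) -> mcone (map_mx (rep_compression e) x)).
Proof.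
move=> M0 hM he; apply: wq_transfer => //.
- exact: rep_compression_star_linear.
- by move=> k x; exact: rep_compression_pos.
- move=> k x; rewrite map_rep_compression.
  by apply: le_trans (compression_norm_le _ he) _; exact: hM.
- by move=> k l; exact: rep_compression_continuous.
Qed.

(** With c the lower and M the upper bound of rho, the norm of x is at most 1/c times that of its
    image, which is a supremum of compressions, each bounded by M times the norm in the range of
    [mus]. *)
Lemma mus_bounded_below : exists2 c : R, 0 < c & forall n (x : 'M[D]_n),
  mnorm x <= c * mnorm (map_mx (mus (lset F)) x).
Proof.
have [M M0 hM] := rep_bound; case: (mrho) => _ _ [_ [c c0 hc]].
exists (c^-1 * M); first by rewrite mulr_gt0 ?invr_gt0.
move=> n x; rewrite -mulrA -ler_pdivrMl ?invr_gt0// invrK.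
apply: le_trans (hc _ _) _; apply: compression_norm_lub.
  by rewrite mulr_ge0 ?(ltW M0)// td_norm_ge0.
move=> m e he; rewrite -map_rep_compression.
by have [] := rep_transfer M0 hM he x.
Qed.

Lemma mus_inj : injective (mus (lset F)).
Proof.
have [c c0 h] := mus_bounded_below => x y exy.
apply/eqP; rewrite -subr_eq0; apply/eqP; apply: (nrm_eq0 oD).
apply: le_anti; rewrite nrm_ge0// andbT; apply: le_trans (h _ _) _.
rewrite map_const_mx (linB (@mus_lin _ _ _)) exy subrr.
have -> : const_mx 0 = 0 :> 'M[submo (mu_range (lset F))]_1.
  by apply/matrixP => i j; rewrite !mxE.
by rewrite (os_norm0 (td_operator_space _)) mulr0.
Qed.

Lemma mus_reflects_cone n (x : 'M[D]_n) : mcone (map_mx (mus (lset F)) x) -> mcone x.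
Proof.
(* rho reflects positivity on self-adjoint matrices only, so self-adjointness of x is first
   recovered from that of its image by injectivity. *)
move=> xc; have xs : mstar x = x.
  have := td_cone_sa xc; rewrite -map_mstar; last exact: mus_star.
  by move=> /matrixP e; apply/matrixP => i j; have := e i j; rewrite !mxE => /mus_inj.
have [M M0 hM] := rep_bound.
apply/(rep_cone xs); apply: (iffRL (compression_coneP _)) => m e he.
by rewrite -map_rep_compression; have [_] := rep_transfer M0 hM he x; exact.
Qed.

End Representation.

(** * Series of vector functionals on N(D) *)

Section VectorSeries.
Variable R : realType.
Local Notation C := R[i].

Lemma series_dominatedZ (t : nat -> C) (b : nat -> R) (c : R) : 0 <= c ->
  (forall k, Rnorm (t k) <= c * b k) -> cvgn (series b) ->
  exists l : C, series (t : nat -> C^o) @ \oo --> (l : C^o) /\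
    forall n, Rnorm (l - series t n) <= c * (limn (series b) - series b n).
Proof.
move=> c0 tb cb; have cb' : cvgn (series (c *: (b : nat -> R^o))) by exact: is_cvg_seriesZ.
have [l [cl hl]] := series_dominated (a := c *: (b : nat -> R^o)) tb cb'.
exists l; split=> // n; apply: le_trans (hl n) _.
by rewrite (lim_seriesZ c cb) seriesZ mulrBr.
Qed.

Variables (I : Type) (d : I -> nat).
Local Notation N := (Defs.msum R d).
Variables (i : nat -> I) (xi eta : forall k, 'cV[C]_(d (i k))).

(** A summable majorant of the products |xi_k| |eta_k|, by the inequality of arithmetic and
    geometric means. *)
Definition half_squares k : R := (vnorm (xi k) ^+ 2 + vnorm (eta k) ^+ 2) / 2.

(** The argument is a bare family rather than an element of [msum], so that it can also be the
    family of values [wq j x]. *)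
Definition vector_term (y : forall j, matmo R (d j)) k : C :=
  ((eta k)^t* *m (y (i k) : 'M[C]_(d (i k))) *m xi k) 0 0.

Lemma vector_term_le y (c : R) k : nrm (y (i k)) <= c ->
  Rnorm (vector_term y k) <= c * half_squares k.
Proof.
move=> yc; apply: le_trans (matmo_vector_form_le _ _ _) _.
apply: (@le_trans _ _ (c * (vnorm (xi k) * vnorm (eta k)))).
  by rewrite -mulrA ler_wpM2r// mulr_ge0 ?vnorm_ge0.
rewrite ler_wpM2l//; first by apply: le_trans yc; exact: matmo_norm_ge0.
rewrite /half_squares; move: (vnorm (xi k)) (vnorm (eta k)) => p q.
by have := sqr_ge0 (p - q); nra.
Qed.

Hypotheses (cxi : cvgn (series (fun k => vnorm (xi k) ^+ 2)))
  (ceta : cvgn (series (fun k => vnorm (eta k) ^+ 2))).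

Lemma half_squares_cvg : cvgn (series half_squares).
Proof.
have -> : half_squares = 2^-1 *: ((fun k => vnorm (xi k) ^+ 2 : R^o) +
                                  (fun k => vnorm (eta k) ^+ 2 : R^o)).
  by apply/funext => k; rewrite /half_squares mulrC.
by apply: is_cvg_seriesZ; apply: is_cvg_seriesD.
Qed.

Lemma vector_series_functional : exists f : dual N, msum_predual f /\
  forall y : N, series (vector_term (val y) : nat -> C^o) @ \oo --> val f y.
Proof.
have nle (y : N) j : nrm (val y j) <= nrm y.
  have := mcoord_norm_le j (const_mx y : 'M[N]_1).
  by rewrite map_const_mx.
have n0 (y : N) : 0 <= nrm y by exact: msum_norm_ge0.
have h (y : N) := series_dominatedZ (n0 y)
  (fun k => vector_term_le (nle y (i k))) half_squares_cvg.
pose L (y : N) : C^o := sval (cid (h y)).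
have cL (y : N) : series (vector_term (val y) : nat -> C^o) @ \oo --> L y.
  by rewrite /L; case: cid => l [].
have bL (y : N) : Rnorm (L y) <= limn (series half_squares) * nrm y.
  (* The remainder at n = 0 is L y itself, which bounds L by the sum of the majorant. *)
  rewrite /L; case: cid => l [_ /(_ 0%N)] /=.
  by rewrite /series /= !big_geq// !subr0 mulrC.
have b : bounded_functional L.
  split; last by exists (limn (series half_squares)).
  move=> a y z; have e k : vector_term (val (a *: y + z)) k =
      a * vector_term (val y) k + vector_term (val z) k.
    rewrite /vector_term subl_valD subl_valZ.
    by rewrite -[X in _ *m X *m _]/(a *: (val y (i k) : 'M[C]_(d (i k))) + val z (i k))
      mulmxDr mulmxDl -scalemxAr -scalemxAl !mxE.
  (* Linearity follows from uniqueness of limits: both sides are limits of the same series. *)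
  have c1 := cL (a *: y + z).
  have c2 : series (vector_term (val (a *: y + z)) : nat -> C^o) @ \oo --> (a *: L y + L z : C^o).
    have -> : (vector_term (val (a *: y + z)) : nat -> C^o) =
      a *: (vector_term (val y) : nat -> C^o) + (vector_term (val z) : nat -> C^o).
      by apply/funext => k; rewrite e.
    rewrite seriesD seriesZ; apply: cvgD (cL z).
    apply/cvgCP => eps eps0; have a0 : 0 < Rnorm a + 1 by rewrite ltr_wpDl ?Rnorm_ge0.
    have := cL y => /(cvgCP _ _) /(_ _ (divr_gt0 eps0 a0)); apply: filterS => k.
    rewrite -[X in _ -> Rnorm X < _]/(a * series (vector_term (val y)) k - a * L y).
    rewrite -mulrBr RnormM ltr_pdivlMr// mulrC => /(le_lt_trans _); apply.
    by rewrite ler_wpM2r ?Rnorm_ge0// lerDl.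
  exact: (cvg_unique _ c1 c2).
pose f : dual N := insubd 0 L; have fE : val f = L by exact: (dual_val b).
have cf (y : N) : series (vector_term (val y) : nat -> C^o) @ \oo --> val f y.
  by rewrite fE; exact: cL.
exists f; split; last exact: cf.
exists i, xi, eta; split; [exact: cxi|exact: ceta|exact: cf].
Qed.

End VectorSeries.

(** * Weak* continuity of mu and of its inverse *)

Section MuContinuous.
Variables (R : realType) (D : modata R) (F : saspace (dual D)).
Local Notation C := R[i].
Local Notation TD := (submo (mu_range (lset F))).
Hypothesis oD : is_operator_space D.

Definition tdual_predual : set (dual TD) :=
  Defs.restrict (ND_predual (lset F)) (mu_range (lset F)).

Lemma wstar_continuous_sum I (r : seq I) (P : pred I) (f : I -> D -> C^o) :
  (forall j, continuous (f j : wstar (lset F) -> C^o)) ->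
  continuous ((fun x => \sum_(j <- r | P j) f j x) : wstar (lset F) -> C^o).
Proof.
move=> cf; elim: r => [|j r IH].
  have -> : (fun x => \sum_(j <- [::] | P j) f j x) = (fun=> 0) :> (D -> C^o).
    by apply/funext => x; rewrite big_nil.
  exact: cst_continuous.
have -> : (fun x => \sum_(k <- j :: r | P k) f k x) =
    (fun x => (if P j then f j x else 0) + \sum_(k <- r | P k) f k x) :> (D -> C^o).
  by apply/funext => x; rewrite big_cons; case: (P j); rewrite ?add0r.
apply: (@wstar_continuousD _ _ _ _ _ _ IH); case: (P j); first exact: cf.
exact: cst_continuous.
Qed.

(** A functional of the predual of N(D), pulled back to D, is a series whose terms are matrix
    coefficients of weak*-continuous maps and so lie in F. The remainder at x is at most the norm of
    x times a scalar remainder, so the partial sums converge in norm and the limit lies in the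
    norm-closed F. *)
Lemma mus_wcontinuous : norm_closed (lset F) -> wcontinuous (lset F) tdual_predual (mus (lset F)).
Proof.
move=> ncF; apply/wcontinuousP => g [f [i [xi [eta [cxi ceta lim]]]] gE].
pose q : dual D := dual_map (mus (lset F)) g.
have [_ mcb] := @mus_CBp R D (lset F) oD.
have qE x : val q x = val g (mus (lset F) x).
  by apply: dual_mapE => //; [exact: td_operator_space|exact: mus_lin].
pose b := half_squares xi eta.
have cb : cvgn (series b) by exact: half_squares_cvg.
pose t (x : D) := vector_term xi eta (fun j => wq j x).
have tE (x : D) : t x = vector_term xi eta (val (mu (lset F) x)) by [].
have wle (x : D) (j : WQall (lset F)) : nrm (wq j x) <= nrm x.
  have [_ _ cc _] := wqP j; have := cc _ (const_mx x : 'M[D]_1).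
  by rewrite map_const_mx.
have tail x n : Rnorm (val q x - series (t x) n) <= nrm x * (limn (series b) - series b n).
  have [l [cl hl]] := series_dominatedZ (nrm_ge0 oD x)
    (fun k => @vector_term_le R (WQall (lset F)) (fun j => (tag j).+1) i xi eta
      (fun j => wq j x) (nrm x) k (wle x (i k))) cb.
  have -> : val q x = l; last exact: hl.
  rewrite qE gE; exact: (cvg_unique _ (lim (mu (lset F) x)) cl).
have pk k : exists2 p, lset F p & forall x, val p x = t x k.
  have [p Fp pE] : exists2 p, lset F p & (fun x => t x k) = val p.
    apply: wstar_continuous_mem.
      move=> a x y; have [[lw _] _ _ _] := wqP (i k).
      by rewrite /t /vector_term lw mulmxDr mulmxDl -scalemxAr -scalemxAl !mxE.
    have -> : (fun x => t x k) = (fun x => \sum_c \sum_r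
        (conjc (eta k r 0) * xi k c 0) * wq (i k) x r c) :> (D -> C^o).
      apply/funext => x; rewrite /t /vector_term mxE; apply: eq_bigr => c _.
      rewrite mxE mulr_suml; apply: eq_bigr => r _; rewrite !mxE.
      by rewrite mulrAC.
    apply: wstar_continuous_sum => c; apply: wstar_continuous_sum => r.
    apply: wstar_continuousZ; have [_ _ _ cw] := wqP (i k); exact: cw.
  by exists p => // x; rewrite -pE.
have pn n : exists2 p, lset F p & forall x, val p x = series (t x) n.
  elim: n => [|n [p Fp pE]].
    exists 0; first exact: lset0.
    by move=> x; rewrite dual_val0 /series /= big_geq.
  have [r Fr rE] := pk n; exists (1 *: r + p); first exact: lsetZD.
  by move=> x; rewrite dual_valD dual_valZ mul1r rE pE addrC [RHS]seriesSr.
have Fq : lset F q.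
  apply: ncF => e e0.
  have e2 : 0 < e / 2 by rewrite divr_gt0.
  have /cvgrPdist_lt /(_ _ e2) [n _ /(_ n (leqnn n)) hn] := cb.
  have [p Fp pE] := pn n; exists p => //.
  apply: (@le_lt_trans _ _ (e / 2)); last by rewrite ltr_pdivrMr// ltr_pMr// ltrDl.
  apply: (dual_nrm_le oD); first exact: ltW.
  move=> x; rewrite dual_valB pE; apply: le_trans (tail x n) _.
  rewrite mulrC ler_wpM2r ?(nrm_ge0 oD)// ltW//; apply: le_lt_trans hn.
  exact: ler_norm.
have cq := wstar_eval_continuous Fq.
have e : val q = (fun x => val g (mus (lset F) x)) by apply/funext; exact: qE.
by rewrite e in cq; exact: cq.
Qed.

End MuContinuous.

Arguments tdual_predual {R D} F _.

Section LinearInverse.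
Variables (R : realType) (U W : lmodType R[i]) (f : U -> W) (g : W -> U).

Lemma lin_inverse : linear f -> cancel f g -> cancel g f -> linear g.
Proof. by move=> lf fK gK a x y; rewrite -{1}(gK x) -{1}(gK y) -lf fK. Qed.
End LinearInverse.

Section MuInverse.
Variables (R : realType) (D : modata R) (F : saspace (dual D)).
Variables (H : hilbert R) (V : saspace (BH H)) (rho : D -> submo V).
Local Notation C := R[i].
Local Notation "''[' u , v ]" := (ip H u v).
Local Notation TD := (submo (mu_range (lset F))).
Hypothesis sD : is_smos D.
Hypothesis mrho : mos_iso rho.
Hypothesis wrho : whomeo (lset F) (Defs.restrict (BH_predual H) V) rho.

Let oD := smos_os sD.

(** An index and two vectors of the size it prescribes. Bundling them lets [choice] select the index
    and the dependently typed vectors at once. *)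
Record wq_vectors := WQVectors {
  wqv_index : WQall (lset F);
  wqv_right : 'cV[C]_((tag wqv_index).+1);
  wqv_left : 'cV[C]_((tag wqv_index).+1) }.

Definition wqv_form (p : wq_vectors) (x : D) : C :=
  ((wqv_left p)^t* *m (wq (wqv_index p) x : 'M[C]_((tag (wqv_index p)).+1)) *m wqv_right p) 0 0.

Lemma rep_vector_wq (M : R) : 0 < M ->
  (forall n (x : 'M[D]_n), mnorm (map_mx rho x) <= M * mnorm x) ->
  forall u w, exists p : wq_vectors,
  [/\ vnorm (wqv_right p) = Rnorm u, vnorm (wqv_left p) = Rnorm w &
      forall x, '[val (rep_op rho x) u, w] = M%:C * wqv_form p x].
Proof.
move=> M0 hM u w; have [m [e [c [d [he hc hd hcd]]]]] := vector_form_compression u w.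
have [phi phiE] := rep_WQ sD mrho wrho M0 hM he.
exists (@WQVectors (Tagged _ phi) c d); split; [exact: hc|exact: hd|move=> x].
rewrite hcd /wqv_form /= [wq _ x]phiE -[compression e _]/(rep_compression rho e x).
move: (rep_compression rho e x) => A.
have E : (d^t* *m ((M^-1)%:C *: (A : 'M[C]_m.+1)) *m c) 0 0 =
    (M^-1)%:C * (d^t* *m (A : 'M[C]_m.+1) *m c) 0 0.
  by rewrite -scalemxAr -scalemxAl mxE.
apply: (etrans _ (congr1 (fun z => M%:C * z) (esym E))).
by rewrite mulrA -rmorphM /= mulfV ?lt0r_neq0// mul1r.
Qed.

(** Each term of a normal functional on B(H), pulled back by rho, is M times a vector functional of
    a coordinate of [mu]. The factor M goes into the left vectors, which stay square-summable, so
    the whole series lives in the predual of N(D). *)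
Lemma BH_predual_wq (h : dual (submo V)) : Defs.restrict (BH_predual H) V h ->
  exists2 g : dual TD, tdual_predual F g & forall x, val g (mus (lset F) x) = val h (rho x).
Proof.
move=> [f [xi [eta [cxi ceta lim]]] hE].
have [M M0 hM] := rep_bound sD mrho.
have [p P] := choice (fun k => rep_vector_wq M0 hM (xi k) (eta k)).
pose i k := wqv_index (p k).
pose c k : 'cV[C]_((tag (i k)).+1) := wqv_right (p k).
pose d' k : 'cV[C]_((tag (i k)).+1) := M%:C *: wqv_left (p k).
have cc : cvgn (series (fun k => vnorm (c k) ^+ 2)).
  have -> // : (fun k => vnorm (c k) ^+ 2) = (fun k => Rnorm (xi k) ^+ 2).
  by apply/funext => k; have [-> _ _] := P k.
have cd : cvgn (series (fun k => vnorm (d' k) ^+ 2)).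
  have -> : (fun k => vnorm (d' k) ^+ 2) = (M ^+ 2) *: (fun k => Rnorm (eta k) ^+ 2 : R^o).
    apply/funext => k; have [_ e _] := P k.
    by rewrite /d' vnormZ Rnorm_real ?(ltW M0)// e exprMn.
  exact: is_cvg_seriesZ.
have [G [Gp GE]] := @vector_series_functional R (WQall (lset F))
  (fun j => (tag j).+1) i c d' cc cd.
have [g gE] := restrict_dual (mu_range (lset F)) G.
exists g; first by exists G.
move=> x; rewrite gE hE.
have lim1 := GE (mu (lset F) x); have lim2 := lim (rep_op rho x).
apply: (cvg_unique _ lim1); first exact: norm_hausdorff.
have e : (fun k => '[val (rep_op rho x) (xi k), eta k] : C^o) =
    @vector_term R (WQall (lset F)) (fun j => (tag j).+1) i c d' (val (mu (lset F) x))
      :> (nat -> C^o).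
  apply/funext => k; have [_ _ ->] := P k.
  rewrite /vector_term /d' linearZ /= map_mxZ /= -!scalemxAl mxE.
  by congr (_ * _); rewrite [RHS]conjc_real.
by rewrite e in lim2; exact: lim2.
Qed.

(** A functional in F, transported to V by the inverse of rho, is weak*-continuous and so a finite
    combination of restricted normal functionals; [BH_predual_wq] makes each of these continuous on
    the range of [mu]. *)
Lemma mus_inverse_wcontinuous (inv : TD -> D) : cancel inv (mus (lset F)) ->
  wcontinuous (tdual_predual F) (lset F) inv.
Proof.
move=> invK; apply/wcontinuousP => f Ff.
have [sigma [rK sK _ /wcontinuousP csigma]] := wrho.
have lsigma : linear sigma by apply: lin_inverse rK sK; case: (rep_star_linear mrho).
pose P (h : submo V -> C^o) :=
  continuous ((fun u : TD => h (rho (inv u))) : wstar (tdual_predual F) -> C^o).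
suff : P (fun v => val f (sigma v)).
  rewrite /P; have -> // : (fun u : TD => val f (sigma (rho (inv u)))) = (fun u => val f (inv u)).
  by apply/funext => u; rewrite rK.
apply: (wstar_continuous_ind (F := Defs.restrict (BH_predual H) V)).
- exact: cst_continuous.
- move=> a h k hp Pk; rewrite /P.
  apply: wstar_continuousD; last exact: Pk.
  apply: wstar_continuousZ; have [g gp gE] := BH_predual_wq hp.
  have -> : (fun u => val h (rho (inv u))) = val g.
    by apply/funext => u; rewrite -gE invK.
  exact: wstar_eval_continuous.
- by move=> a u v; rewrite lsigma dual_lin.
- exact: csigma.
Qed.

End MuInverse.

(** * MOS isomorphisms and their inverses *)

Section MosIsomorphisms.
Variables (R : realType).

Lemma mos_iso_intro (X Y : modata R) (phi : X -> Y) (psi : Y -> X) :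
  is_operator_space Y ->
  cancel phi psi -> cancel psi phi -> CBp phi -> CBp psi -> mos_iso phi.
Proof.
move=> oY fK gK [[slf pf] bf] [[slg pg] bg].
have mK n (x : 'M[X]_n) : map_mx psi (map_mx phi x) = x.
  by apply/matrixP => i j; rewrite !mxE fK.
split; first by exists psi.
  split; [exact: slf|exact: can_inj fK|].
  by move=> n x _; split=> [/pf//|/pg]; rewrite mK.
split; first exact: bf.
have [M M0 hM] := cb_bound oY bg; exists M^-1; first by rewrite invr_gt0.
by move=> n x; rewrite ler_pdivrMl//; have := hM n (map_mx phi x); rewrite mK.
Qed.

Lemma mos_iso_CBp (X Y : modata R) (phi : X -> Y) :
  (forall n (x : 'M[X]_n), mcone x -> mstar x = x) -> mos_iso phi -> CBp phi.
Proof.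
move=> sa [_ [sl _ pos] [bf _]]; split=> //; split=> // n x xc.
by apply/pos => //; exact: sa.
Qed.

(** An order monomorphism reflects positivity of self-adjoint matrices only; hence the assumption
    that positive matrices over Y are self-adjoint, a property that passes to their preimages. *)
Lemma mos_iso_inverse (X Y : modata R) (phi : X -> Y) :
  (forall n (y : 'M[Y]_n), mcone y -> mstar y = y) -> mos_iso phi ->
  exists psi : Y -> X, [/\ cancel phi psi, cancel psi phi & CBp psi].
Proof.
move=> sa [[psi fK gK] [[lf sf] injf pos] [_ [c c0 hc]]].
have mK n (y : 'M[Y]_n) : map_mx phi (map_mx psi y) = y.
  by apply/matrixP => i j; rewrite !mxE gK.
have spsi y : psi (star y) = star (psi y) by rewrite -{1}(gK y) -sf fK.
exists psi; split=> //; split; last first.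
  by exists c^-1 => n y; have := hc n (map_mx psi y); rewrite mK ler_pdivlMl.
split; first by split=> //; exact: lin_inverse lf fK gK.
move=> n y yc; apply/pos; last by rewrite mK.
by rewrite -map_mstar// sa.
Qed.

Lemma whomeo_inverse (X Y : modata R) (F : set (dual X)) (G : set (dual Y))
    (phi : X -> Y) (psi : Y -> X) :
  cancel phi psi -> cancel psi phi -> wcontinuous F G phi -> wcontinuous G F psi ->
  whomeo F G phi.
Proof. by move=> *; exists psi. Qed.

Lemma mos_iso_comp (X Y Z : modata R) (phi : X -> Y) (psi : Y -> Z) :
  is_smos X -> mos_iso phi -> mos_iso psi -> mos_iso (psi \o phi).
Proof.
move=> sX [bf [[lf sf] jf pf] [[M hM] [c c0 hc]]] [bg [[lg sg] jg pg] [[N hN] [d d0 hd]]].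
have oX := smos_os sX.
have mE n (x : 'M[X]_n) : map_mx (psi \o phi) x = map_mx psi (map_mx phi x).
  exact: map_mx_comp.
split; first exact: bij_comp.
  split; first split.
  - by move=> a x y /=; rewrite lf lg.
  - by move=> x /=; rewrite sf sg.
  - exact: inj_comp.
  - move=> n x xs; rewrite mE; apply: (iff_trans (pf n x xs)); apply: pg.
    by rewrite -map_mstar// xs.
split.
  exists (`|N| * M) => n x; rewrite mE; apply: le_trans (hN _ _) _.
  (* Y is an arbitrary [modata] here; nonnegativity of its norm on the range of phi comes from the
     lower bound of phi. *)
  have p0 : 0 <= mnorm (map_mx phi x).
    by apply: le_trans (hc n x); rewrite mulr_ge0 ?(ltW c0) ?os_norm_ge0.
  apply: (@le_trans _ _ (`|N| * mnorm (map_mx phi x))).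
    by rewrite ler_wpM2r// ler_norm.
  by rewrite -mulrA ler_wpM2l.
exists (d * c); first exact: mulr_gt0.
move=> n x; rewrite mE; apply: le_trans (hd _ _).
by rewrite -mulrA ler_pM2l.
Qed.

End MosIsomorphisms.

(** * Hahn-Banach *)

Section HahnBanach.
Variables (R : realType) (X : lmodType R[i]) (p : X -> R).
Local Notation C := R[i].
Hypothesis pD : forall x y, p (x + y) <= p x + p y.
Hypothesis pZ : forall a x, p (a *: x) = Rnorm a * p x.

Lemma seminorm0 : p 0 = 0.
Proof. by rewrite -(scale0r (0 : X)) pZ Rnorm0 mul0r. Qed.

Lemma seminorm_ge0 x : 0 <= p x.
Proof.
have := pD x (- x); rewrite subrr seminorm0 -scaleN1r pZ RnormN.
by rewrite -[X in Rnorm X]/((1 : R)%:C) Rnorm_real// mul1r; lra.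
Qed.

(* graph of a real-linear functional below p on a real subspace; domination
   makes it single-valued *)
Definition dominated_graph (G : set (X * R)) : Prop :=
  (forall (a : R) x r y s, G (x, r) -> G (y, s) -> G (a%:C *: x + y, a * r + s)) /\
  forall x r, G (x, r) -> r <= p x.

(** The one-dimensional extension step. Subadditivity puts every r - p (x - y) below every p (x' +
    y) - r', and c is the supremum of the former; the signs of t use one side each. *)
Lemma dominated_graph_extend (G : set (X * R)) y : dominated_graph G -> G (0, 0) ->
  exists c : R, dominated_graph [set z | exists x r t, G (x, r) /\
    z = (t%:C *: y + x, t * c + r)].
Proof.
move=> [Glin Gp] G0.
pose S : set R := [set s | exists x r, G (x, r) /\ s = r - p (x - y)].
have Sub x r x' r' : G (x, r) -> G (x', r') -> r - p (x - y) <= p (x' + y) - r'.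
  move=> g g'; have := Gp _ _ (Glin 1 _ _ _ _ g g').
  rewrite scale1r mul1r => h.
  have := pD (x - y) (x' + y); rewrite addrACA addNr addr0; lra.
have Ss : has_sup S.
  split; first by exists (0 - p (0 - y)), 0, 0.
  exists (p (0 + y) - 0) => _ [x [r [g ->]]]; exact: Sub.
pose c := sup S.
have c_ge x r : G (x, r) -> r - p (x - y) <= c.
  by move=> g; apply: ub_le_sup; [case: Ss|exists x, r].
have c_le x r : G (x, r) -> c <= p (x + y) - r.
  move=> g; apply: ge_sup; first by case: Ss.
  by move=> _ [x' [r' [g' ->]]]; exact: Sub.
have Gscale (a : R) x r : G (x, r) -> G (a%:C *: x, a * r).
  by move=> g; have := Glin a _ _ _ _ g G0; rewrite !addr0.
exists c; split.
  move=> a _ _ _ _ [x [r [t [g [-> ->]]]]] [x' [r' [t' [g' [-> ->]]]]].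
  exists (a%:C *: x + x'), (a * r + r'), (a * t + t'); split; first exact: Glin.
  congr (_, _); last by ring.
  rewrite rmorphD rmorphM scalerDr scalerA scalerDl -!addrA; congr (_ + _).
  by rewrite addrCA.
move=> _ _ [x [r [t [g [-> ->]]]]].
have [t0|t0|->] := ltgtP t 0; last by rewrite scale0r mul0r !add0r; exact: Gp.
- have nt0 : 0 < - t by rewrite oppr_gt0.
  have := c_ge _ _ (Gscale (- t)^-1 _ _ g).
  have -> : t%:C *: y + x = (- t)%:C *: (((- t)^-1)%:C *: x - y).
    rewrite scalerBr scalerA -rmorphM mulfV ?lt0r_neq0// scale1r.
    by rewrite rmorphN scaleNr opprK addrC.
  rewrite pZ Rnorm_real ?(ltW nt0)//.
  move: (p _) => q h; have := ler_wpM2l (ltW nt0) h.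
  by rewrite mulrBr mulrA mulfV ?lt0r_neq0// mul1r; lra.
- have := c_le _ _ (Gscale t^-1 _ _ g).
  have -> : t%:C *: y + x = t%:C *: ((t^-1)%:C *: x + y).
    by rewrite scalerDr scalerA -rmorphM mulfV ?lt0r_neq0// scale1r addrC.
  rewrite pZ Rnorm_real ?(ltW t0)//.
  move: (p _) => q h; have := ler_wpM2l (ltW t0) h.
  by rewrite mulrBr mulrA mulfV ?lt0r_neq0// mul1r; lra.
Qed.

Lemma hahn_banach_real x0 : exists f : X -> R,
  [/\ forall (a : R) x y, f (a%:C *: x + y) = a * f x + f y,
      forall x, f x <= p x & f x0 = p x0].
Proof.
pose G0 : set (X * R) := [set z | exists t : R, z = (t%:C *: x0, t * p x0)].
(* The line through x0 is added to G rather than required to lie in it, so that the empty union,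
   which the chains in Zorn's lemma include, also satisfies P. *)
pose P (G : set (X * R)) := dominated_graph (G `|` G0).
have G0dom : dominated_graph G0.
  split.
    move=> a _ _ _ _ [t [-> ->]] [t' [-> ->]]; exists (a * t + t').
    by rewrite scalerA -rmorphM -scalerDl -rmorphD mulrDl mulrA.
  move=> _ _ [t [-> ->]]; rewrite pZ ler_wpM2r ?seminorm_ge0//.
  by apply: le_trans (Re_le_Rnorm _); rewrite /= ler_norm.
have [|G [PG maxG]] := @Zorn_bigcup (X * R)%type P.
  move=> F FP Ftot.
  have [FE|/set0P [G1 FG1]] := eqVneq F set0.
    by rewrite /P FE bigcup_set0 set0U.
  have up z z' : ((\bigcup_(Y in F) Y) `|` G0) z -> ((\bigcup_(Y in F) Y) `|` G0) z' ->
      exists2 Y, F Y & (Y `|` G0) z /\ (Y `|` G0) z'.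
    move=> [[Y FY Yz]|z0] [[Y' FY' Yz']|z0'].
    - have [YY|YY] := Ftot _ _ FY FY'.
        by exists Y' => //; split; left => //; exact: YY.
      by exists Y => //; split; left => //; exact: YY.
    - by exists Y => //; split; [left|right].
    - by exists Y' => //; split; [right|left].
    - by exists G1 => //; split; right.
  split.
    move=> a x r y s h1 h2; have [Y FY [Y1 Y2]] := up _ _ h1 h2.
    have [Ylin _] := FP _ FY; have [Y3|Y3] := Ylin a _ _ _ _ Y1 Y2; last by right.
    by left; exists Y.
  move=> x r h; have [Y FY [Y1 _]] := up _ _ h h.
  by have [_ Yp] := FP _ FY; exact: Yp.
pose K := G `|` G0.
have Kdom : dominated_graph K := PG.
have [Klin Kp] := Kdom.
have K0 : K (0, 0) by right; exists 0; rewrite scale0r mul0r.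
have Ktotal y : exists r, K (y, r).
  have [c Ec] := dominated_graph_extend y Kdom K0.
  set E := (X in dominated_graph X) in Ec.
  have KE : K `<=` E.
    by move=> [x r] h; exists x, r, 0; rewrite scale0r mul0r !add0r.
  have EG : E `|` G0 = E.
    by rewrite setUidl// => z hz; apply: KE; right.
  exists c; apply: contrapT => nK; apply: (maxG E).
    split; first by move=> z Gz; apply: KE; left.
    move=> EsubG; apply: nK; left; apply: EsubG.
    by exists 0, 0, 1; rewrite scale1r mul1r !addr0.
  by rewrite /P EG.
have Kuniq x r s : K (x, r) -> K (x, s) -> r = s.
  move=> h1 h2.
  have neg (y : X) : (- 1)%:C *: y = - y by rewrite rmorphN rmorph1 scaleN1r.
  have := Kp _ _ (Klin (-1) _ _ _ _ h1 h2); have := Kp _ _ (Klin (-1) _ _ _ _ h2 h1).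
  by rewrite neg addNr seminorm0; lra.
have [f fK] := choice Ktotal.
exists f; split.
- move=> a x y; exact: (Kuniq _ _ _ (fK _) (Klin a _ _ _ _ (fK x) (fK y))).
- by move=> x; exact: Kp.
- apply: (Kuniq x0) => //; right; exists 1.
  by rewrite scale1r mul1r.
Qed.

(** The complex functional is f(x) - i f(i x) for a real one f below p. Rotating x by the phase u
    makes its value real and nonnegative, and then the one-sided bound on f is a bound on the
    modulus. *)
Lemma hahn_banach x0 : p x0 != 0 -> exists g : X -> C^o,
  [/\ linear g, forall x, Rnorm (g x) <= p x & g x0 != 0].
Proof.
move=> px0; have [f [flin fp fx0]] := hahn_banach_real x0.
pose I : C := Complex 0 1.
have fD x y : f (x + y) = f x + f y by have := flin 1 x y; rewrite scale1r mul1r.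
have f0 : f 0 = 0 by have := fD 0 0; rewrite addr0; lra.
have fZ (a : R) x : f (a%:C *: x) = a * f x by have := flin a x 0; rewrite !addr0 f0 addr0.
pose g (x : X) : C^o := Complex (f x) (- f (I *: x)).
have decomp (a : C) (x : X) : a *: x = (complex.Re a)%:C *: x + (complex.Im a)%:C *: (I *: x).
  rewrite scalerA -scalerDl; congr (_ *: _); case: a => a b.
  by apply/eqP; rewrite eq_complex /=; apply/andP; split; apply/eqP; ring.
have II (x : X) : I *: (I *: x) = - x.
  rewrite scalerA -scaleN1r; congr (_ *: _).
  by apply/eqP; rewrite eq_complex /=; apply/andP; split; apply/eqP; ring.
have fN x : f (- x) = - f x by have := fD x (- x); rewrite subrr f0; lra.
have glin : linear g.
  move=> a x y; have e : I *: (a *: x + y) = (complex.Re a)%:C *: (I *: x) -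
      (complex.Im a)%:C *: x + I *: y.
    rewrite scalerDr; congr (_ + _); rewrite -scalerN -(II x) -decomp.
    by rewrite !scalerA mulrC.
  have -> : a *: g x + g y = a * g x + g y by [].
  rewrite /g e !fD fN !fZ {1}(decomp a x) fD !fZ; case: a {e} => a b /=.
  by apply/eqP; rewrite eq_complex /=; apply/andP; split; apply/eqP; ring.
exists g; split => //; last first.
  by apply: contra_neq px0 => /(congr1 (@complex.Re R)) /=; rewrite fx0.
move=> x; have [gx0|gx0] := eqVneq (g x) 0; first by rewrite gx0 Rnorm0 seminorm_ge0.
have n0 : Rnorm (g x) != 0 by apply: contra_neq gx0 => /Rnorm_eq0.
pose u : C := conjc (g x) * ((Rnorm (g x))^-1)%:C.
have gu : g (u *: x) = (Rnorm (g x))%:C.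
  rewrite (linZ glin) -[LHS]/(u * g x) /u mulrAC [conjc _ * _]mulrC -Rnorm_sqr.
  by rewrite -rmorphM expr2 -mulrA mulfV// mulr1.
have fu : f (u *: x) = Rnorm (g x) by have := congr1 (@complex.Re R) gu.
have nu : Rnorm u = 1.
  rewrite /u RnormM Rnorm_conj Rnorm_real ?invr_ge0 ?Rnorm_ge0//.
  by rewrite mulfV.
by rewrite -fu; apply: le_trans (fp _) _; rewrite pZ nu mul1r.
Qed.

End HahnBanach.

(** * Operator systems and their duals *)

Section PositiveMaps.
Variable R : realType.

Lemma CBp_comp (X Y Z : modata R) (phi : X -> Y) (psi : Y -> Z) :
  is_operator_space Y -> CBp phi -> CBp psi -> CBp (psi \o phi).
Proof.
move=> oY [[[lf sf] pf] [M hM]] [[[lg sg] pg] bg].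
have [N N0 hN] := cb_bound oY bg.
have mE n (x : 'M[X]_n) : map_mx (psi \o phi) x = map_mx psi (map_mx phi x).
  exact: map_mx_comp.
split; last first.
  exists (N * M) => n x; rewrite mE; apply: le_trans (hN _ _) _.
  by rewrite -mulrA ler_pM2l.
split; last by move=> n x xc; rewrite mE; apply: pg; exact: pf.
split; first by move=> a x y /=; rewrite lf lg.
by move=> x /=; rewrite sf sg.
Qed.

Lemma dual_map_wcontinuous (X Y : modata R) (phi : X -> Y) :
  is_operator_space X -> is_operator_space Y -> linear phi -> completely_bounded phi ->
  wcontinuous (range (kappa Y)) (range (kappa X)) (@dual_map R X Y phi).
Proof.
move=> oX oY lf bf; apply/wcontinuousP => _ [x _ <-].
have e : (fun g : dual Y => val (kappa X x) (dual_map phi g)) = val (kappa Y (phi x)).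
  by apply/funext => g; rewrite (kappaE oX) dual_mapE// kappaE.
by rewrite e; apply: wstar_eval_continuous; exists (phi x).
Qed.

End PositiveMaps.

Section TdSmos.
Variables (R : realType) (D : modata R) (F : set (dual D)).
Local Notation TD := (submo (mu_range F)).

Lemma td_involution : is_involution TD.
Proof.
have st (d : nat) : [/\ forall x y : matmo R d, star (x + y) = star x + star y,
    forall a (x : matmo R d), star (a *: x) = conjc a *: star x &
    forall x : matmo R d, star (star x) = x].
  split.
  - by move=> x y; apply/matrixP => i j; rewrite !mxE rmorphD.
  - by move=> a x; apply/matrixP => i j; rewrite !mxE rmorphM.
  - by move=> x; apply/matrixP => i j; rewrite !mxE conjCK.
split.
- move=> x y; apply: td_ext => i.
  rewrite (linD (@tcoord_lin _ _ _ i)) !tcoord_star (linD (@tcoord_lin _ _ _ i)).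
  by have [h _ _] := st (tag i).+1; exact: h.
- move=> a x; apply: td_ext => i.
  rewrite (linZ (@tcoord_lin _ _ _ i)) !tcoord_star (linZ (@tcoord_lin _ _ _ i)).
  by have [_ h _] := st (tag i).+1; exact: h.
- move=> x; apply: td_ext => i; rewrite !tcoord_star.
  by have [_ _ h] := st (tag i).+1; exact: h.
Qed.

Lemma td_norm_star n (u : 'M[TD]_n) : mnorm (mstar u) = mnorm u.
Proof.
have [_ n0 nle nlub] := td_norming F.
have e i (v : 'M[TD]_n) : mnorm (map_mx (tcoord i) (mstar v)) = mnorm (map_mx (tcoord i) v).
  by rewrite map_mstar; [exact: matmo_norm_star|exact: tcoord_star].
apply: le_anti; apply/andP; split.
  by apply: (nlub n (mstar u)); [exact: n0|move=> i; rewrite e; exact: nle].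
by apply: (nlub n u); [exact: n0|move=> i; rewrite -e; exact: nle].
Qed.

Lemma td_smos : is_smos TD.
Proof.
split; [exact: td_operator_space|exact: td_involution|by move=> n u; exact: td_norm_star|].
apply: (@family_matrix_cone R TD (WQall F) (fun i => (tag i).+1) (@tcoord R D F)).
- exact: td_operator_space.
- exact: td_involution.
- by move=> n u; exact: td_norm_star.
- by move=> i; split; [exact: tcoord_lin|exact: tcoord_star].
- move=> i; exists 1 => n u; rewrite mul1r.
  by have [_ _ nle _] := td_norming F; exact: nle.
- move=> n u; apply: (iff_trans (td_coneP u)); split=> [h|[_ h]]; last exact: h.
  by split; [apply: td_cone_sa; apply: (iffRL (td_coneP u))|exact: h].
Qed.

End TdSmos.

Section MuIsomorphism.
Variables (R : realType) (D : modata R).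

(** The set F0 is separate from F because [td] is built on the set [range kappa], while [dualizable]
    supplies a subspace with that underlying set. *)
Lemma mus_isomorphism (F : saspace (dual D)) (F0 : set (dual D)) :
  lset F = F0 -> is_dual_quasi_opsys F ->
  wcontinuous F0 (Defs.restrict (ND_predual F0) (mu_range F0)) (mus F0) /\
  exists inv : submo (mu_range F0) -> D,
    [/\ cancel (mus F0) inv, cancel inv (mus F0), CBp inv &
        wcontinuous (Defs.restrict (ND_predual F0) (mu_range F0)) F0 inv].
Proof.
move=> <- [[[sD ncF _ _ _] _] [H [V [rho [_ mrho wrho]]]]].
have oD := smos_os sD.
split; first exact: mus_wcontinuous.
have inj := mus_inj sD mrho wrho.
have [inv invK] := choice (@mus_surj _ _ (lset F)).
have cK : cancel (mus (lset F)) inv by move=> x; apply: inj; rewrite -invK.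
have Kc : cancel inv (mus (lset F)) by move=> u; rewrite -invK.
have mK n (u : 'M[submo (mu_range (lset F))]_n) : map_mx (mus (lset F)) (map_mx inv u) = u.
  by apply/matrixP => i j; rewrite !mxE Kc.
exists inv; split; [exact: cK|exact: Kc| |exact: (mus_inverse_wcontinuous sD mrho wrho)].
split; last first.
  have [c c0 h] := mus_bounded_below sD mrho wrho.
  by exists c => n u; apply: le_trans (h _ _) _; rewrite mK.
split; last first.
  move=> n u uc; apply: (mus_reflects_cone sD mrho wrho).
  by rewrite mK.
split; first exact: (lin_inverse (@mus_lin _ _ _) cK Kc).
by move=> u; apply: inj; rewrite mus_star !Kc.
Qed.

End MuIsomorphism.

Section OperatorSystems.
Variables (R : realType) (T : opsys R).
Local Notation C := R[i].
Local Notation H := (opsys_hilbert T).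
Hypothesis sT : is_smos T.

Let oT := smos_os sT.

Definition ops_compression m (e : 'I_m -> H) (t : T) : matmo R m :=
  compression e (val t : BH H).

Lemma map_ops_compression m (e : 'I_m -> H) n (t : 'M[T]_n) :
  map_mx (ops_compression e) t = map_mx (compression e) (map_mx val t).
Proof. by rewrite -map_mx_comp. Qed.

Lemma ops_involutive (t : T) : star (star (val t : BH H)) = val t.
Proof.
by rewrite -[val t]/(incl t) -!incl_star; case: sT => _ [_ _ ->].
Qed.

Lemma ops_compression_lin m (e : 'I_m -> H) : linear (ops_compression e).
Proof.
by move=> a x y; rewrite /ops_compression subl_valD subl_valZ compression_lin.
Qed.

Lemma ops_compression_star m (e : 'I_m -> H) t :
  ops_compression e (star t) = star (ops_compression e t).
Proof. exact/compression_star/ops_involutive. Qed.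

(** Compressions of T are positive matrices over its dual lying in the unit ball. The bound is
    exactly 1, since T carries the norm of B(H) itself; matrices over the dual therefore recover
    norm, cone and points of T. *)
Lemma ops_compression_dual m (e : 'I_m.+1 -> H) : contractive_frame e ->
  exists f : 'M[dual T]_m.+1,
  [/\ forall t, theta f t = ops_compression e t, mnorm f <= 1 & mcone f].
Proof.
move=> he.
have nle n (t : 'M[T]_n) : mnorm (map_mx (ops_compression e) t) <= mnorm t.
  by rewrite map_ops_compression; exact: compression_norm_le.
have b i j : bounded_functional (fun t : T => ops_compression e t i j : C^o).
  split; first by move=> a x y; rewrite ops_compression_lin !mxE.
  exists 1 => t; rewrite mul1r.
  have := nle 1%N (const_mx t); rewrite map_const_mx => h.
  apply: le_trans h; have := matmo_vector_form_le (ops_compression e t)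
    (delta_mx j 0) (delta_mx i 0).
  rewrite -!hs_col !hs_delta !mulr1 => h; apply: le_trans h.
  rewrite -form_const !trmx_delta form_delta.
  have ec : (const_mx (ops_compression e t) : 'M[matmo R m.+1]_1) 0 0 =
      ops_compression e t by rewrite [LHS]mxE.
  by rewrite ec.
pose f : 'M[dual T]_m.+1 :=
  \matrix_(i, j) insubd 0 (fun t : T => ops_compression e t i j : C^o).
have fE t i j : val (f i j) t = ops_compression e t i j.
  by rewrite mxE (dual_val (b i j)).
have thE t : theta f t = ops_compression e t.
  by apply/matrixP => i j; rewrite mxE fE.
have mthE n (t : 'M[T]_n) : map_mx (theta f) t = map_mx (ops_compression e) t.
  by apply/matrixP => i j; rewrite !mxE thE.
exists f; split; first exact: thE.
  apply: (dual_norm_lub oT); first exact: ler01.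
  by move=> n t; rewrite mthE mul1r.
apply: (iffRL (dual_coneP sT f)); split.
  apply/matrixP => i j; rewrite mxE mxE; apply: dual_eq => t.
  rewrite (dual_starE sT) !fE ops_compression_star !mxE.
  exact: conjcK.
move=> n t tc; rewrite mthE map_ops_compression.
exact: (iffLR (compression_coneP _) tc).
Qed.

Lemma ops_norm_lub n (t : 'M[T]_n) (c : R) : 0 <= c ->
  (forall m (f : 'M[dual T]_m), mnorm f <= 1 -> mnorm (map_mx (theta f) t) <= c) ->
  mnorm t <= c.
Proof.
move=> c0 h; apply: compression_norm_lub => // m e he.
have [f [fE f1 _]] := ops_compression_dual he.
rewrite -map_ops_compression; have -> : map_mx (ops_compression e) t = map_mx (theta f) t.
  by apply/matrixP => i j; rewrite mxE [RHS]mxE fE.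
exact: h.
Qed.

Lemma ops_cone_intro n (t : 'M[T]_n) :
  (forall m (f : 'M[dual T]_m), mcone f -> mcone (map_mx (theta f) t)) -> mcone t.
Proof.
move=> h; apply: (iffRL (compression_coneP _)) => m e he.
have [f [fE _ fc]] := ops_compression_dual he.
rewrite -map_ops_compression; have -> : map_mx (ops_compression e) t = map_mx (theta f) t.
  by apply/matrixP => i j; rewrite mxE [RHS]mxE fE.
exact: h.
Qed.

Lemma ops_separated (t t' : T) : (forall f : dual T, val f t = val f t') -> t = t'.
Proof.
move=> h; apply: val_inj; apply: compression_ext => m e he.
have [f [fE _ _]] := ops_compression_dual he.
have := fE t; have := fE t'; rewrite /ops_compression => <- <-.
by apply/matrixP => i j; rewrite !mxE h.
Qed.

(** On matrices over the dual, the image of t acts as [evmx t]. One inequality is the definition of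
    the dual norm; the other holds because the unit balls over the dual of an operator system norm
    it. *)
Lemma kappa_isometry : complete_isometry (kappa T).
Proof.
move=> n t; have oD := dual_operator_space oT.
have e m (f : 'M[dual T]_m) : map_mx (theta (map_mx (kappa T) t)) f = map_mx (evmx t) f.
  by apply/matrixP => i j; rewrite !mxE; apply/matrixP => a b; rewrite !mxE kappaE.
apply: le_anti; apply/andP; split.
  apply: (dual_norm_lub oD); first exact: os_norm_ge0.
  by move=> m f; rewrite e evmx_norm mulrC; exact: dual_norm_bound.
apply: ops_norm_lub; first exact: (dual_norm_ge0 oD).
move=> m f f1; rewrite -evmx_norm -e; apply: le_trans (dual_norm_bound oD _ _) _.
by rewrite -[leRHS]mulr1 ler_wpM2l// (dual_norm_ge0 oD).
Qed.

End OperatorSystems.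

(** * Recovering a map from its dual *)

Section Predualization.
Variables (R : realType) (S : modata R) (T : opsys R).
Hypotheses (sS : is_smos S) (sT : is_smos T).
Variables (phi : S -> T) (psi : dual T -> dual S).
Hypothesis psiE : forall f s, val (psi f) s = val f (phi s).

Let oS := smos_os sS.
Let oT := smos_os sT.

Lemma theta_predual m (f : 'M[dual T]_m) n (s : 'M[S]_n) :
  map_mx (theta f) (map_mx phi s) = map_mx (theta (map_mx psi f)) s.
Proof.
by apply/matrixP => i j; rewrite !mxE; apply/matrixP => a b; rewrite !mxE psiE.
Qed.

Lemma predual_bound (M : R) : 0 <= M ->
  (forall m (f : 'M[dual T]_m), mnorm (map_mx psi f) <= M * mnorm f) ->
  forall n (s : 'M[S]_n), mnorm (map_mx phi s) <= M * mnorm s.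
Proof.
move=> M0 hM n s; apply: (ops_norm_lub sT); first by rewrite mulr_ge0 ?(os_norm_ge0 oS).
move=> m f f1; rewrite theta_predual; apply: le_trans (dual_norm_bound oS _ _) _.
rewrite ler_wpM2r ?(os_norm_ge0 oS)//; apply: le_trans (hM _ _) _.
by rewrite -[leRHS]mulr1 ler_wpM2l.
Qed.

Lemma predual_CBp : CBp psi -> CBp phi.
Proof.
move=> [[[lpsi spsi] ppsi] bpsi].
split; last first.
  have [M M0 hM] := cb_bound (dual_operator_space oT) bpsi.
  by exists M; exact: predual_bound (ltW M0) hM.
split; last first.
  move=> n s sc; apply: (ops_cone_intro sT) => m f fc; rewrite theta_predual.
  by have [_ h] := iffLR (dual_coneP sS _) (ppsi m f fc); exact: h.
split.
  (* So far phi is a mere function; it is linear because each functional psi f is, and the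
     functionals separate the points of T. *)
  move=> a x y; apply: (ops_separated sT) => f.
  by rewrite -psiE !(dual_lin (psi f)) (dual_lin f) !psiE.
move=> s; apply: (ops_separated sT) => f.
apply: (can_inj (@conjcK R)).
by rewrite -(dual_starE sT) -psiE -psiE -(dual_starE sS) spsi.
Qed.

End Predualization.

Section PredualMap.
Variables (R : realType) (S : modata R) (T : modata R).
Hypotheses (oS : is_operator_space S) (oT : is_operator_space T).

(** For fixed s the functional taking f to psi f at s is weak*-continuous, hence a finite
    combination of evaluations at points of T, and this is evaluation at one point t, the value of
    phi at s. *)
Lemma predual_map_exists (psi : dual T -> dual S) : linear psi ->
  wcontinuous (range (kappa T)) (range (kappa S)) psi ->
  exists phi : S -> T, forall f s, val (psi f) s = val f (phi s).
Proof.
move=> lpsi /wcontinuousP cpsi.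
suff h s : exists t, forall f, val (psi f) s = val f t.
  by have [phi hphi] := choice h; exists phi.
have Pg : exists t, forall f, val (psi f) s = val f t.
  apply: (wstar_continuous_ind (F := range (kappa T))
    (P := fun g => exists t, forall f : dual T, g f = val f t)).
  - by exists 0 => f; rewrite (lin0 (@dual_lin _ _ f)).
  - move=> a _ g [t' _ <-] [t gE]; exists (a *: t' + t) => f.
    by rewrite (dual_lin f) gE (kappaE oT).
  - by move=> a f g; rewrite lpsi dual_valD dual_valZ.
  - have := cpsi (kappa S s) (ex_intro2 _ _ s I erefl).
    have e : (fun f => val (kappa S s) (psi f)) = (fun f => val (psi f) s).
      by apply/funext => f; rewrite (kappaE oS).
    by rewrite e.
exact: Pg.
Qed.

End PredualMap.

Section DualizableSystem.
Variables (R : realType) (T : modata R).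
Hypothesis dT : dualizable T.

Lemma dualizable_smos : is_smos T.
Proof. by case: dT => [[[]]]. Qed.

Lemma mu_td_CBp : CBp (mu_td T).
Proof.
apply: mus_CBp; apply: dual_operator_space.
by case: dualizable_smos.
Qed.

Lemma mu_td_iso : wcontinuous (range (kappa T)) (td_predual T) (mu_td T) /\
  exists inv : td T -> dual T,
    [/\ cancel (mu_td T) inv, cancel inv (mu_td T), CBp inv &
        wcontinuous (td_predual T) (range (kappa T)) inv].
Proof. by case: dT => _ [F [FE dF]]; exact: (mus_isomorphism FE dF). Qed.

Lemma mu_td_surj (u : td T) : exists f, u = mu_td T f.
Proof. exact: mus_surj. Qed.

Lemma mu_td_inj : injective (mu_td T).
Proof. by have [_ [inv [mK _ _ _]]] := mu_td_iso; exact: can_inj mK. Qed.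

End DualizableSystem.

Section Separation.
Variables (R : realType) (S : lmodType R[i]) (T : modata R) (phi : S -> T) (t : T).
Hypotheses (oT : is_operator_space T) (lphi : linear phi).

Let nrmD (x y : T) : nrm (x + y) <= nrm x + nrm y.
Proof.
case: oT => h _ _ _ _; have := h _ (const_mx x : 'M[T]_1) (const_mx y).
have -> : const_mx x + const_mx y = const_mx (x + y) :> 'M[T]_1.
  by apply/matrixP => i j; rewrite !mxE.
exact.
Qed.

Let nrmZ a (x : T) : nrm (a *: x) = Rnorm a * nrm x.
Proof.
case: oT => _ h _ _ _; rewrite -h; congr mnorm; apply/matrixP => i j.
by rewrite !mxE.
Qed.

Let P (x : T) : set R := [set r | exists s, r = nrm (x - phi s)].
Let p (x : T) := inf (P x).

Let Plb x : lbound (P x) 0.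
Proof. by move=> _ [s ->]; exact: nrm_ge0. Qed.

Let Pinf x : has_inf (P x).
Proof. by split; [exists (nrm (x - phi 0)), 0|exists 0; exact: Plb]. Qed.

Let ple x s : p x <= nrm (x - phi s).
Proof. by apply: ge_inf; [exists 0; exact: Plb|exists s]. Qed.

Let papprox x (e : R) : 0 < e -> exists s, nrm (x - phi s) < p x + e.
Proof.
by move=> e0; have [_ [s ->] h] := inf_adherent e0 (Pinf x); exists s.
Qed.

Let p0 x : 0 <= p x.
Proof. by apply: lb_le_inf; [case: (Pinf x)|exact: Plb]. Qed.

Let pD x y : p (x + y) <= p x + p y.
Proof.
apply/ler_addgt0Pr => e e0; have e2 : 0 < e / 2 by rewrite divr_gt0.
have [s hs] := papprox x e2; have [s' hs'] := papprox y e2.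
apply: le_trans (ple _ (s + s')) _; rewrite (linD lphi) opprD addrACA.
apply: le_trans (nrmD _ _) _.
by move: (nrm _) (nrm _) (p x) (p y) hs hs' => a b c d; lra.
Qed.

Let pZle a x : p (a *: x) <= Rnorm a * p x.
Proof.
apply/ler_addgt0Pr => e e0; have a0 : 0 < Rnorm a + 1 by rewrite ltr_wpDl ?Rnorm_ge0.
have [s hs] := papprox x (divr_gt0 e0 a0).
apply: le_trans (ple _ (a *: s)) _; rewrite (linZ lphi) -scalerBr nrmZ.
apply: (@le_trans _ _ (Rnorm a * (p x + e / (Rnorm a + 1)))).
  by rewrite ler_wpM2l ?Rnorm_ge0// ltW.
rewrite mulrDr lerD2l mulrCA ger_pMr// ler_pdivrMr// mul1r.
by rewrite lerDl.
Qed.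

Let pZ a x : p (a *: x) = Rnorm a * p x.
Proof.
apply: le_anti; rewrite pZle andTb.
have [->|a0] := eqVneq a 0; first by rewrite Rnorm0 mul0r.
have ap : 0 < Rnorm a.
  by rewrite lt_def Rnorm_ge0 andbT; apply: contra_neq a0 => /Rnorm_eq0.
by have := pZle a^-1 (a *: x); rewrite scalerA mulVf// scale1r RnormV ler_pdivlMl.
Qed.

(* Hahn-Banach for the distance to the range of phi *)
Lemma separating_functional :
  ~ (forall e : R, 0 < e -> exists s, nrm (t - phi s) < e) ->
  exists f : dual T, (forall s, val f (phi s) = 0) /\ val f t != 0.
Proof.
move=> far; have pt : p t != 0.
  apply/eqP => pt0; apply: far => e e0; have [s hs] := papprox t e0.
  by exists s; rewrite pt0 add0r in hs.
have [g [lg gp gt]] := hahn_banach pD pZ pt.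
have bg : bounded_functional g.
  split; [exact: lg|exists 1 => x; rewrite mul1r; apply: le_trans (gp x) _].
  by have := ple x 0; rewrite (lin0 lphi) subr0.
exists (insubd 0 g); rewrite (dual_val bg); split; last exact: gt.
move=> s; apply: Rnorm_eq0; apply: le_anti; rewrite Rnorm_ge0 andbT.
apply: le_trans (gp _) _; apply: le_trans (ple _ s) _; rewrite subrr.
by rewrite -(scale0r (0 : T)) nrmZ Rnorm0 mul0r.
Qed.

End Separation.

(** * The correspondence between phi and its dual map *)

Section DualOfMap.
Variables (R : realType) (S T : opsys R).
Hypotheses (dS : dualizable S) (dT : dualizable T).

Let sS : is_smos S := dualizable_smos dS.
Let sT : is_smos T := dualizable_smos dT.
Let oS := smos_os sS.
Let oT := smos_os sT.
Let oSd : is_operator_space (td S) := @td_operator_space _ _ _.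
Let oTd : is_operator_space (td T) := @td_operator_space _ _ _.

Lemma is_phid_mu (phi : S -> T) chi : is_phid phi chi ->
  forall f, chi (mu_td T f) = mu_td S (dual_map phi f).
Proof. by move=> [_ e] f; exact: (congr1 (fun h : dual T -> td S => h f) e). Qed.

Lemma is_phid_unique (phi : S -> T) chi chi' :
  is_phid phi chi -> is_phid phi chi' -> chi = chi'.
Proof.
move=> h h'; apply/funext => u; have [f ->] := mu_td_surj u.
by rewrite (is_phid_mu h) (is_phid_mu h').
Qed.

Lemma is_phid_exists (phi : S -> T) : CBp phi -> exists chi, is_phid phi chi.
Proof.
move=> cphi; have [[[lphi _] _] bphi] := cphi.
have [wS _] := mu_td_iso dS; have [_ [inv [mK Km cinv winv]]] := mu_td_iso dT.
exists (mu_td S \o (@dual_map R S T phi \o inv)); split; last first.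
  by apply/funext => f; exact: (congr1 (fun h => mu_td S (dual_map phi h)) (mK f)).
split.
  apply: CBp_comp (mu_td_CBp dS); first exact: dual_operator_space.
  apply: CBp_comp cinv _; first exact: dual_operator_space.
  exact: dual_map_CBp.
apply: wcontinuous_comp wS; apply: wcontinuous_comp winv _.
exact: dual_map_wcontinuous.
Qed.

Lemma phidP (phi : S -> T) : CBp phi -> is_phid phi (phid phi).
Proof. by move=> /is_phid_exists h; exact: xgetPex h. Qed.

Lemma phid_mu (phi : S -> T) : CBp phi ->
  forall f, phid phi (mu_td T f) = mu_td S (dual_map phi f).
Proof. by move=> /phidP /is_phid_mu. Qed.

Lemma phid_eq (phi : S -> T) chi : CBp phi -> is_phid phi chi -> chi = phid phi.
Proof. by move=> /phidP h h'; exact: is_phid_unique h' h. Qed.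

Lemma mu_td_lift n (u : 'M[td T]_n) : exists f : 'M[dual T]_n, u = map_mx (mu_td T) f.
Proof.
exact: map_mx_surj (@mu_td_surj _ _) _ u.
Qed.

Lemma phid_contraction (phi : S -> T) : CBp phi -> complete_contraction phi ->
  complete_contraction (phid phi).
Proof.
move=> cphi cc n u; have [f ->] := mu_td_lift u.
have [[[lphi sphi] pphi] bphi] := cphi.
have -> : map_mx (phid phi) (map_mx (mu_td T) f) = map_mx (mu_td S) (map_mx (dual_map phi) f).
  by apply/matrixP => i j; rewrite !mxE phid_mu.
have [cdual _] := dual_map_CBp sS sT cphi.
have nb k (g : 'M[dual T]_k) : mnorm (map_mx (dual_map phi) g) <= 1 * mnorm g.
  by apply: dual_map_bound => // p x; rewrite mul1r.
have := mus_transfer ltr01 cdual nb (dual_map_wcontinuous oS oT lphi bphi) f.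
by rewrite mul1r => -[].
Qed.

Lemma phid_inj (phi phi' : S -> T) : CBp phi -> CBp phi' -> phid phi = phid phi' -> phi = phi'.
Proof.
move=> c c' e; apply/funext => s; apply: (ops_separated sT) => f.
have := phid_mu c f; rewrite e (phid_mu c') => /(mu_td_inj dS) ef.
have [[[l _] _] b] := c; have [[[l' _] _] b'] := c'.
by rewrite -(dual_mapE oS oT l b) -(dual_mapE oS oT l' b') ef.
Qed.

Lemma phid_surj (chi : td T -> td S) : CBpw (td_predual T) (td_predual S) chi ->
  exists2 phi : S -> T, CBp phi & chi = phid phi.
Proof.
move=> [cchi wchi].
have [wT _] := mu_td_iso dT; have [_ [inv [mK Km cinv winv]]] := mu_td_iso dS.
pose psi : dual T -> dual S := inv \o (chi \o mu_td T).
have cpsi : CBp psi.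
  by apply: CBp_comp (CBp_comp oTd (mu_td_CBp dT) cchi) cinv.
have wpsi : wcontinuous (range (kappa T)) (range (kappa S)) psi.
  by apply: wcontinuous_comp winv; exact: wcontinuous_comp wT wchi.
have lpsi : linear psi by case: cpsi => [[[]]].
have [phi phiE] := predual_map_exists oS oT lpsi wpsi.
have cphi : CBp phi := predual_CBp sS sT phiE cpsi.
have [[[l _] _] b] := cphi.
have e f : dual_map phi f = psi f.
  by apply: dual_eq => s; rewrite (dual_mapE oS oT l b) phiE.
exists phi; first exact: cphi.
apply: (phid_eq cphi); split; first exact: (conj cchi wchi).
apply/funext => f; rewrite -[LHS]/(chi (mu_td T f)) -[RHS]/(mu_td S (dual_map phi f)).
by rewrite e; exact: (esym (Km _)).
Qed.

(* Krein-Smulian is avoided: the range of phi is closed since an element of S^**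
   approximated by kappa (S) lies in kappa (S), and it is dense by Hahn-Banach
   because the dual map of phi is injective. *)
Lemma predual_surjective (phi : S -> T) (psi' : dual S -> dual T) :
  CBp phi -> CBp psi' -> cancel (@dual_map R S T phi) psi' ->
  cancel psi' (@dual_map R S T phi) -> forall t, exists s, phi s = t.
Proof.
move=> cphi cpsi dK Kd t; have [[[lphi _] _] bphi] := cphi.
have [[[lpsi _] _] bpsi] := cpsi.
have oS' := dual_operator_space oS.
have [M M0 hM] := cb_bound oS' bpsi.
have psi'E f s : val (psi' f) (phi s) = val f s.
  by rewrite -[in RHS](Kd f) (dual_mapE oS oT lphi bphi).
have psi'_le f : nrm (psi' f) <= M * nrm f.
  by have := hM 1%N (const_mx f); rewrite map_const_mx.
have [approx|far] := pselect (forall e : R, 0 < e -> exists s, nrm (t - phi s) < e).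
  (* That the range of [kappa S] is norm closed is part of S^* being a dual SMOS with predual S. *)
  have [F [FE [[[_ ncF _ _ _] _] _]]] := dS.2.
  have b : bounded_functional (fun f : dual S => val (psi' f) t).
    split; first by move=> a f g; rewrite lpsi dual_valD dual_valZ.
    exists (M * nrm t) => f; apply: le_trans (dual_apply_le oT _ _) _.
    rewrite mulrAC; apply: ler_wpM2r; [exact: nrm_ge0|exact: psi'_le].
  (* The preimage of t, seen in the bidual of S: evaluation at t transported by the inverse of the
     dual map of phi. *)
  pose u : dual (dual S) := insubd 0 (fun f : dual S => val (psi' f) t).
  have uE f : val u f = val (psi' f) t by rewrite /u (dual_val b).
  have Fu : lset F u.
    (* At f, the difference of u and [kappa S s] is psi' f at t - phi s, hence at most M |f| times
       the distance from t to phi s; this choice makes its norm at most e / 2. *)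
    apply: ncF => e e0; have eM : 0 < e / (2 * M) by rewrite divr_gt0 ?mulr_gt0.
    have [s hs] := approx _ eM; exists (kappa S s); first by rewrite FE; exists s.
    apply: (@le_lt_trans _ _ (e / 2)); last by rewrite ltr_pdivrMr// ltr_pMr// ltrDl.
    apply: (dual_nrm_le oS'); first by rewrite divr_ge0 ?(ltW e0).
    move=> f; rewrite dual_valB uE (kappaE oS) -psi'E -(linB (@dual_lin _ _ (psi' f))).
    apply: le_trans (dual_apply_le oT _ _) _.
    apply: (@le_trans _ _ ((M * nrm f) * (e / (2 * M)))).
      by apply: ler_pM; rewrite ?(nrm_ge0 oT) ?(nrm_ge0 (dual_operator_space oT)) ?psi'_le ?ltW.
    rewrite mulrAC (_ : M * (e / (2 * M)) = e / 2)//.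
    by rewrite invfM mulrCA [M * (_ * _)]mulrCA divff ?lt0r_neq0// mulr1.
  move: Fu; rewrite FE => -[s _ su]; exists s; apply: (ops_separated sT) => g.
  have := congr1 (fun v => val v (dual_map phi g)) su.
  by rewrite (kappaE oS) uE dK (dual_mapE oS oT lphi bphi).
have [f [f0 ft]] := separating_functional oT lphi far.
have : f = 0.
  have e : dual_map phi f = 0.
    by apply: dual_eq => s; rewrite (dual_mapE oS oT lphi bphi) dual_val0.
  by rewrite -(dK f) e (lin0 lpsi).
by move=> fz; move: ft; rewrite fz dual_val0 eqxx.
Qed.

(** Once phi is onto, the inverse psi' of its dual map is itself the dual of the inverse of phi;
    positivity and boundedness of psi' then descend to that inverse by [predual_CBp]. *)
Lemma phid_reflects_mos_iso (phi : S -> T) : CBp phi -> mos_iso (phid phi) -> mos_iso phi.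
Proof.
move=> cphi miso; have [[[lphi _] _] bphi] := cphi.
have cone_sa n (u : 'M[td S]_n) : mcone u -> mstar u = u by exact: td_cone_sa.
have [chi' [cK Kc cchi']] := mos_iso_inverse cone_sa miso.
have [_ [inv [mK Km cinv winv]]] := mu_td_iso dT.
pose psi' : dual S -> dual T := inv \o (chi' \o mu_td S).
have cpsi' : CBp psi' by apply: CBp_comp (CBp_comp oSd (mu_td_CBp dS) cchi') cinv.
have dK : cancel (@dual_map R S T phi) psi'.
  move=> f; rewrite -[LHS]/(inv (chi' (mu_td S (dual_map phi f)))).
  by rewrite -(phid_mu cphi) cK mK.
have Kd : cancel psi' (@dual_map R S T phi).
  move=> f; apply: (mu_td_inj dS).
  have e : mu_td T (psi' f) = chi' (mu_td S f) by exact: Km.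
  by rewrite -(phid_mu cphi) e; exact: Kc.
have [theta_ phiK] := choice (predual_surjective cphi cpsi' dK Kd).
have thetaE f t : val (psi' f) t = val f (theta_ t).
  by rewrite -{1}(phiK t) -[in RHS](Kd f) (dual_mapE oS oT lphi bphi).
have Kphi : cancel phi theta_.
  move=> s; apply: (ops_separated sS) => f.
  by rewrite -thetaE -[in RHS](Kd f) (dual_mapE oS oT lphi bphi).
apply: (mos_iso_intro oT Kphi phiK cphi).
exact: (predual_CBp sT sS thetaE cpsi').
Qed.

End DualOfMap.

Section SmosCone.
Variables (R : realType) (X : modata R).
Lemma smos_cone_sa (sX : is_smos X) n (x : 'M[X]_n) : mcone x -> mstar x = x.
Proof. by case: sX => _ _ _ [h _ _ _]; exact: h. Qed.
End SmosCone.

(** * Norms through the second dual *)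

Section TauKappa.
Variables (R : realType) (T : modata R).
Hypothesis dT : dualizable T.

Let sT : is_smos T := dualizable_smos dT.
Let oT := smos_os sT.
Let oTd : is_operator_space (td T). Proof. exact: td_operator_space. Qed.

(** Evaluation at t as a functional on T^d. The choice of preimage is the one made in [tau], so that
    [tau T (kappa T t)] is [mu_td (td T) (kappa_td t)] by definition. *)
Definition kappa_td (t : T) : dual (td T) :=
  xget 0 [set g | dual_map (@mu_td R T) g = kappa T t].

Lemma kappa_tdE t f : val (kappa_td t) (mu_td T f) = val f t.
Proof.
have oD := dual_operator_space oT.
have [_ [inv [mK Km [[[linv _] _] binv] _]]] := mu_td_iso dT.
have [[[lmu _] _] bmu] := mu_td_CBp dT.
have ex : exists g, dual_map (@mu_td R T) g = kappa T t.
  exists (dual_map inv (kappa T t)); apply: dual_eq => h.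
  by rewrite (dual_mapE oD oTd lmu bmu) (dual_mapE oTd oD linv binv) mK.
have e : dual_map (@mu_td R T) (kappa_td t) = kappa T t by exact: (xgetPex 0 ex).
by rewrite -(dual_mapE oD oTd lmu bmu) e (kappaE oT).
Qed.

Lemma map_tau_kappa n (x : 'M[T]_n) :
  map_mx (tau T \o kappa T) x = map_mx (mu_td (td T)) (map_mx kappa_td x).
Proof. by rewrite -map_mx_comp. Qed.

End TauKappa.

Section DualOfPositiveMap.
Variables (R : realType) (S T : opsys R).
Hypotheses (dS : dualizable S) (dT : dualizable T).

Let sS : is_smos S := dualizable_smos dS.
Let sT : is_smos T := dualizable_smos dT.
Let oS := smos_os sS.
Let oT := smos_os sT.
Let oSd : is_operator_space (td S) := @td_operator_space _ _ _.
Let oTd : is_operator_space (td T) := @td_operator_space _ _ _.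

Lemma phid_cancel (phi : S -> T) (psi : T -> S) : CBp phi -> CBp psi ->
  cancel phi psi -> cancel (phid psi) (phid phi).
Proof.
move=> cphi cpsi fK u; have [f ->] := mu_td_surj u.
rewrite (phid_mu dT dS cpsi) (phid_mu dS dT cphi); congr (mu_td S).
have [[[l _] _] b] := cphi; have [[[l' _] _] b'] := cpsi.
by apply: dual_eq => s; rewrite (dual_mapE oS oT l b) (dual_mapE oT oS l' b') fK.
Qed.

Hypotheses (iS : complete_isometry (tau S \o kappa S))
           (iT : complete_isometry (tau T \o kappa T)).

(** The assumptions on tau and kappa express the norms of S and T in the second duals. There phi
    becomes the dual map of [phid phi], because on [mu_td T f] both functionals give the value of f
    at phi s; [mus_transfer] bounds it by 1. *)
Lemma phid_reflects_contraction (phi : S -> T) : CBp phi ->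
  complete_contraction (phid phi) -> complete_contraction phi.
Proof.
move=> cphi cc n x.
have eT : mnorm (map_mx phi x) =
    mnorm (map_mx (mu_td (td T)) (map_mx (@kappa_td R T) (map_mx phi x))).
  by rewrite -(map_tau_kappa (map_mx phi x)); exact: esym (iT (map_mx phi x)).
have eS : mnorm x = mnorm (map_mx (mu_td (td S)) (map_mx (@kappa_td R S) x)).
  by rewrite -(map_tau_kappa x); exact: esym (iS x).
have [[cchi wchi] _] := phidP dS dT cphi; have [[[lchi schi] pchi] bchi] := cchi.
have [[[lphi _] _] bphi] := cphi.
have e : map_mx (@kappa_td R T) (map_mx phi x) =
    map_mx (dual_map (phid phi)) (map_mx (@kappa_td R S) x).
  apply/matrixP => i j; rewrite mxE [in LHS]mxE [RHS]mxE [in RHS]mxE.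
  apply: dual_eq => u; have [f ->] := mu_td_surj u.
  rewrite (kappa_tdE dT) (dual_mapE oTd oSd lchi bchi) (phid_mu dS dT cphi).
  by rewrite (kappa_tdE dS) (dual_mapE oS oT lphi bphi).
rewrite eT eS e.
have [cdual _] := dual_map_CBp (td_smos _) (td_smos _) cchi.
have nb k (g : 'M[dual (td S)]_k) :
    mnorm (map_mx (dual_map (phid phi)) g) <= 1 * mnorm g.
  apply: (dual_map_bound oTd oSd lchi bchi ler01).
  by move=> p u; rewrite mul1r; exact: cc.
have [h _] := mus_transfer ltr01 cdual nb
  (dual_map_wcontinuous oTd oSd lchi bchi) (map_mx (@kappa_td R S) x).
by rewrite mul1r in h; exact: h.
Qed.

End DualOfPositiveMap.

Section DualOfIsomorphism.
Variables (R : realType) (S T : opsys R).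
Hypotheses (dS : dualizable S) (dT : dualizable T).

Let sS : is_smos S := dualizable_smos dS.
Let sT : is_smos T := dualizable_smos dT.

Lemma mos_iso_phid (phi : S -> T) : mos_iso phi ->
  mos_iso (phid phi) /\ whomeo (td_predual T) (td_predual S) (phid phi).
Proof.
move=> miso; have cphi := mos_iso_CBp (smos_cone_sa sS) miso.
have [psi [fK gK cpsi]] := mos_iso_inverse (smos_cone_sa sT) miso.
have [[c1 w1] _] := phidP dS dT cphi; have [[c2 w2] _] := phidP dT dS cpsi.
have K1 := phid_cancel dS dT cphi cpsi fK; have K2 := phid_cancel dT dS cpsi cphi gK.
split; first exact: (mos_iso_intro (td_operator_space _) K2 K1 c1 c2).
exact: (whomeo_inverse K2 K1 w1 w2).
Qed.

Hypotheses (iS : complete_isometry (tau S \o kappa S))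
           (iT : complete_isometry (tau T \o kappa T)).

(** The inverse of phi has the inverse of [phid phi] as its dual map, so the contraction result
    applies in both directions. *)
Lemma phid_reflects_isometry (phi : S -> T) : CBp phi ->
  complete_isometry (phid phi) -> mos_iso (phid phi) ->
  complete_isometry phi /\ mos_iso phi.
Proof.
move=> cphi iso miso; have mphi := phid_reflects_mos_iso dS dT cphi miso.
split; last exact: mphi.
have [psi [fK gK cpsi]] := mos_iso_inverse (smos_cone_sa sT) mphi.
have cc1 : complete_contraction phi.
  apply: (phid_reflects_contraction dS dT iS iT cphi) => n u.
  by rewrite iso.
have cc2 : complete_contraction psi.
  apply: (phid_reflects_contraction dT dS iT iS cpsi) => n u.
  rewrite -iso; have -> : map_mx (phid phi) (map_mx (phid psi) u) = u.
    apply/matrixP => i j; rewrite mxE [in LHS]mxE.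
    exact: (phid_cancel dS dT cphi cpsi fK).
  exact: lexx.
move=> n x; apply: le_anti; apply/andP; split; first exact: cc1.
have e : map_mx psi (map_mx phi x) = x by apply/matrixP => i j; rewrite !mxE fK.
by rewrite -{1}e; exact: cc2.
Qed.

End DualOfIsomorphism.

(** * Preduals as operator systems *)

Section MatrixConeProper.
Variable R : realType.

(* the quadratic form of x vanishes, so that both x and i x are hermitian *)
Lemma matmo_cone_proper n m (x : 'M[matmo R m]_n) : mcone x -> mcone (- x) -> x = 0.
Proof.
move=> xc nxc; have xs := matmo_cone_sa xc.
move: xc nxc => /matmo_coneP h /matmo_coneP h'.
have x0 v : form x v v = 0.
  have h1 := h v; have := h' v.
  have -> : - x = map_mx ( *:%R (-1)) x by apply/matrixP => i j; rewrite !mxE scaleN1r.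
  by rewrite formZ mulN1r oppr_ge0 => h2; apply: le_anti; rewrite h1 h2.
have ys : mstar (map_mx ( *:%R (0 +i* 1)) x) = map_mx ( *:%R (0 +i* 1)) x.
  by apply: form_real_hermitian => v; rewrite formZ x0 mulr0 real0.
apply/matrixP => i j; apply/matrixP => a b.
move/matrixP: ys => /(_ i j) /matrixP /(_ a b).
move/matrixP: xs => /(_ i j) /matrixP /(_ a b).
rewrite !mxE => <-.
move: (x j i b a) => [p q] /eqP; rewrite eq_complex /= => /andP[/eqP h1 /eqP h2].
by apply/eqP; rewrite eq_complex /=; apply/andP; split; apply/eqP; lra.
Qed.

End MatrixConeProper.

Section OperatorSystemIsMos.
Variables (R : realType) (S : opsys R).
Local Notation C := R[i].
Local Notation H := (opsys_hilbert S).
Hypothesis starK : forall y : S, star (star (val y : BH H)) = val y.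

Let frames := {m & {e : 'I_m.+1 -> H | contractive_frame e}}.
Let comp (i : frames) : S -> matmo R (tag i).+1 := ops_compression (sval (tagged i)).

Let comp_lin i : linear (comp i). Proof. exact: ops_compression_lin. Qed.

Let comp_star i y : comp i (star y) = star (comp i y).
Proof. exact/compression_star/starK. Qed.

Let comp_le i n (y : 'M[S]_n) : mnorm (map_mx (comp i) y) <= mnorm y.
Proof.
rewrite [X in mnorm X]map_ops_compression; apply: compression_norm_le.
exact: (svalP (tagged i)).
Qed.

Let comp_lub n (y : 'M[S]_n) (c : R) : 0 <= c ->
  (forall i, mnorm (map_mx (comp i) y) <= c) -> mnorm y <= c.
Proof.
move=> c0 h; apply: compression_norm_lub; first exact: c0.
move=> m e he; rewrite -map_ops_compression.
exact: (h (existT _ m (exist (fun e : 'I_m.+1 -> H => contractive_frame e) e he))).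
Qed.

Let comp_coneP n (y : 'M[S]_n) : mcone y <-> forall i, mcone (map_mx (comp i) y).
Proof.
split=> [yc i|h].
  rewrite [X in mcone X]map_ops_compression.
  by apply: (iffLR (compression_coneP _) yc); exact: (svalP (tagged i)).
apply: (iffRL (compression_coneP _)) => m e he; rewrite -map_ops_compression.
exact: (h (existT _ m (exist (fun e : 'I_m.+1 -> H => contractive_frame e) e he))).
Qed.

Let comp_ext (x y : S) : (forall i, comp i x = comp i y) -> x = y.
Proof.
move=> h; apply: val_inj; apply: compression_ext => m e he.
exact: (h (existT _ m (exist (fun e : 'I_m.+1 -> H => contractive_frame e) e he))).
Qed.

(** A single family, the compressions, determines norm, cone and points, so all axioms come from
    matrix algebras; [starK] makes these compressions preserve the involution. *)
Lemma opsys_mos : is_mos S.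
Proof.
have nn n (y : 'M[S]_n) : 0 <= mnorm y by exact: BH_norm_ge0.
have norm_comp : norming comp.
  by split; [exact: comp_lin|exact: nn|exact: comp_le|exact: comp_lub].
have oS : is_operator_space S.
  apply: (norming_operator_space norm_comp) => x h; apply: comp_ext => i.
  by rewrite h (lin0 (@comp_lin i)).
have iS : is_involution S.
  split.
  - move=> x y; apply: comp_ext => i.
    rewrite comp_star (linD (@comp_lin i)) [RHS](linD (@comp_lin i)) !comp_star.
    by apply/matrixP => a b; rewrite !mxE rmorphD.
  - move=> a x; apply: comp_ext => i.
    rewrite comp_star (linZ (@comp_lin i)) [RHS](linZ (@comp_lin i)) comp_star.
    by apply/matrixP => k l; rewrite !mxE rmorphM.
  - move=> x; apply: comp_ext => i; rewrite !comp_star.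
    by apply/matrixP => k l; rewrite !mxE conjCK.
have nS n (y : 'M[S]_n) : mnorm (mstar y) = mnorm y.
  have e i : mnorm (map_mx (comp i) (mstar y)) = mnorm (map_mx (comp i) y).
    by rewrite map_mstar; [exact: matmo_norm_star|exact: comp_star].
  apply: le_anti; apply/andP; split; apply: comp_lub; try exact: nn; move=> i.
    by rewrite e; exact: comp_le.
  by rewrite -e; exact: comp_le.
have sa n (y : 'M[S]_n) : mcone y -> mstar y = y.
  move=> /comp_coneP yc; apply/matrixP => k l; apply: comp_ext => i.
  rewrite !mxE comp_star; have /matrixP /(_ k l) := matmo_cone_sa (yc i).
  by rewrite !mxE.
split; last first.
  move=> n y /comp_coneP yc /comp_coneP nyc; apply/matrixP => k l; apply: comp_ext => i.
  have nyi := nyc i; rewrite (map_linN (@comp_lin i)) in nyi.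
  have /matrixP /(_ k l) := matmo_cone_proper (yc i) nyi.
  by rewrite !mxE (lin0 (@comp_lin i)).
split; [exact: oS|exact: iS|exact: nS|].
apply: (family_matrix_cone (om := comp)); [exact: oS|exact: iS|exact: nS| | |].
- by move=> i; split; [exact: comp_lin|exact: comp_star].
- by move=> i; exists 1 => n y; rewrite mul1r; exact: comp_le.
- move=> n y; split=> [yc|[_ h]]; last exact: (iffRL (comp_coneP y)).
  by split; [exact: sa|exact: (iffLR (comp_coneP y))].
Qed.

End OperatorSystemIsMos.

Section SubspaceSmos.
Variables (R : realType) (X : modata R) (V : saspace X).
Local Notation C := R[i].
Hypothesis sX : is_smos X.

Let lval : linear (val : submo V -> X).
Proof. by move=> a x y; rewrite subl_valD subl_valZ. Qed.

Let mval_inj n (x y : 'M[submo V]_n) :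
  map_mx (val : submo V -> X) x = map_mx (val : submo V -> X) y -> x = y.
Proof.
move=> /matrixP e; apply/matrixP => i j; apply: val_inj.
by have := e i j; rewrite !mxE.
Qed.

Let mval_star n (x : 'M[submo V]_n) :
  map_mx (val : submo V -> X) (mstar x) = mstar (map_mx (val : submo V -> X) x).
Proof. exact: map_mstar. Qed.

Let mval_act n k (a b : 'I_k -> 'M[C]_n) (x : 'I_k -> 'M[submo V]_n) :
  map_mx (val : submo V -> X) (\sum_i mxact (a i) (x i) (b i)) =
  \sum_i mxact (a i) (map_mx (val : submo V -> X) (x i)) (b i).
Proof.
by rewrite (map_lin_sum lval); apply: eq_bigr => i _; exact: (map_lin_mxact lval).
Qed.

(** Needed for a predual as a subspace of the dual of D, and for the range of [kappa] as a subspace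
    of the bidual of S. *)
Lemma submo_smos : is_smos (submo V).
Proof.
have [[nD nZ n0 nc nA] [sD sZ sK] nS [csa cc ccl cA]] := sX.
split.
- split.
  + move=> n x y; rewrite [leLHS]/mnorm /= (map_linD lval); exact: nD.
  + move=> n a x; rewrite [LHS]/mnorm /= (map_linZ lval); exact: nZ.
  + move=> n x h; apply: mval_inj; rewrite (map_lin0 lval); exact: n0.
  + move=> n x; rewrite [LHS]/mnorm /= (map_lin_corner lval); exact: nc.
  + move=> n k a b x; rewrite [leLHS]/mnorm /= mval_act; exact: nA.
- split.
  + move=> x y; apply: val_inj; rewrite [RHS]subl_valD -[LHS]/(star (val (x + y))) subl_valD; exact: sD.
  + move=> a x; apply: val_inj; rewrite [RHS]subl_valZ -[LHS]/(star (val (a *: x))) subl_valZ; exact: sZ.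
  + move=> x; apply: val_inj; exact: sK.
- move=> n x; rewrite [LHS]/mnorm /= mval_star; exact: nS.
- split.
  + move=> n x xc; apply: mval_inj; rewrite mval_star; exact: csa.
  + move=> n x; rewrite [X in X <-> _]/mcone /= (map_lin_corner lval); exact: cc.
  + move=> n x h; apply: ccl => e e0; have [y yc yx] := h e e0.
    exists (map_mx (val : submo V -> X) y); first exact: yc.
    by rewrite -(map_linB lval).
  + move=> n k a x h; rewrite [mcone _]/mcone /= mval_act; exact: cA.
Qed.

End SubspaceSmos.

Section ImageSystem.
Variables (R : realType) (X : modata R) (G : saspace X).
Variables (H : hilbert R) (V : saspace (BH H)) (phi : X -> submo V).
Local Notation C := R[i].
Hypotheses (sX : is_smos X) (mphi : mos_iso phi).

Let lphi : linear phi. Proof. by case: mphi => _ [[]]. Qed.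
Let sphi x : phi (star x) = star (phi x). Proof. by case: mphi => _ [[_ h] _ _] _; exact: h. Qed.

Definition image_set : set (BH H) := [set y | exists2 f, lset G f & y = val (phi f)].

Fact image_set0 : image_set 0.
Proof. by exists 0; [exact: lset0|rewrite (lin0 lphi) subl_val0]. Qed.

Fact image_setZD (a : C) u v : image_set u -> image_set v -> image_set (a *: u + v).
Proof.
move=> [f Gf ->] [g Gg ->]; exists (a *: f + g); first exact: lsetZD.
by rewrite lphi subl_valD subl_valZ.
Qed.

Fact image_set_star u : image_set u -> image_set (star u).
Proof.
move=> [f Gf ->]; exists (star f); first exact: sas_star.
by rewrite sphi.
Qed.

Definition image_system : opsys R :=
  Opsys (@SASpace R (BH H) (LSpace image_set0 image_setZD) image_set_star).

Lemma image_system_mos : is_mos image_system.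
Proof.
apply: opsys_mos => y; have [f _ ->] : image_set (val y) := set_mem (valP y).
have sK : star (star f) = f by case: sX => _ [].
have e : star (star (phi f)) = phi f by rewrite -!sphi sK.
by rewrite -[val (phi f)]/(incl (phi f)) -!incl_star e.
Qed.

Fact image_in (f : submo G) : val (phi (incl f)) \in lset (sas_lspace (opsys_space image_system)).
Proof. by apply/mem_set; exists (incl f); first exact: inclP. Qed.

Definition image_map (f : submo G) : image_system := Subl (image_in f).

Lemma incl_image_map f : incl (image_map f) = incl (phi (incl f)).
Proof. by []. Qed.

Lemma map_image_map n (f : 'M[submo G]_n) :
  map_mx (@incl _ _ _) (map_mx image_map f) =
  map_mx (@incl _ _ V) (map_mx phi (map_mx (@incl _ _ G) f)).
Proof.
apply/matrixP => i j; rewrite mxE [in LHS]mxE [RHS]mxE [in RHS]mxE [in RHS]mxE.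
exact: incl_image_map.
Qed.

Lemma image_map_iso : mos_iso image_map.
Proof.
have [_ [_ inj pos] [[M hM] [c c0 hc]]] := mphi.
have injI : injective image_map.
  by move=> f g /(congr1 (@incl _ _ _)); rewrite !incl_image_map => /incl_inj /inj /incl_inj.
have surjI y : exists f, image_map f = y.
  have [f Gf e] : image_set (incl y) := inclP y; have [g gf] := incl_surj Gf.
  by exists g; apply: incl_inj; rewrite incl_image_map gf e.
have [k kK] := choice surjI.
split; first by exists k => [f|y]; [apply: injI; rewrite kK|rewrite kK].
  split; [split|exact: injI|].
  - move=> a f g; apply: incl_inj; rewrite (incl_lin a (image_map f) (image_map g)).
    by rewrite !incl_image_map (incl_lin a f g) lphi (incl_lin a (phi (incl f)) (phi (incl g))).
  - move=> f; apply: incl_inj; rewrite incl_star !incl_image_map !incl_star sphi.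
    exact: incl_star.
  - move=> n f fs; apply: (iff_trans (incl_coneP f)).
    apply: iff_sym; apply: (iff_trans (incl_coneP _)); rewrite map_image_map.
    apply: (iff_trans (iff_sym (incl_coneP _))); apply: iff_sym; apply: pos.
    by have e := map_mstar f (@incl_star _ _ G); rewrite fs in e; exact: esym e.
split.
  by exists M => n f; rewrite [leLHS]incl_norm map_image_map [X in _ * X]incl_norm; exact: hM.
by exists c => // n f; rewrite [leRHS]incl_norm map_image_map [X in _ * X]incl_norm; exact: hc.
Qed.

End ImageSystem.

Section PredualMap.
Variables (R : realType) (D : modata R) (F : saspace (dual D)).
Local Notation C := R[i].
Hypothesis sD : is_smos D.

Let oD := smos_os sD.
Let sF : is_smos (submo F). Proof. exact/submo_smos/dual_smos. Qed.

Lemma predual_mapE x (f : submo F) : val (predual_map F x) f = val (incl f) x.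
Proof.
have b : bounded_functional (fun f : submo F => val (incl f) x).
  split; first by move=> a f' g; rewrite (incl_lin a f' g) dual_valD dual_valZ.
  exists (nrm x) => f'; rewrite sub_nrm mulrC; exact: dual_apply_le.
by rewrite /predual_map (dual_val b).
Qed.

Lemma predual_map_lin : linear (predual_map F).
Proof.
by move=> a x y; apply: dual_eq => f; rewrite dual_valD dual_valZ !predual_mapE dual_lin.
Qed.

Lemma predual_map_star x : predual_map F (star x) = star (predual_map F x).
Proof.
apply: dual_eq => f; rewrite (dual_starE sF) !predual_mapE.
by rewrite incl_star (dual_starE sD) conjcK.
Qed.

Lemma theta_predual_map n (x : 'M[D]_n) m (f : 'M[submo F]_m) :
  map_mx (theta (map_mx (predual_map F) x)) f = map_mx (evmx x) (map_mx (@incl _ _ F) f).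
Proof.
apply/matrixP => i j; rewrite mxE [RHS]mxE; apply/matrixP => a b.
rewrite [LHS]mxE [RHS]mxE.
have e1 := map_mx_entry (predual_map F) x a b.
have e2 := map_mx_entry (@incl _ _ F) f i j.
apply: (etrans (congr1 (fun g : dual (submo F) => val g (f i j)) e1)).
apply: (etrans (predual_mapE _ _)).
exact: (congr1 (fun g : dual D => val g (x a b)) (esym e2)).
Qed.

Lemma predual_map_pos n (x : 'M[D]_n) : mcone x -> mcone (map_mx (predual_map F) x).
Proof.
move=> xc; apply: (iffRL (dual_coneP sF _)); split.
  rewrite -map_mstar; last exact: predual_map_star.
  by rewrite (smos_cone_sa sD xc).
move=> m f fc; rewrite theta_predual_map; apply: (iffRL (evmx_cone _ _)).
have [_ h] := iffLR (dual_coneP sD (map_mx (@incl _ _ F) f)) fc; exact: (h n x xc).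
Qed.

(* The compressions of a weak* representation have their entries in F, and they
   detect the cone. *)
Lemma predual_map_reflects_cone (H : hilbert R) (V : saspace (BH H)) (rho : D -> submo V) :
  mos_iso rho -> whomeo (lset F) (Defs.restrict (BH_predual H) V) rho ->
  injective (predual_map F) ->
  forall n (x : 'M[D]_n), mcone (map_mx (predual_map F) x) -> mcone x.
Proof.
move=> mrho wrho inj n x xc.
have [ps h] := iffLR (dual_coneP sF _) xc.
have xs : mstar x = x.
  move: ps; rewrite -map_mstar; last exact: predual_map_star.
  by move=> /matrixP e; apply/matrixP => i j; apply: inj; have := e i j; rewrite !mxE.
apply: (iffRL (rep_cone mrho xs)); apply: (iffRL (compression_coneP _)) => m e he.
rewrite -map_rep_compression.
have [lc sc] := rep_compression_star_linear sD mrho e.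
have mem a b : exists f : submo F, forall y, val (incl f) y = rep_compression rho e y a b.
  have [f Ff fE] : exists2 f, lset F f & (fun y => rep_compression rho e y a b : C^o) = val f.
    apply: wstar_continuous_mem; last exact: (rep_compression_continuous wrho).
    by move=> k y z; rewrite lc !mxE.
  have [f' ff'] := incl_surj Ff; exists f' => y; rewrite ff'.
  exact: (congr1 (fun h : D -> C^o => h y) (esym fE)).
have [g gE] := choice (fun ab : 'I_m.+1 * 'I_m.+1 => mem ab.1 ab.2).
pose f : 'M[submo F]_m.+1 := \matrix_(a, b) g (a, b).
have fE k (y : 'M[D]_k) : map_mx (theta (map_mx (@incl _ _ F) f)) y = map_mx (rep_compression rho e) y.
  apply/matrixP => i j; rewrite mxE [RHS]mxE; apply/matrixP => a b.
  rewrite [LHS]mxE.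
  have -> : map_mx (@incl _ _ F) f a b = incl (g (a, b)) by rewrite mxE [f a b]mxE.
  exact: gE.
have fc : mcone f.
  apply: (iffRL (dual_coneP sD (map_mx (@incl _ _ F) f))); split.
    have fab a b : map_mx (@incl _ _ F) f a b = incl (g (a, b)) by rewrite mxE [f a b]mxE.
    apply/matrixP => a b; apply: dual_eq => y; rewrite mxE [X in star X]mxE !fab (dual_starE sD) !gE.
    by rewrite sc mxE; apply: etrans (conjcK _) _; exact: mxE.
  by move=> k y yc; rewrite fE; exact: (rep_compression_pos sD mrho he yc).
have := h m.+1 f fc; rewrite theta_predual_map => /evmx_cone.
by rewrite fE.
Qed.

End PredualMap.

Section Transport.
Variable R : realType.

Lemma CBp_id (X : modata R) : CBp (id : X -> X).
Proof.
have mid n (x : 'M[X]_n) : map_mx id x = x by apply/matrixP => i j; rewrite mxE.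
split; last by exists 1 => n x; rewrite mid mul1r.
by split; [split|move=> n x; rewrite mid].
Qed.

Lemma CBp_cone_iff (X Y : modata R) (phi : X -> Y) (psi : Y -> X) :
  cancel phi psi -> CBp phi -> CBp psi ->
  forall n (x : 'M[X]_n), mcone x <-> mcone (map_mx phi x).
Proof.
move=> fK [[_ p] _] [[_ q] _] n x; split; first exact: p.
move=> /q; have -> : map_mx psi (map_mx phi x) = x; last exact.
by apply/matrixP => i j; rewrite !mxE fK.
Qed.

Lemma wcontinuous_closed (D E : modata R) (F : set (dual D)) (G : set (dual E))
    (phi : D -> E) n (A : set 'M[E]_n) : wcontinuous F G phi ->
  closed (A : set 'M[wstar G]_n) ->
  closed ([set x | A (map_mx phi x)] : set 'M[wstar F]_n).
Proof.
move=> c clA x hx; apply: clA => B [P MP PB].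
have nx : nbhs (x : 'M[wstar F]_n) [set y | B (map_mx phi y)].
  exists (fun i j => phi @^-1` P i j).
    by move=> i j; apply: c; have := MP i j; rewrite map_mx_entry.
  by move=> y hy; apply: PB => i j; rewrite map_mx_entry; exact: hy.
by have [y [Ay By]] := hx _ nx; exists (map_mx phi y).
Qed.

End Transport.

(** * From the predual of D to a dualizable operator system *)

Section DualizableOfPredual.
Variables (R : realType) (D : modata R) (F : saspace (dual D)) (S : opsys R).
Local Notation C := R[i].
Hypotheses (mS : is_mos S) (dqF : is_dual_quasi_opsys F).
Variables (e : D -> dual S) (e' : dual S -> D).
Variables (j : submo F -> S) (k : S -> submo F).
Hypotheses (eK : cancel e e') (e'K : cancel e' e) (ce : CBp e) (ce' : CBp e').
Hypothesis jK : cancel j k.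
Hypothesis eE : forall x s, val (e x) s = val (incl (k s)) x.

Let sS : is_smos S. Proof. by case: mS. Qed.
Let oS := smos_os sS.
Let sS' : is_smos (dual S). Proof. exact: dual_smos. Qed.
Let oS' := smos_os sS'.
Let sD : is_smos D. Proof. by case: dqF => [[[]]]. Qed.
Let oD := smos_os sD.

(** By [eE], e is the dual of k once D is read as the dual of F. Evaluations at points of S thus
    correspond to elements of F, which gives continuity both of e and of e'. *)
Let we : wcontinuous (lset F) (range (kappa S)) e.
Proof.
apply/wcontinuousP => _ [s _ <-].
have E : (fun x => val (kappa S s) (e x)) = val (incl (k s)).
  by apply/funext => x; rewrite (kappaE oS) eE.
rewrite E; apply: wstar_eval_continuous; exact: inclP.
Qed.

Let we' : wcontinuous (range (kappa S)) (lset F) e'.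
Proof.
apply/wcontinuousP => g Fg; have [f fg] := incl_surj Fg.
have E : (fun u => val g (e' u)) = val (kappa S (j f)).
  by apply/funext => u; rewrite (kappaE oS) -{2}(e'K u) eE jK fg.
by rewrite E; apply: wstar_eval_continuous; exists (j f).
Qed.

Fact kappa_range0 : range (kappa S) 0.
Proof. by exists 0; [|exact: kappa0]. Qed.

Fact kappa_rangeZD (a : C) u v :
  range (kappa S) u -> range (kappa S) v -> range (kappa S) (a *: u + v).
Proof. by move=> [s _ <-] [t _ <-]; exists (a *: s + t); [|exact: kappaD]. Qed.

Fact kappa_range_star u : range (kappa S) u -> range (kappa S) (star u).
Proof.
move=> [s _ <-]; exists (star s); first by [].
have [_ _ sK] := smos_star_lin sS.
by apply: dual_eq => f; rewrite (kappaE oS) (dual_starE sS') (kappaE oS) (dual_starE sS) conjcK.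
Qed.

Definition kappa_space : saspace (dual (dual S)) :=
  SASpace (sas_lspace := LSpace kappa_range0 kappa_rangeZD) kappa_range_star.

Let K (s : S) : submo kappa_space :=
  Subl (V := kappa_space) (mem_set (ex_intro2 _ _ s I erefl)).

Let KE s : incl (K s) = kappa S s. Proof. by []. Qed.

Let K_surj (x : submo kappa_space) : exists s, x = K s.
Proof.
have [s _ h] : range (kappa S) (incl x) := inclP x.
by exists s; apply: incl_inj; rewrite KE h.
Qed.

Let K_norm n (s : 'M[S]_n) : mnorm (map_mx K s) = mnorm s.
Proof.
rewrite incl_norm; have -> : map_mx (@incl _ _ kappa_space) (map_mx K s) = map_mx (kappa S) s.
  exact: map_mx_comp_ext KE.
exact: kappa_isometry.
Qed.

(** Pulling back along e sends [kappa S s] to k s in F and is bounded, so limits go to limits; F is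
    norm closed in the dual of D, and the element of F obtained comes from a point of S. *)
Let kappa_closed : norm_closed (lset kappa_space).
Proof.
move=> g h; have [[[ _ ncF _ _ _] _] _] := dqF.
have [[[le _] _] be] := ce.
have [M M0 hM] := cb_bound (dual_operator_space oS') (dual_map_cb oD oS' le be).
have Fg : lset F (dual_map e g).
  apply: ncF => eps eps0; have [_ [s _ <-] hs] := h _ (divr_gt0 eps0 M0).
  exists (incl (k s)); first exact: inclP.
  have -> : dual_map e g - incl (k s) = dual_map e (g - kappa S s).
    apply: dual_eq => x; rewrite dual_valB !(dual_mapE oD oS' le be) dual_valB (kappaE oS).
    by rewrite eE.
  have := hM 1%N (const_mx (g - kappa S s)); rewrite map_const_mx => hn.
  by apply: le_lt_trans hn _; rewrite mulrC -ltr_pdivlMr.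
have [f fg] := incl_surj Fg; exists (j f); first by [].
apply: dual_eq => u; rewrite (kappaE oS) -(e'K u) eE jK fg.
by rewrite (dual_mapE oD oS' le be).
Qed.

Let sK : is_smos (submo kappa_space). Proof. exact/submo_smos/dual_smos. Qed.
Let oK := smos_os sK.

Let predual_K u s : val (predual_map kappa_space u) (K s) = val u s.
Proof. by rewrite (predual_mapE sS') KE (kappaE oS). Qed.

Let K_lin : linear K.
Proof. by move=> a s t; apply: incl_inj; rewrite (incl_lin a (K s) (K t)) !KE; exact: kappaD. Qed.

Let kappa_onto (h : dual (submo kappa_space)) : exists u, predual_map kappa_space u = h.
Proof.
have b : bounded_functional (fun s => val h (K s)).
  split; first by move=> a s t; rewrite K_lin (dual_lin h).
  have [_ [M hM]] := dualP h; exists M => s; apply: le_trans (hM _) _.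
  by have := K_norm (const_mx s : 'M[S]_1); rewrite map_const_mx /nrm => ->.
exists (insubd 0 (fun s => val h (K s))); apply: dual_eq => y.
by have [s ->] := K_surj y; rewrite predual_K (dual_val b).
Qed.

Let theta_K n (u : 'M[dual S]_n) m (s : 'M[S]_m) :
  map_mx (theta (map_mx (predual_map kappa_space) u)) (map_mx K s) = map_mx (theta u) s.
Proof.
apply: map_mx_comp_ext => y; apply/matrixP => a b; rewrite mxE [RHS]mxE map_mx_entry.
exact: predual_K.
Qed.

(** An exact isometry, which transport from D could not give since e is only bounded in both
    directions. It follows instead from [kappa] being completely isometric on an operator system. *)
Let kappa_iso : complete_isometry (predual_map kappa_space).
Proof.
move=> n u; apply: le_anti; apply/andP; split.
  apply: (dual_norm_lub oK); first exact: (dual_norm_ge0 oS).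
  move=> m x; have [s ->] := map_mx_surj K_surj x.
  by rewrite theta_K K_norm; exact: (dual_norm_bound oS).
apply: (dual_norm_lub oS); first exact: (dual_norm_ge0 oK).
by move=> m s; rewrite -theta_K -(K_norm s); exact: (dual_norm_bound oK).
Qed.

Let cone_iff n (u : 'M[dual S]_n) : mcone u <-> mcone (map_mx e' u).
Proof. exact: (CBp_cone_iff e'K ce' ce). Qed.

(** The cone over the dual of S is the preimage of the cone over D under e', and e' is
    weak*-continuous. *)
Let cone_closed n : closed ([set u | mcone u] : set 'M[wstar (lset kappa_space)]_n).
Proof.
have [[[_ _ _ _ cl] _] _] := dqF.
have -> : [set u : 'M[dual S]_n | mcone u] = [set u | mcone (map_mx e' u)].
  by apply/seteqP; split=> u; [exact: (iffLR (cone_iff u))|exact: (iffRL (cone_iff u))].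
exact: (wcontinuous_closed (A := [set x | mcone x]) we' (cl n)).
Qed.

Let dual_mos : is_mos (dual S).
Proof.
split; first exact: sS'.
have [[_ [_ proper]] _] := dqF; have [[[le' _] _] _] := ce'.
move=> n u uc nuc.
have z : map_mx e' u = 0.
  apply: proper; first exact: (iffLR (cone_iff u)).
  by rewrite -(map_linN le'); exact: (iffLR (cone_iff (- u))).
apply/matrixP => a b; apply: (can_inj e'K); rewrite mxE (lin0 le').
have := congr1 (fun A : 'M[D]_n => A a b) z.
by rewrite map_mx_entry mxE.
Qed.

Lemma dualizable_of_predual : dualizable S.
Proof.
split.
  split; first exact: mS.
  exists S, id.
  by apply: (mos_iso_intro (psi := id) oS); [| |exact: CBp_id|exact: CBp_id].
exists kappa_space; split; first by [].
split.
  split; last exact: dual_mos.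
  by split; [exact: sS'|exact: kappa_closed|exact: kappa_onto|exact: kappa_iso|exact: cone_closed].
have [_ [H [V [rho [clV mrho wrho]]]]] := dqF.
exists H, V, (rho \o e'); split; first exact: clV.
  apply: (mos_iso_comp sS' _ mrho).
  exact: (mos_iso_intro oD e'K eK ce' ce).
have [sigma [rK sgK c1 c2]] := wrho.
exists (e \o sigma); split.
- by move=> u /=; rewrite rK e'K.
- by move=> v /=; rewrite eK sgK.
- exact: wcontinuous_comp we' c1.
- exact: wcontinuous_comp c2 we.
Qed.

Lemma td_iso_of_predual : exists psi : td S -> D,
  mos_iso psi /\ whomeo (td_predual S) (lset F) psi.
Proof.
have dS := dualizable_of_predual.
have [wmu [inv [mK Km cinv winv]]] := mu_td_iso dS.
have c1 : cancel (e' \o inv) (mu_td S \o e) 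
  by move=> u; exact: (etrans (congr1 (mu_td S) (e'K (inv u))) (Km u)).
have c2 : cancel (mu_td S \o e) (e' \o inv) 
  by move=> x; exact: (etrans (congr1 e' (mK (e x))) (eK x)).
exists (e' \o inv); split.
  apply: (mos_iso_intro oD c1 c2).
    exact: (CBp_comp oS' cinv ce').
  exact: (CBp_comp oS' ce (mu_td_CBp dS)).
apply: (whomeo_inverse c1 c2); first exact: wcontinuous_comp winv we'.
exact: wcontinuous_comp we wmu.
Qed.

End DualizableOfPredual.

Section PredualMapInverse.
Variables (R : realType) (D : modata R) (F : saspace (dual D)).
Hypothesis dqF : is_dual_quasi_opsys F.

Let sD : is_smos D. Proof. by case: dqF => [[[]]]. Qed.
Let sF : is_smos (submo F). Proof. exact/submo_smos/dual_smos. Qed.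
Let oD := smos_os sD.
Let oF' : is_operator_space (dual (submo F)). Proof. by apply: dual_operator_space; case: sF. Qed.

Let iso : complete_isometry (predual_map F). Proof. by case: dqF => [[[]]]. Qed.

Lemma predual_map_CBp : CBp (predual_map F).
Proof.
split; last by exists 1 => n x; rewrite mul1r iso.
split; last by move=> n x; exact: (predual_map_pos F sD).
by split; [exact: (predual_map_lin F sD)|exact: (predual_map_star F sD)].
Qed.

Lemma predual_map_inj : injective (predual_map F).
Proof.
have lp := predual_map_lin F sD.
move=> x y exy; apply/eqP; rewrite -subr_eq0; apply/eqP; apply: (nrm_eq0 oD).
have := iso (const_mx (x - y) : 'M[D]_1); rewrite map_const_mx (linB lp) exy subrr => h.
rewrite /nrm -h; have -> : const_mx 0 = 0 :> 'M[dual (submo F)]_1.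
  by apply/matrixP => i j; rewrite !mxE.
exact: (os_norm0 oF').
Qed.

(** A dual SMOS supplies only a surjective isometry onto the dual of its predual; that the inverse
    is positive too rests on a weak* representation of D. *)
Lemma predual_map_inverse : exists q : dual (submo F) -> D,
  [/\ cancel (predual_map F) q, cancel q (predual_map F) & CBp q].
Proof.
have [[[_ _ onto _ _] _] [H [V [rho [_ mrho wrho]]]]] := dqF.
have [q qK] := choice onto.
have Kq : cancel (predual_map F) q by move=> x; apply: predual_map_inj; rewrite qK.
have mK n (u : 'M[dual (submo F)]_n) : map_mx (predual_map F) (map_mx q u) = u.
  by apply/matrixP => i j; rewrite !mxE qK.
exists q; split; [exact: Kq|exact: qK|].
split; last by exists 1 => n u; rewrite mul1r -iso mK.
split.
  split; first exact: (lin_inverse (predual_map_lin F sD) Kq qK).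
  by move=> u; apply: predual_map_inj; rewrite (predual_map_star F sD) !qK.
move=> n u uc; apply: (predual_map_reflects_cone sD mrho wrho predual_map_inj).
by rewrite mK.
Qed.

End PredualMapInverse.

Section PredualSystem.
Variables (R : realType) (D : modata R) (F : saspace (dual D)).

Lemma predual_system : is_dual_quasi_opsys F -> dualizable D ->
  exists S0 : opsys R, dualizable S0 /\
    exists psi : td S0 -> D, mos_iso psi /\ whomeo (td_predual S0) (lset F) psi.
Proof.
(* Here rho represents the dual of D and exists because D is dualizable; the representation of D
   itself sits in [dqF]. *)
move=> dqF [_ [F2 [_ [_ [H [V [rho [_ mrho _]]]]]]]].
have sD : is_smos D by case: dqF => [[[]]].
have sD' := dual_smos sD.
have sF : is_smos (submo F) := submo_smos F sD'.
have oF := smos_os sF.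
pose S0 := image_system F mrho.
have mS0 : is_mos S0 := image_system_mos F sD' mrho.
have sS0 : is_smos S0 by case: mS0.
have oS0 := smos_os sS0.
have jiso := image_map_iso F mrho; pose j : submo F -> S0 := image_map mrho (G := F).
have cj : CBp j := mos_iso_CBp (smos_cone_sa sF) jiso.
have [k [jK kK ck]] : exists k : S0 -> submo F, [/\ cancel j k, cancel k j & CBp k] :=
  mos_iso_inverse (smos_cone_sa sS0) jiso.
have [q [Kq qK cq]] := predual_map_inverse dqF.
have cp := predual_map_CBp dqF.
have [[[lj _] _] bj] := cj; have [[[lk _] _] bk] := ck.
(* D is the dual of F by [predual_map], and F is isomorphic to S0 by j; composing with the duals of
   k and j identifies D with the dual of S0. *)
pose e : D -> dual S0 := @dual_map R S0 (submo F) k \o predual_map F.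
pose e' : dual S0 -> D := q \o @dual_map R (submo F) S0 j.
have oF' := dual_operator_space oF.
have ce : CBp e by exact: CBp_comp oF' cp (dual_map_CBp sS0 sF ck).
have ce' : CBp e' by exact: CBp_comp oF' (dual_map_CBp sF sS0 cj) cq.
have jkK f : dual_map j (dual_map k f) = f.
  by apply: dual_eq => g; rewrite (dual_mapE oF oS0 lj bj) (dual_mapE oS0 oF lk bk) jK.
have kjK u : dual_map k (dual_map j u) = u.
  by apply: dual_eq => g; rewrite (dual_mapE oS0 oF lk bk) (dual_mapE oF oS0 lj bj) kK.
have eK : cancel e e' by move=> x; exact: (etrans (congr1 q (jkK _)) (Kq x)).
have e'K : cancel e' e.
  by move=> u; exact: (etrans (congr1 (@dual_map R S0 (submo F) k) (qK _)) (kjK u)).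
have eE x s : val (e x) s = val (incl (k s)) x.
  exact: (etrans (dual_mapE oS0 oF lk bk _ _) (predual_mapE sD _ _)).
exists S0; split; first exact: (dualizable_of_predual mS0 dqF eK e'K ce ce' jK eE).
exact: (td_iso_of_predual mS0 dqF eK e'K ce ce' jK eE).
Qed.

End PredualSystem.

Theorem theorem3p16 (R : realType) (S T : opsys R)
    (dualS : dualizable S) (dualT : dualizable T) :
  (* (a) *)
  (forall phi : S -> T, CBp phi ->
     (exists! chi : td T -> td S,
        CBpw (td_predual T) (td_predual S) chi /\
        chi \o mu_td T = mu_td S \o dual_map phi) /\
     (CCp phi -> CCpw (td_predual T) (td_predual S) (phid phi))) /\
  (* (b) *)
  set_bij (@CBp R S T) (CBpw (td_predual T) (td_predual S)) (@phid R S T) /\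
  (* (c) *)
  ((forall phi : S -> T, mos_iso phi ->
      mos_iso (phid phi) /\ whomeo (td_predual T) (td_predual S) (phid phi)) /\
   (forall chi : td T -> td S,
      wcontinuous (td_predual T) (td_predual S) chi -> mos_iso chi ->
      exists phi : S -> T, mos_iso phi /\ chi = phid phi)) /\
  (* (d) *)
  (forall (D : modata R) (F : saspace (dual D)),
     is_dual_opsys F -> dualizable D ->
     exists S0 : opsys R, dualizable S0 /\
       exists psi : td S0 -> D,
         mos_iso psi /\ whomeo (td_predual S0) F psi) /\
  (* (e) *)
  (complete_isometry (tau S \o kappa S) ->
   complete_isometry (tau T \o kappa T) ->
   forall chi : td T -> td S,
     CCpw (td_predual T) (td_predual S) chi ->
     exists phi : S -> T,
       [/\ CCp phi, chi = phid phi &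
           complete_isometry chi -> mos_iso chi ->
           complete_isometry phi /\ mos_iso phi]).
Proof.
split.
  move=> phi cphi; split.
    exists (phid phi); split; first exact: (phidP dualS dualT cphi).
    by move=> chi hchi; exact: (esym (phid_eq dualS dualT cphi hchi)).
  move=> [_ cc]; have [[[pchi _] wchi] _] := phidP dualS dualT cphi.
  split; [split; [exact: pchi|]|exact: wchi].
  exact: (phid_contraction dualS dualT cphi cc).
split.
  split.
  - by move=> phi cphi; have [h _] := phidP dualS dualT cphi; exact: h.
  - move=> phi phi' /set_mem c /set_mem c'; exact: (phid_inj dualS dualT c c').
  - move=> chi hchi; have [phi c ->] := phid_surj dualS dualT hchi.
    by exists phi.
split.
  split; first by move=> phi; exact: (mos_iso_phid dualS dualT).
  move=> chi wchi miso.
  have cchi : CBp chi := mos_iso_CBp (fun n (u : 'M[td T]_n) => @td_cone_sa _ _ _ _ u) miso.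
  have [phi c chiE] := phid_surj dualS dualT (conj cchi wchi).
  exists phi; split; last exact: chiE.
  by apply: (phid_reflects_mos_iso dualS dualT c); rewrite -chiE.
split.
  move=> D F [dF [H [V [rho [wrep _]]]]] dD; apply: predual_system dD.
  by split; [exact: dF|exists H, V, rho].
move=> iS iT chi [[pchi cc] wchi].
have cchi : CBp chi by split; [exact: pchi|exists 1 => n u; rewrite mul1r; exact: cc].
have [phi c chiE] := phid_surj dualS dualT (conj cchi wchi).
exists phi; split; [|exact: chiE|].
  split; first by case: c.
  by apply: (phid_reflects_contraction dualS dualT iS iT c); rewrite -chiE.
by rewrite chiE; exact: (phid_reflects_isometry dualS dualT iS iT c).
Qed.
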